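(* Let $0<|q|<1$ and consider the fuchsian $q$-difference equation $$\Big[(1-q^{Q\partial_Q})^4-Q\prod_{i=1}^4\big(1-q^{\frac i5}q^{Q\partial_Q}\big)\Big]F(Q)=0.\qquad(\ast)$$ Define $X_b(q,Q)$, $b=0,1,2,3$, by $$\sum_{d=0}^\infty\frac{\prod_{i=1}^4(Pq^{\frac i5};q)_d}{(Pq;q)_d^4}Q^d\equiv\sum_{b=0}^3X_b(q,Q)(1-P)^b\pmod{(1-P)^4}.$$ Then $4$ solutions of $(\ast)$ at $Q=0$ are given by $$\sum_{a+b=m}(-1)^a\binom{\ell_q(Q)}{a}X_b(q,Q),\qquad m=0,1,2,3,$$ and $4$ solutions of $(\ast)$ at $Q=\infty$ are given by $$W_1(1/Q)=e_{q,q^{1/5}}(1/Q)\,{}_4\phi_3\big(q^{\frac15},q^{\frac15},q^{\frac15},q^{\frac15};q^{\frac45},q^{\frac35},q^{\frac25};q;q^2/Q\big),$$ $$W_2(1/Q)=e_{q,q^{2/5}}(1/Q)\,{}_4\phi_3\big(q^{\frac25},q^{\frac25},q^{\frac25},q^{\frac25};q^{\frac65},q^{\frac45},q^{\frac35};q;q^2/Q\big),$$ $$W_3(1/Q)=e_{q,q^{3/5}}(1/Q)\,{}_4\phi_3\big(q^{\frac35},q^{\frac35},q^{\frac35},q^{\frac35};q^{\frac75},q^{\frac65},q^{\frac45};q;q^2/Q\big),$$ $$W_4(1/Q)=e_{q,q^{4/5}}(1/Q)\,{}_4\phi_3\big(q^{\frac45},q^{\frac45},q^{\frac45},q^{\frac45};q^{\frac85},q^{\frac75},q^{\frac65};q;q^2/Q\big).$$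 The connection matrix is given by the following identities of meromorphic functions on $|q|^2<|Q|<1$. Writing $$C_k(Q)=\frac{\prod_{1\le i\le4,\,i\ne k}(q^{\frac i5};q)_\infty\;(q^{1-\frac k5};q)_\infty^3}{\prod_{1\le i\le4,\,i\ne k}(q^{\frac{i-k}5};q)_\infty\;(q;q)_\infty^3}\cdot\frac{\big(q^{\frac k5}Q,\,q^{\frac{5-k}5}/Q;q\big)_\infty}{(Q,q/Q;q)_\infty},$$ one has $$X_0(q,Q)=\sum_{k=1}^4C_k(Q)\,e^{-1}_{q,q^{k/5}}(1/Q)\,W_k(1/Q),$$ $$X_1(q,Q)=\sum_{k=1}^4C_k(Q)\big(\mathbb{G}^{(k)}_1+\mathbb{F}_1\big)e^{-1}_{q,q^{k/5}}(1/Q)\,W_k(1/Q),$$ $$X_2(q,Q)=\sum_{k=1}^4C_k(Q)\big(\mathbb{G}^{(k)}_2+\mathbb{F}_2+\mathbb{G}^{(k)}_1\mathbb{F}_1\big)e^{-1}_{q,q^{k/5}}(1/Q)\,W_k(1/Q),$$ $$X_3(q,Q)=\sum_{k=1}^4C_k(Q)\big(\mathbb{G}^{(k)}_3+\mathbb{F}_3+\mathbb{G}^{(k)}_2\mathbb{F}_1+\mathbb{G}^{(k)}_1\mathbb{F}_2\big)e^{-1}_{q,q^{k/5}}(1/Q)\,W_k(1/Q),$$ where $\mathbb{F}_b$ and $\mathbb{G}^{(k)}_b=\mathbb{G}^{(k)}_b(Q)$, $b=1,2,3$, are the expansion coefficients defined in the context.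
   Context: A fifth root $q^{1/5}$ of $q$ is fixed, $q^{i/5}=(q^{1/5})^i$. $q^{Q\partial_Q}:f(Q)\mapsto f(qQ)$. $(a;q)_d=\prod_{k=0}^{d-1}(1-aq^k)$ for $d\in\mathbb{N}\cup\{\infty\}$, $(a_1,\dots,a_r;q)_d=\prod_i(a_i;q)_d$, ${}_4\phi_3(a_1,a_2,a_3,a_4;b_1,b_2,b_3;q;x)=\sum_{d\ge0}\frac{(a_1,a_2,a_3,a_4;q)_d}{(q,b_1,b_2,b_3;q)_d}x^d$. $\theta_q(Q)=\sum_{d\in\mathbb{Z}}q^{d(d-1)/2}Q^d$; $\ell_q(Q)=-Q\theta_q'(Q)/\theta_q(Q)$; $\binom{\ell}{a}=\frac1{a!}\prod_{r=0}^{a-1}(\ell-r)$; $e_{q,\lambda}(Q)=\theta_q(Q)/\theta_q(\lambda Q)$, $e^{-1}_{q,\lambda}=1/e_{q,\lambda}$. Here $P$ is a variable; functions of $P$ holomorphic near $P=1$ are expanded in powers of $1-P$. The coefficients $\mathbb{F}_b$ and $\mathbb{G}^{(k)}_b$ are defined by $$\frac{\prod_{i=1}^4(Pq^{\frac i5};q)_\infty}{(Pq;q)_\infty^4}=\frac{\prod_{i=1}^4(q^{\frac i5};q)_\infty}{(q;q)_\infty^4}\Big[1+\sum_{b=1}^3\mathbb{F}_b(1-P)^b+O((1-P)^4)\Big],$$ $$\frac{\big(Pq^{\frac k5}Q,\;P^{-1}Q^{-1}q^{1-\frac k5};q\big)_\infty}{\big(Pq^{\frac k5},\;P^{-1}q^{1-\frac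 k5};q\big)_\infty}=\frac{\theta_q(-q^{\frac k5}Q)}{\theta_q(-q^{\frac k5})}\Big[1+\sum_{b=1}^3\mathbb{G}^{(k)}_b(1-P)^b+O((1-P)^4)\Big].$$ *)

(* Defs.v *)
(* Stdlib reals, with Coquelicot's complex numbers. *)
From Stdlib Require Import Reals ZArith List ClassicalEpsilon.
From Coquelicot Require Import Coquelicot.
Import ListNotations.
Open Scope C_scope.

(* Total limit and sum, meaningful only in case of convergence. *)
Definition Clim_seq (u : nat -> C) : C :=
  (real (Lim_seq (fun n => Re (u n))), real (Lim_seq (fun n => Im (u n)))).

Definition Csum (a : nat -> C) : C := Clim_seq (sum_n a).

Definition CsumZ (a : Z -> C) : C :=
  Csum (fun n => a (Z.of_nat n)) + Csum (fun n => a (- Z.of_nat (S n))%Z).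

Definition Cpowz (z : C) (n : Z) : C :=
  match n with
  | Z0 => 1
  | Zpos m => z ^ Pos.to_nat m
  | Zneg m => / (z ^ Pos.to_nat m)
  end.

Definition Cprod (l : list nat) (f : nat -> C) : C :=
  fold_right Cmult 1 (map f l).

Fixpoint qpoch (a q : C) (d : nat) : C :=
  match d with
  | O => 1
  | S k => qpoch a q k * (1 - a * q ^ k)
  end.

Definition qpoch_inf (a q : C) : C := Clim_seq (qpoch a q).

Definition phi43 (a1 a2 a3 a4 b1 b2 b3 q x : C) : C :=
  Csum (fun d =>
    (qpoch a1 q d * qpoch a2 q d * qpoch a3 q d * qpoch a4 q d)
    / (qpoch q q d * qpoch b1 q d * qpoch b2 q d * qpoch b3 q d) * x ^ d).

Definition theta (q Q : C) : C :=
  CsumZ (fun d => Cpowz q (d * (d - 1) / 2) * Cpowz Q d).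

Definition ell (q Q : C) : C := - Q * C_derive (theta q) Q / theta q Q.

Definition binomC (l : C) (a : nat) : C :=
  / RtoC (INR (fact a)) * Cprod (seq 0 a) (fun r => l - RtoC (INR r)).

Definition eq_lam (q lam Q : C) : C := theta q Q / theta q (lam * Q).

(* Holomorphy is complex differentiability at each point of a disc; a
   meromorphic function is locally a quotient of holomorphic ones.  Its value
   at the center of each disc is irrelevant, so that the (junk) values Rocq
   assigns at poles or at removable singularities play no role. *)
Definition holomorphic_disc (z0 : C) (r : R) (g : C -> C) : Prop :=
  forall z, (Cmod (z - z0) < r)%R ->
    ex_derive (K := C_AbsRing) (V := C_NormedModule) g z.

Definition meromorphic_on (D : C -> Prop) (f : C -> C) : Prop :=
  forall z0, D z0 -> exists (r : R) (g h : C -> C),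
    (0 < r)%R /\ holomorphic_disc z0 r g /\ holomorphic_disc z0 r h /\
    forall z, (0 < Cmod (z - z0) < r)%R -> h z <> 0 /\ f z = g z / h z.

(* Equality as meromorphic functions: the values agree near each point of D,
   that point possibly excepted, hence off a discrete subset of D. *)
Definition mero_eq (D : C -> Prop) (f g : C -> C) : Prop :=
  meromorphic_on D f /\ meromorphic_on D g /\
  forall z0, D z0 -> exists r : R, (0 < r)%R /\
    forall z, (0 < Cmod (z - z0) < r)%R -> f z = g z.

(* In this file p is the fixed fifth root of q, so that p ^ i = q^(i/5).
   one_sub_shift a q is the operator 1 - a q^(Q d/dQ). *)
Definition one_sub_shift (a q : C) (f : C -> C) : C -> C :=
  fun Q => f Q - a * f (q * Q).

Definition qdiff_op (q p : C) (f : C -> C) : C -> C :=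
  fun Q =>
    Nat.iter 4 (one_sub_shift 1 q) f Q
    - Q * one_sub_shift (p ^ 1) q (one_sub_shift (p ^ 2) q
            (one_sub_shift (p ^ 3) q (one_sub_shift (p ^ 4) q f))) Q.

(* The equation is required wherever Q, qQ, ..., q^4 Q all lie in the domain
   of the solution. *)
Definition qdiff_solution (q p : C) (D : C -> Prop) (f : C -> C) : Prop :=
  meromorphic_on D f /\
  mero_eq (fun Q => forall j : nat, (j <= 4)%nat -> D (q ^ j * Q))
          (qdiff_op q p f) (fun _ => 0).

(* f(P) = g(P) + O((1-P)^4) as P -> 1 *)
Definition eqmod4 (f g : C -> C) : Prop :=
  exists M eps : R, (0 < eps)%R /\
    forall P : C, (Cmod (P - 1) < eps)%R ->
      (Cmod (f P - g P) <= M * Cmod (1 - P) ^ 4)%R.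

(* Full expansion, and expansion normalized to leading coefficient A. *)
Definition expands (f : C -> C) (c : nat -> C) : Prop :=
  eqmod4 f (fun P => sum_n (fun b => c b * (1 - P) ^ b) 3).

Definition expands_norm (A : C) (f : C -> C) (c : nat -> C) : Prop :=
  eqmod4 f (fun P => A * (1 + sum_n_m (fun b => c b * (1 - P) ^ b) 1 3)).

(* "The" coefficients: they are unique for b <= 3 (resp. 1 <= b <= 3 and
   A <> 0) whenever an expansion exists. *)
Definition some_coef (E : (nat -> C) -> Prop) : nat -> C :=
  epsilon (inhabits (fun _ : nat => RtoC 0)) E.

Definition Xfun (q p Q P : C) : C :=
  Csum (fun d =>
    Cprod [1; 2; 3; 4]%nat (fun i => qpoch (P * p ^ i) q d)
    / qpoch (P * q) q d ^ 4 * Q ^ d).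

Definition X (q p : C) (b : nat) (Q : C) : C :=
  some_coef (expands (Xfun q p Q)) b.

Definition Ffun (q p P : C) : C :=
  Cprod [1; 2; 3; 4]%nat (fun i => qpoch_inf (P * p ^ i) q)
  / qpoch_inf (P * q) q ^ 4.

Definition Flead (q p : C) : C :=
  Cprod [1; 2; 3; 4]%nat (fun i => qpoch_inf (p ^ i) q) / qpoch_inf q q ^ 4.

Definition FF (q p : C) (b : nat) : C :=
  some_coef (expands_norm (Flead q p) (Ffun q p)) b.

Definition Gfun (q p : C) (k : nat) (Q P : C) : C :=
  (qpoch_inf (P * p ^ k * Q) q * qpoch_inf (/ P * / Q * p ^ (5 - k)) q)
  / (qpoch_inf (P * p ^ k) q * qpoch_inf (/ P * p ^ (5 - k)) q).

Definition Glead (q p : C) (k : nat) (Q : C) : C :=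
  theta q (- p ^ k * Q) / theta q (- p ^ k).

Definition GG (q p : C) (k b : nat) (Q : C) : C :=
  some_coef (expands_norm (Glead q p k Q) (Gfun q p k Q)) b.

Definition sol0 (q p : C) (m : nat) (Q : C) : C :=
  sum_n (fun a => (- (1)) ^ a * binomC (ell q Q) a * X q p (m - a) Q) m.

(* W_k as a function of x = 1/Q, for 1 <= k <= 4. *)
Definition W (q p : C) (k : nat) (x : C) : C :=
  match k with
  | 1%nat => eq_lam q (p ^ 1) x *
      phi43 (p ^ 1) (p ^ 1) (p ^ 1) (p ^ 1) (p ^ 4) (p ^ 3) (p ^ 2) q (q ^ 2 * x)
  | 2%nat => eq_lam q (p ^ 2) x *
      phi43 (p ^ 2) (p ^ 2) (p ^ 2) (p ^ 2) (p ^ 6) (p ^ 4) (p ^ 3) q (q ^ 2 * x)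
  | 3%nat => eq_lam q (p ^ 3) x *
      phi43 (p ^ 3) (p ^ 3) (p ^ 3) (p ^ 3) (p ^ 7) (p ^ 6) (p ^ 4) q (q ^ 2 * x)
  | 4%nat => eq_lam q (p ^ 4) x *
      phi43 (p ^ 4) (p ^ 4) (p ^ 4) (p ^ 4) (p ^ 8) (p ^ 7) (p ^ 6) q (q ^ 2 * x)
  | _ => 0
  end.

Definition others (k : nat) : list nat :=
  filter (fun i => negb (Nat.eqb i k)) [1; 2; 3; 4]%nat.

Definition Ccon (q p : C) (k : nat) (Q : C) : C :=
  (Cprod (others k) (fun i => qpoch_inf (p ^ i) q) * qpoch_inf (p ^ (5 - k)) q ^ 3)
  / (Cprod (others k)
       (fun i => qpoch_inf (Cpowz p (Z.of_nat i - Z.of_nat k)) q)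
     * qpoch_inf q q ^ 3)
  * ((qpoch_inf (p ^ k * Q) q * qpoch_inf (p ^ (5 - k) / Q) q)
     / (qpoch_inf Q q * qpoch_inf (q / Q) q)).

(* sum over k = 1..4 of C_k(Q) * coef k Q * e^{-1}_{q,q^{k/5}}(1/Q) * W_k(1/Q) *)
Definition connection (q p : C) (coef : nat -> C -> C) (Q : C) : C :=
  sum_n_m (fun k =>
    Ccon q p k Q * coef k Q * / eq_lam q (p ^ k) (/ Q) * W q p k (/ Q)) 1 4.

Definition punctured_unit_disc (Q : C) : Prop := (0 < Cmod Q < 1)%R.
Definition near_infinity (q Q : C) : Prop := (Cmod q ^ 2 < Cmod Q)%R.
Definition annulus (q Q : C) : Prop := (Cmod q ^ 2 < Cmod Q < 1)%R.

(* Main.v *)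
Require Import Defs.
From Stdlib Require Import Reals ZArith List ClassicalEpsilon Lra Lia.
From Coquelicot Require Import Coquelicot.
Import ListNotations.
Open Scope C_scope.

(** The connection formula is the limit of an exact finite identity; the equations
    are telescoping sums.

    Connection formula.  Up to a factor independent of [d], the coefficient of
    [Q^d] in the series at 0 is the value at [u = P q^d] of a quotient
    [quot N u] of products, for [N] infinite.  For finite [N] this quotient is a
    rational function of [u] with simple poles at [u = p^-m], [m] prime to 5,
    hence a sum of partial fractions.  The kernel [kern Q N c], a truncated
    quotient of theta functions, is likewise the finite sum
    [sum_(|d| <= N) w_d / (1 - c q^d)] with [w_d] close to a multiple of [Q^d].
    Evaluating the double sum of [w_d r_m / (1 - P p^m q^d)] in both orders gives
    [sum_d w_d quot N (P q^d) = sum_m r_m kern Q N (P p^m)]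
    ([finite_connection]).  As [N] tends to infinity, the terms with [d >= 0] on
    the left tend to a multiple of the series at 0, and the right-hand side
    splits by [m mod 5] into the four series at infinity, each multiplied by a
    theta quotient depending on [P]; the sums are dominated by geometric series
    exactly when [|q|^2 < |Q| < 1].  The terms with [d < 0] carry a common factor
    [(1 - 1/P)^4] and are [O((1 - P)^4)] uniformly in [N] ([quot_negative]).  So
    the series at 0 agrees modulo [(1 - P)^4] with a combination of products
    [Ffun * Gfun] ([Xfun_connection]), and comparing expansion coefficients gives
    the four formulas.  The Jacobi triple product identifies the theta values
    that normalize the expansions and shows that exceptional points are isolated.

    Expansions.  To expand infinite products and series in powers of [1 - P]
    with uniform control, functions are replaced by cubic polynomials with a
    remainder, under a submultiplicative norm ([jet_mult]).  Infinite products
    and termwise differentiable power series come out of the same estimate.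

    Equations.  Applied to either hypergeometric series the operator telescopes.
    At 0 this happens with [P] times the shift in place of the shift and leaves
    [(1 - P)^4] ([Xfun_equation]).  Since [ell q (q Q) = ell q Q + 1], the
    formal power [P^ell] absorbs that factor [P], and the [m]-th combination is
    the coefficient of [(1 - P)^m] in [P^ell] times the series. *)

(** * Limits and sums of complex numbers *)

Definition Cconv (u : nat -> C) (l : C) : Prop :=
  forall eps : R, (0 < eps)%R ->
    exists N, forall n, (N <= n)%nat -> (Cmod (u n - l) < eps)%R.

Lemma pow_01 (x : R) (n : nat) : (0 <= x <= 1)%R -> (0 <= x ^ n <= 1)%R.
Proof.
  intros H; split; [apply pow_le; lra|]. rewrite <- (pow1 n). apply pow_incr; lra.
Qed.

Lemma Cmod_Re_Im (z : C) : (Cmod z <= Rabs (Re z) + Rabs (Im z))%R.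
Proof.
  destruct z as [x y]. change (Re (x, y)) with x. change (Im (x, y)) with y.
  replace ((x, y) : C) with (RtoC x + RtoC y * Ci)
    by (unfold RtoC, Ci, Cplus, Cmult; simpl; f_equal; ring).
  eapply Rle_trans; [apply Cmod_triangle|].
  rewrite Cmod_mult, Cmod_Ci, !Cmod_R. lra.
Qed.

Lemma Cmod_Im (z : C) : (Rabs (Im z) <= Cmod z)%R.
Proof. eapply Rle_trans; [apply Rmax_r|apply Rmax_Cmod]. Qed.

Lemma Cmod_Re (z : C) : (Rabs (Re z) <= Cmod z)%R.
Proof. eapply Rle_trans; [apply Rmax_l|apply Rmax_Cmod]. Qed.

Lemma Cconv_Re_Im (u : nat -> C) (l : C) :
  Cconv u l <->
  is_lim_seq (fun n => Re (u n)) (Re l) /\ is_lim_seq (fun n => Im (u n)) (Im l).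
Proof.
  split.
  - intros H; split; apply is_lim_seq_spec; intros eps;
      destruct (H eps (cond_pos eps)) as [N HN]; exists N; intros n Hn;
      (eapply Rle_lt_trans; [|exact (HN n Hn)]).
    + exact (Cmod_Re (u n - l)).
    + exact (Cmod_Im (u n - l)).
  - intros [H1 H2] eps He.
    apply is_lim_seq_spec in H1; apply is_lim_seq_spec in H2.
    assert (He2 : (0 < eps / 2)%R) by lra.
    destruct (H1 (mkposreal _ He2)) as [N1 HN1].
    destruct (H2 (mkposreal _ He2)) as [N2 HN2].
    exists (N1 + N2)%nat; intros n Hn.
    eapply Rle_lt_trans; [apply Cmod_Re_Im|].
    specialize (HN1 n ltac:(lia)); specialize (HN2 n ltac:(lia)); simpl in HN1, HN2.
    change (Re (u n - l)) with (Re (u n) - Re l)%R.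
    change (Im (u n - l)) with (Im (u n) - Im l)%R.
    lra.
Qed.

Lemma Clim_seq_eq (u : nat -> C) (l : C) : Cconv u l -> Clim_seq u = l.
Proof.
  intros H; apply Cconv_Re_Im in H; destruct H as [H1 H2].
  unfold Clim_seq. rewrite (is_lim_seq_unique _ _ H1), (is_lim_seq_unique _ _ H2).
  destruct l; reflexivity.
Qed.

Lemma Cconv_unique (u : nat -> C) (l l' : C) : Cconv u l -> Cconv u l' -> l = l'.
Proof. intros H1 H2. rewrite <- (Clim_seq_eq _ _ H1). apply Clim_seq_eq, H2. Qed.

Lemma Cconv_ext (u v : nat -> C) (l : C) :
  (forall n, u n = v n) -> Cconv u l -> Cconv v l.
Proof.
  intros E H eps He; destruct (H eps He) as [N HN]; exists N; intros n Hn.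
  rewrite <- E; auto.
Qed.

Lemma Cconv_const (c : C) : Cconv (fun _ => c) c.
Proof.
  intros eps He; exists O; intros.
  replace (c - c) with (RtoC 0) by ring. rewrite Cmod_0; exact He.
Qed.

Lemma Cconv_plus (u v : nat -> C) (l m : C) :
  Cconv u l -> Cconv v m -> Cconv (fun n => u n + v n) (l + m).
Proof.
  intros H1 H2 eps He.
  destruct (H1 (eps / 2)%R ltac:(lra)) as [N1 HN1].
  destruct (H2 (eps / 2)%R ltac:(lra)) as [N2 HN2].
  exists (N1 + N2)%nat; intros n Hn.
  replace (u n + v n - (l + m)) with ((u n - l) + (v n - m)) by ring.
  eapply Rle_lt_trans; [apply Cmod_triangle|].
  specialize (HN1 n ltac:(lia)); specialize (HN2 n ltac:(lia)); lra.
Qed.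

Lemma Cconv_bounded (u : nat -> C) (l : C) :
  Cconv u l -> exists N, forall n, (N <= n)%nat -> (Cmod (u n) <= Cmod l + 1)%R.
Proof.
  intros H; destruct (H 1%R ltac:(lra)) as [N HN]; exists N; intros n Hn.
  replace (u n) with (l + (u n - l)) by ring.
  eapply Rle_trans; [apply Cmod_triangle|]. specialize (HN n Hn); lra.
Qed.

Lemma Cconv_mult (u v : nat -> C) (l m : C) :
  Cconv u l -> Cconv v m -> Cconv (fun n => u n * v n) (l * m).
Proof.
  intros H1 H2 eps He.
  destruct (Cconv_bounded _ _ H1) as [N0 HN0].
  set (A := (Cmod l + 1)%R) in *. set (B := (Cmod m + 1)%R).
  assert (HA : (0 < A)%R) by (unfold A; pose proof (Cmod_ge_0 l); lra).
  assert (HB : (0 < B)%R) by (unfold B; pose proof (Cmod_ge_0 m); lra).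
  destruct (H1 (eps / 2 / B)%R) as [N1 HN1].
  { apply Rdiv_lt_0_compat; lra. }
  destruct (H2 (eps / 2 / A)%R) as [N2 HN2].
  { apply Rdiv_lt_0_compat; lra. }
  exists (N0 + N1 + N2)%nat; intros n Hn.
  replace (u n * v n - l * m) with (u n * (v n - m) + (u n - l) * m) by ring.
  eapply Rle_lt_trans; [apply Cmod_triangle|]. rewrite !Cmod_mult.
  specialize (HN0 n ltac:(lia)); specialize (HN1 n ltac:(lia)); specialize (HN2 n ltac:(lia)).
  apply Rle_lt_trans with (A * Cmod (v n - m) + Cmod (u n - l) * B)%R.
  - apply Rplus_le_compat.
    + apply Rmult_le_compat_r; [apply Cmod_ge_0|exact HN0].
    + apply Rmult_le_compat_l; [apply Cmod_ge_0|unfold B; lra].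
  - apply (Rmult_lt_compat_l A) in HN2; [|exact HA].
    apply (Rmult_lt_compat_r B) in HN1; [|exact HB].
    replace (A * (eps / 2 / A))%R with (eps / 2)%R in HN2 by (field; lra).
    replace (eps / 2 / B * B)%R with (eps / 2)%R in HN1 by (field; lra).
    lra.
Qed.

Lemma Cconv_scal (c : C) (u : nat -> C) (l : C) :
  Cconv u l -> Cconv (fun n => c * u n) (c * l).
Proof. intros H; apply Cconv_mult; [apply Cconv_const|exact H]. Qed.

Lemma Cconv_minus (u v : nat -> C) (l m : C) :
  Cconv u l -> Cconv v m -> Cconv (fun n => u n - v n) (l - m).
Proof.
  intros H1 H2.
  apply Cconv_ext with (fun n => u n + (- (1)) * v n); [intros; ring|].
  replace (l - m) with (l + (- (1)) * m) by ring.
  apply Cconv_plus; [exact H1|apply Cconv_scal, H2].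
Qed.

Lemma Cconv_inv (u : nat -> C) (l : C) :
  l <> 0 -> Cconv u l -> Cconv (fun n => / u n) (/ l).
Proof.
  intros Hl H eps He.
  assert (Hm : (0 < Cmod l)%R) by (apply Cmod_gt_0; exact Hl).
  destruct (H (Cmod l / 2)%R ltac:(lra)) as [N1 HN1].
  destruct (H (eps * (Cmod l * Cmod l / 2))%R) as [N2 HN2].
  { apply Rmult_lt_0_compat; [exact He|].
    assert (0 < Cmod l * Cmod l)%R by (apply Rmult_lt_0_compat; exact Hm). lra. }
  exists (N1 + N2)%nat; intros n Hn.
  specialize (HN1 n ltac:(lia)); specialize (HN2 n ltac:(lia)).
  assert (Hu : (Cmod l / 2 < Cmod (u n))%R).
  { assert (Cmod l <= Cmod (u n) + Cmod (u n - l))%R.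
    { replace l with (u n + - (u n - l)) at 1 by ring.
      eapply Rle_trans; [apply Cmod_triangle|]. rewrite Cmod_opp; lra. }
    lra. }
  assert (Hu0 : u n <> 0) by (apply Cmod_gt_0; lra).
  replace (/ u n - / l) with (- (u n - l) * / (u n * l)) by (field; auto).
  rewrite Cmod_mult, Cmod_opp, Cmod_inv, Cmod_mult by (apply Cmult_neq_0; auto).
  assert (Hp : (Cmod l * Cmod l / 2 < Cmod (u n) * Cmod l)%R).
  { apply (Rmult_lt_compat_r (Cmod l)) in Hu; lra. }
  assert (0 < Cmod l * Cmod l)%R by (apply Rmult_lt_0_compat; exact Hm).
  apply Rlt_div_l with (c := (Cmod (u n) * Cmod l)%R); [lra|].
  eapply Rlt_le_trans; [exact HN2|].
  apply Rmult_le_compat_l; lra.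
Qed.

Lemma Cconv_div (u v : nat -> C) (l m : C) :
  m <> 0 -> Cconv u l -> Cconv v m -> Cconv (fun n => u n / v n) (l / m).
Proof. intros Hm H1 H2; apply Cconv_mult; [exact H1|apply Cconv_inv; auto]. Qed.

Lemma Cconv_pow (u : nat -> C) (l : C) (k : nat) :
  Cconv u l -> Cconv (fun n => u n ^ k) (l ^ k).
Proof.
  intros H; induction k as [|k IH]; simpl.
  - apply Cconv_const.
  - apply Cconv_mult; assumption.
Qed.

Lemma Cconv_subseq (u : nat -> C) (l : C) (f : nat -> nat) :
  (forall n, (n <= f n)%nat) -> Cconv u l -> Cconv (fun n => u (f n)) l.
Proof.
  intros Hf H eps He; destruct (H eps He) as [N HN]; exists N; intros n Hn.
  apply HN. specialize (Hf n); lia.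
Qed.

Lemma Cconv_shift_minus (u : nat -> C) (l : C) (k : nat) :
  Cconv u l -> Cconv (fun n => u (n - k)%nat) l.
Proof.
  intros H eps He; destruct (H eps He) as [N HN]; exists (N + k)%nat; intros n Hn.
  apply HN; lia.
Qed.

Lemma Cconv_le (u : nat -> C) (l : C) (M : R) :
  Cconv u l -> (forall n, (Cmod (u n) <= M)%R) -> (Cmod l <= M)%R.
Proof.
  intros H HM. apply Rnot_lt_le; intros Hlt.
  destruct (H (Cmod l - M)%R ltac:(lra)) as [N HN].
  specialize (HN N (le_n _)). specialize (HM N).
  assert (Cmod l <= Cmod (u N) + Cmod (u N - l))%R.
  { replace l with (u N + - (u N - l)) at 1 by ring.
    eapply Rle_trans; [apply Cmod_triangle|]. rewrite Cmod_opp; lra. }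
  lra.
Qed.

(** Sums and products over [i < n]; indexing by the number of terms makes the
    empty case available to inductions. *)
Fixpoint bsum (a : nat -> C) (n : nat) : C :=
  match n with O => 0 | S k => bsum a k + a k end.

Fixpoint bprod (a : nat -> C) (n : nat) : C :=
  match n with O => 1 | S k => bprod a k * a k end.

Lemma sum_n_bsum (a : nat -> C) (n : nat) : sum_n a n = bsum a (S n).
Proof.
  induction n as [|n IH].
  - rewrite sum_O; simpl. now rewrite Cplus_0_l.
  - rewrite sum_Sn, IH. reflexivity.
Qed.

Lemma bsum_ext (a b : nat -> C) (n : nat) :
  (forall i, (i < n)%nat -> a i = b i) -> bsum a n = bsum b n.
Proof.
  induction n as [|n IH]; intros H; simpl; [reflexivity|].
  rewrite IH, (H n) by auto with arith. reflexivity.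
Qed.

Lemma bprod_ext (a b : nat -> C) (n : nat) :
  (forall i, (i < n)%nat -> a i = b i) -> bprod a n = bprod b n.
Proof.
  induction n as [|n IH]; intros H; simpl; [reflexivity|].
  rewrite IH, (H n) by auto with arith. reflexivity.
Qed.

Lemma bsum_plus (a b : nat -> C) (n : nat) :
  bsum (fun i => a i + b i) n = bsum a n + bsum b n.
Proof. induction n as [|n IH]; simpl; [ring|rewrite IH; ring]. Qed.

Lemma bsum_scal (c : C) (a : nat -> C) (n : nat) :
  bsum (fun i => c * a i) n = c * bsum a n.
Proof. induction n as [|n IH]; simpl; [ring|rewrite IH; ring]. Qed.

Lemma bprod_mult (a b : nat -> C) (n : nat) :
  bprod (fun i => a i * b i) n = bprod a n * bprod b n.
Proof. induction n as [|n IH]; simpl; [ring|rewrite IH; ring]. Qed.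

Lemma bprod_neq0 (a : nat -> C) (n : nat) :
  (forall i, (i < n)%nat -> a i <> 0) -> bprod a n <> 0.
Proof.
  induction n as [|n IH]; intros H; simpl; [apply C1_nz|].
  apply Cmult_neq_0; auto with arith.
Qed.

Lemma bsum_shift (a : nat -> C) (n : nat) :
  bsum a (S n) = a O + bsum (fun i => a (S i)) n.
Proof.
  induction n as [|n IH]; [simpl; ring|].
  change (bsum a (S (S n))) with (bsum a (S n) + a (S n)). rewrite IH. simpl. ring.
Qed.

Lemma bsum_app (a : nat -> C) (n m : nat) :
  bsum a (n + m) = bsum a n + bsum (fun i => a (n + i)%nat) m.
Proof.
  induction m as [|m IH]; simpl.
  - rewrite Nat.add_0_r; ring.
  - rewrite Nat.add_succ_r; simpl. rewrite IH; ring.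
Qed.

Lemma bprod_app (a : nat -> C) (n m : nat) :
  bprod a (n + m) = bprod a n * bprod (fun i => a (n + i)%nat) m.
Proof.
  induction m as [|m IH]; simpl.
  - rewrite Nat.add_0_r; ring.
  - rewrite Nat.add_succ_r; simpl. rewrite IH; ring.
Qed.

Lemma bsum_rev (a : nat -> C) (n : nat) :
  bsum a n = bsum (fun i => a (n - 1 - i)%nat) n.
Proof.
  induction n as [|n IH]; [reflexivity|].
  rewrite (bsum_shift (fun i => a (S n - 1 - i)%nat)).
  change (bsum a (S n)) with (bsum a n + a n). rewrite IH.
  replace (S n - 1 - 0)%nat with n by lia.
  rewrite (bsum_ext (fun i => a (S n - 1 - S i)%nat) (fun i => a (n - 1 - i)%nat)).
  - ring.
  - intros i Hi; f_equal; lia.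
Qed.

(** Bilateral sums over [-n <= d <= n] are written with the index [n + d]; this
    separates the two halves, which converge for different reasons. *)
Lemma bsum_center (a : nat -> C) (n : nat) :
  bsum a (S (2 * n)) =
  bsum (fun j => a (n + j)%nat) (S n) + bsum (fun j => a (n - S j)%nat) n.
Proof.
  replace (S (2 * n)) with (n + S n)%nat by lia.
  rewrite bsum_app, Cplus_comm. f_equal. rewrite bsum_rev.
  apply bsum_ext; intros i Hi; f_equal; lia.
Qed.

Lemma bsum_swap (a : nat -> nat -> C) (n m : nat) :
  bsum (fun i => bsum (fun j => a i j) m) n = bsum (fun j => bsum (fun i => a i j) n) m.
Proof.
  induction n as [|n IH]; simpl.
  - induction m as [|m IHm]; simpl; [reflexivity|rewrite <- IHm; ring].
  - rewrite IH, bsum_plus. reflexivity.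
Qed.

Lemma bsum_mod4 (a : nat -> C) (n : nat) :
  bsum a (4 * n) =
  bsum (fun j => a (4 * j)%nat + a (4 * j + 1)%nat + a (4 * j + 2)%nat
                 + a (4 * j + 3)%nat) n.
Proof.
  induction n as [|n IH]; [reflexivity|].
  replace (4 * S n)%nat with (4 * n + 4)%nat by lia.
  rewrite bsum_app, IH. cbn [bsum]. rewrite !Nat.add_0_r. ring.
Qed.

Lemma bprod_mod4 (a : nat -> C) (n : nat) :
  bprod a (4 * n) =
  bprod (fun j => a (4 * j)%nat) n * bprod (fun j => a (4 * j + 1)%nat) n
  * bprod (fun j => a (4 * j + 2)%nat) n * bprod (fun j => a (4 * j + 3)%nat) n.
Proof.
  rewrite <- !bprod_mult.
  induction n as [|n IH]; [reflexivity|].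
  replace (4 * S n)%nat with (4 * n + 4)%nat by lia.
  rewrite bprod_app, IH. cbn [bprod]. rewrite !Nat.add_0_r. ring.
Qed.

(** ** Absolutely convergent series *)

Definition Summable (a : nat -> C) : Prop := ex_series (fun n => Cmod (a n)).

Lemma Summable_le (a : nat -> C) (b : nat -> R) :
  (forall n, (Cmod (a n) <= b n)%R) -> ex_series b -> Summable a.
Proof.
  intros H Hb. apply (ex_series_le (fun n => Cmod (a n)) b); [|exact Hb].
  intros n; unfold norm; simpl; unfold abs; simpl.
  rewrite Rabs_pos_eq by apply Cmod_ge_0. apply H.
Qed.

Lemma Csum_eq (a : nat -> C) (l : C) : Cconv (bsum a) l -> Csum a = l.
Proof.
  intros H. unfold Csum. apply Clim_seq_eq.
  apply Cconv_ext with (fun n => bsum a (S n)); [intros; now rewrite sum_n_bsum|].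
  apply (Cconv_subseq (bsum a) l S); auto.
Qed.

Lemma Re_bsum (a : nat -> C) (n : nat) : Re (bsum a (S n)) = sum_n (fun k => Re (a k)) n.
Proof.
  induction n as [|n IH].
  - rewrite sum_O. change (0 + Re (a O) = Re (a O))%R. ring.
  - rewrite sum_Sn, <- IH. reflexivity.
Qed.

Lemma Im_bsum (a : nat -> C) (n : nat) : Im (bsum a (S n)) = sum_n (fun k => Im (a k)) n.
Proof.
  induction n as [|n IH].
  - rewrite sum_O. change (0 + Im (a O) = Im (a O))%R. ring.
  - rewrite sum_Sn, <- IH. reflexivity.
Qed.

Lemma Csum_conv (a : nat -> C) : Summable a -> Cconv (bsum a) (Csum a).
Proof.
  intros H.
  assert (H1 : ex_series (fun n => Re (a n))).
  { apply (ex_series_le (fun n => Re (a n)) (fun n => Cmod (a n))); [|exact H].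
    intros n; apply Cmod_Re. }
  assert (H2 : ex_series (fun n => Im (a n))).
  { apply (ex_series_le (fun n => Im (a n)) (fun n => Cmod (a n))); [|exact H].
    intros n; apply Cmod_Im. }
  assert (Hc : Cconv (bsum a) (Series (fun n => Re (a n)), Series (fun n => Im (a n)))).
  { apply Cconv_Re_Im; split; apply is_lim_seq_incr_1.
    - eapply is_lim_seq_ext; [intros n; symmetry; apply Re_bsum|].
      apply (Series_correct _ H1).
    - eapply is_lim_seq_ext; [intros n; symmetry; apply Im_bsum|].
      apply (Series_correct _ H2). }
  rewrite (Csum_eq _ _ Hc). exact Hc.
Qed.

Lemma Cmod_bsum (a : nat -> C) (n : nat) :
  (Cmod (bsum a n) <= match n with O => 0 | S k => sum_n (fun i => Cmod (a i)) k end)%R.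
Proof.
  destruct n as [|n]; [simpl; rewrite Cmod_0; lra|].
  induction n as [|n IH].
  - rewrite sum_O; simpl. rewrite Cplus_0_l; lra.
  - rewrite sum_Sn. change (bsum a (S (S n))) with (bsum a (S n) + a (S n)).
    eapply Rle_trans; [apply Cmod_triangle|]. apply Rplus_le_compat_r, IH.
Qed.

Lemma sum_n_le_Series (b : nat -> R) (n : nat) :
  (forall k, (0 <= b k)%R) -> ex_series b -> (sum_n b n <= Series b)%R.
Proof.
  intros Hb H.
  apply (is_lim_seq_incr_compare (sum_n b)); [apply (Series_correct _ H)|].
  intros k; rewrite sum_Sn. change (sum_n b k <= sum_n b k + b (S k))%R.
  specialize (Hb (S k)); lra.
Qed.

Lemma Series_pos (b : nat -> R) :
  (forall k, (0 <= b k)%R) -> ex_series b -> (0 <= Series b)%R.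
Proof.
  intros Hb H. eapply Rle_trans; [|apply (sum_n_le_Series b 0 Hb H)].
  rewrite sum_O; apply Hb.
Qed.

Lemma bsum_le_Series (a : nat -> C) (b : nat -> R) (n : nat) :
  (forall k, (k < n)%nat -> (Cmod (a k) <= b k)%R) -> (forall k, (0 <= b k)%R) ->
  ex_series b -> (Cmod (bsum a n) <= Series b)%R.
Proof.
  intros H Hp Hb. destruct n as [|n].
  - simpl; rewrite Cmod_0; apply Series_pos; assumption.
  - eapply Rle_trans; [apply Cmod_bsum|].
    eapply Rle_trans; [|apply (sum_n_le_Series b n Hp Hb)].
    clear Hb.
    assert (forall m, (m <= n)%nat -> (sum_n (fun i => Cmod (a i)) m <= sum_n b m)%R) as HH.
    { induction m as [|m IH]; intros Hm.
      - rewrite !sum_O; apply H; lia.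
      - rewrite !sum_Sn. apply Rplus_le_compat; [apply IH; lia|apply H; lia]. }
    apply HH; lia.
Qed.

Lemma Csum_le_Series (a : nat -> C) (b : nat -> R) :
  (forall k, (Cmod (a k) <= b k)%R) -> ex_series b -> (Cmod (Csum a) <= Series b)%R.
Proof.
  intros H Hb.
  apply (Cconv_le (bsum a)); [apply Csum_conv; eapply Summable_le; eassumption|].
  intros n; apply bsum_le_Series; auto.
  intros k; eapply Rle_trans; [apply Cmod_ge_0|apply H].
Qed.

Lemma Csum_ext (a b : nat -> C) : (forall n, a n = b n) -> Csum a = Csum b.
Proof.
  intros H. unfold Csum, Clim_seq. f_equal; f_equal; apply Lim_seq_ext; intros n;
  rewrite !sum_n_bsum, (bsum_ext a b) by auto; reflexivity.
Qed.

Lemma Summable_ext (a b : nat -> C) :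
  (forall n, a n = b n) -> Summable a -> Summable b.
Proof.
  intros H; apply ex_series_ext; intros n; now rewrite H.
Qed.

Lemma Summable_plus (a b : nat -> C) :
  Summable a -> Summable b -> Summable (fun n => a n + b n).
Proof.
  intros Ha Hb. eapply Summable_le; [intros n; apply Cmod_triangle|].
  apply (ex_series_plus (fun n => Cmod (a n)) (fun n => Cmod (b n))); assumption.
Qed.

Lemma Summable_scal (c : C) (a : nat -> C) : Summable a -> Summable (fun n => c * a n).
Proof.
  intros Ha.
  eapply (Summable_le _ (fun n => Cmod c * Cmod (a n))%R);
    [intros n; rewrite Cmod_mult; lra|].
  apply (ex_series_scal_l (Cmod c) (fun n => Cmod (a n))); exact Ha.
Qed.

Lemma Csum_plus (a b : nat -> C) :
  Summable a -> Summable b -> Csum (fun n => a n + b n) = Csum a + Csum b.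
Proof.
  intros Ha Hb; apply Csum_eq.
  apply Cconv_ext with (fun n => bsum a n + bsum b n); [intros; now rewrite bsum_plus|].
  apply Cconv_plus; apply Csum_conv; assumption.
Qed.

Lemma Csum_scal (c : C) (a : nat -> C) :
  Summable a -> Csum (fun n => c * a n) = c * Csum a.
Proof.
  intros Ha; apply Csum_eq.
  apply Cconv_ext with (fun n => c * bsum a n); [intros; now rewrite bsum_scal|].
  apply Cconv_scal, Csum_conv, Ha.
Qed.

Lemma Summable_geom (z : C) : (Cmod z < 1)%R -> Summable (fun n => z ^ n).
Proof.
  intros H. eapply (Summable_le _ (fun n => Cmod z ^ n)%R);
    [intros n; rewrite Cmod_pow; lra|].
  apply ex_series_geom. rewrite Rabs_pos_eq; [exact H|apply Cmod_ge_0].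
Qed.

Lemma Summable_bounded_geom (a : nat -> C) (M : R) (z : C) :
  (Cmod z < 1)%R -> (forall n, (Cmod (a n) <= M)%R) -> Summable (fun n => a n * z ^ n).
Proof.
  intros Hz Ha. eapply (Summable_le _ (fun n => M * Cmod z ^ n)%R).
  - intros n; rewrite Cmod_mult, Cmod_pow.
    apply Rmult_le_compat_r; [apply pow_le, Cmod_ge_0|apply Ha].
  - apply (ex_series_scal_l M (fun n => Cmod z ^ n)%R).
    apply ex_series_geom. rewrite Rabs_pos_eq; [exact Hz|apply Cmod_ge_0].
Qed.

Lemma Series_tail_small (b : nat -> R) (eps : R) :
  ex_series b -> (0 < eps)%R ->
  exists K, (Series (fun n => b (K + n)%nat) < eps)%R.
Proof.
  intros Hb He.
  assert (Hs : is_lim_seq (sum_n b) (Series b)) by exact (Series_correct _ Hb).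
  apply is_lim_seq_spec in Hs. destruct (Hs (mkposreal _ He)) as [N HN].
  specialize (HN N (le_n _)); simpl in HN.
  exists (S N).
  rewrite (Series_incr_n b (S N)) in HN by (lia || assumption).
  rewrite Nat.pred_succ, <- sum_n_Reals in HN.
  apply Rabs_lt_between in HN; lra.
Qed.

(** Dominated convergence for series (Tannery): the tail beyond [K] is small
    uniformly in [N], and the first [K] terms converge one by one. *)
Lemma tannery (u : nat -> nat -> C) (v : nat -> C) (b : nat -> R) (len : nat -> nat) :
  (forall N, (N <= len N)%nat) ->
  (forall N j, (j < len N)%nat -> (Cmod (u N j) <= b j)%R) ->
  (forall j, (0 <= b j)%R) -> ex_series b ->
  (forall j, Cconv (fun N => u N j) (v j)) ->
  Cconv (fun N => bsum (u N) (len N)) (Csum v).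
Proof.
  intros Hlen Hu Hb Hs Hv.
  assert (Hvb : forall j, (Cmod (v j) <= b j)%R).
  { intros j. apply (Cconv_le (fun N => u (N + S j)%nat j)).
    - apply (Cconv_subseq (fun N => u N j) (v j) (fun N => (N + S j)%nat)); [lia|apply Hv].
    - intros n; apply Hu. specialize (Hlen (n + S j)%nat); lia. }
  assert (HvS : Summable v) by (eapply Summable_le; eassumption).
  intros eps He.
  destruct (Series_tail_small b (eps / 4) Hs ltac:(lra)) as [K HK].
  assert (HsK : ex_series (fun n => b (K + n)%nat)) by (apply ex_series_incr_n; exact Hs).
  destruct (Csum_conv v HvS (eps / 4)%R ltac:(lra)) as [N1 HN1].
  assert (Hfin : forall k, Cconv (fun N => bsum (u N) k) (bsum v k)).
  { induction k as [|k IH]; simpl; [apply Cconv_const|].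
    apply (Cconv_plus (fun N => bsum (u N) k) (fun N => u N k)); [exact IH|apply Hv]. }
  destruct (Hfin K (eps / 4)%R ltac:(lra)) as [N2 HN2].
  exists (K + N1 + N2)%nat; intros n Hn.
  specialize (HN2 n ltac:(lia)).
  assert (Hn' : exists m, len n = (K + m)%nat).
  { exists (len n - K)%nat. specialize (Hlen n); lia. }
  destruct Hn' as [m Hm].
  rewrite Hm, bsum_app.
  specialize (HN1 (K + N1)%nat ltac:(lia)). rewrite bsum_app in HN1.
  replace (bsum (u n) K + bsum (fun i => u n (K + i)%nat) m - Csum v) with
    ((bsum (u n) K - bsum v K) + bsum (fun i => u n (K + i)%nat) m
     + - bsum (fun i => v (K + i)%nat) N1
     + (bsum v K + bsum (fun i => v (K + i)%nat) N1 - Csum v)) by ring.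
  assert (A1 : (Cmod (bsum (fun i => u n (K + i)%nat) m)
                <= Series (fun n => b (K + n)%nat))%R).
  { apply (bsum_le_Series _ (fun i => b (K + i)%nat)); auto. intros k Hk; apply Hu; lia. }
  assert (A2 : (Cmod (bsum (fun i => v (K + i)%nat) N1)
                <= Series (fun n => b (K + n)%nat))%R).
  { apply (bsum_le_Series _ (fun i => b (K + i)%nat)); auto. }
  eapply Rle_lt_trans; [apply Cmod_triangle|].
  pose proof (Cmod_triangle (bsum (u n) K - bsum v K + bsum (fun i => u n (K + i)%nat) m)
                (- bsum (fun i => v (K + i)%nat) N1)) as T1.
  pose proof (Cmod_triangle (bsum (u n) K - bsum v K) (bsum (fun i => u n (K + i)%nat) m)) as T2.
  rewrite Cmod_opp in T1. lra.
Qed.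

Lemma Csum_telescope (a b : nat -> C) :
  Cconv b 0 -> (forall n, a n = b n - b (S n)) -> Csum a = b O.
Proof.
  intros Hb H; apply Csum_eq.
  apply Cconv_ext with (fun n => b O - b n).
  - induction n as [|n IH]; simpl; [ring|]. rewrite <- IH, H; ring.
  - replace (b O) with (b O - 0) at 1 by ring.
    apply Cconv_minus; [apply Cconv_const|exact Hb].
Qed.

Lemma Summable_conv0 (a : nat -> C) : Summable a -> Cconv a 0.
Proof.
  intros H. pose proof (ex_series_lim_0 _ H) as H0.
  apply is_lim_seq_spec in H0. intros eps He.
  destruct (H0 (mkposreal _ He)) as [N HN]; exists N; intros n Hn.
  specialize (HN n Hn); simpl in HN.
  rewrite Rminus_0_r, Rabs_pos_eq in HN by apply Cmod_ge_0.
  replace (a n - 0) with (a n) by ring. exact HN.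
Qed.

(** * Third-order jets with a submultiplicative norm *)

Definition cpol (c : nat -> C) (t : C) : C :=
  c 0%nat + c 1%nat * t + c 2%nat * t ^ 2 + c 3%nat * t ^ 3.

Definition wt (r : R) (c : nat -> C) : R :=
  (Cmod (c 0%nat) + Cmod (c 1%nat) * r + Cmod (c 2%nat) * r ^ 2 + Cmod (c 3%nat) * r ^ 3)%R.

(** [jet r f c B]: on the disc of radius [r] the function [f] is the cubic
    polynomial with coefficients [c] up to a multiple of [t ^ 4], and the total
    size of coefficients and remainder, weighted by powers of [r], is at most
    [B].  The least such [B] is a submultiplicative norm ([jet_mult]); this
    makes infinite products and series of jets as easy as those of numbers. *)
Definition jet (r : R) (f : C -> C) (c : nat -> C) (B : R) : Prop :=
  (wt r c <= B)%R /\
  forall t, (Cmod t < r)%R ->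
    (Cmod (f t - cpol c t) * r ^ 4 <= (B - wt r c) * Cmod t ^ 4)%R.

Definition conv (c d : nat -> C) (n : nat) : C :=
  sum_n (fun a => c a * d (n - a)%nat) n.

Lemma conv_0 c d : conv c d 0 = c 0%nat * d 0%nat.
Proof. unfold conv. rewrite sum_O. reflexivity. Qed.

Lemma conv_1 c d : conv c d 1 = c 0%nat * d 1%nat + c 1%nat * d 0%nat.
Proof. unfold conv. rewrite sum_Sn, sum_O. reflexivity. Qed.

Lemma conv_2 c d :
  conv c d 2 = c 0%nat * d 2%nat + c 1%nat * d 1%nat + c 2%nat * d 0%nat.
Proof. unfold conv. rewrite !sum_Sn, sum_O. reflexivity. Qed.

Lemma conv_3 c d :
  conv c d 3 = c 0%nat * d 3%nat + c 1%nat * d 2%nat + c 2%nat * d 1%nat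
               + c 3%nat * d 0%nat.
Proof. unfold conv. rewrite !sum_Sn, sum_O. reflexivity. Qed.

(** Coefficients of the affine function [a + b t]. *)
Definition unit_seq (a b : C) (n : nat) : C :=
  match n with O => a | S O => b | _ => 0 end.

Lemma Cmod_cpol r c t : (0 < r)%R -> (Cmod t < r)%R -> (Cmod (cpol c t) <= wt r c)%R.
Proof.
  intros Hr Ht. unfold cpol, wt.
  assert (H : forall n, (Cmod t ^ n <= r ^ n)%R).
  { intros n; apply pow_incr; split; [apply Cmod_ge_0|lra]. }
  eapply Rle_trans; [apply Cmod_triangle|]; apply Rplus_le_compat.
  eapply Rle_trans; [apply Cmod_triangle|]; apply Rplus_le_compat.
  eapply Rle_trans; [apply Cmod_triangle|]; apply Rplus_le_compat.
  - lra.
  - rewrite Cmod_mult; apply Rmult_le_compat_l; [apply Cmod_ge_0|lra].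
  - rewrite Cmod_mult, Cmod_pow; apply Rmult_le_compat_l; [apply Cmod_ge_0|apply H].
  - rewrite Cmod_mult, Cmod_pow; apply Rmult_le_compat_l; [apply Cmod_ge_0|apply H].
Qed.

Lemma wt_ge_0 r c : (0 < r)%R -> (0 <= wt r c)%R.
Proof.
  intros Hr. unfold wt.
  assert (H : forall n, (0 <= Cmod (c n) * r ^ n)%R).
  { intros n; apply Rmult_le_pos; [apply Cmod_ge_0|apply pow_le; lra]. }
  pose proof (Cmod_ge_0 (c 0%nat)). pose proof (H 1%nat); pose proof (H 2%nat);
  pose proof (H 3%nat). rewrite pow_1 in *. lra.
Qed.

Lemma wt_coef r c n : (0 < r)%R -> (n <= 3)%nat -> (Cmod (c n) * r ^ n <= wt r c)%R.
Proof.
  intros Hr Hn. unfold wt.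
  assert (H : forall n, (0 <= Cmod (c n) * r ^ n)%R).
  { intros k; apply Rmult_le_pos; [apply Cmod_ge_0|apply pow_le; lra]. }
  pose proof (H 0%nat); pose proof (H 1%nat); pose proof (H 2%nat); pose proof (H 3%nat).
  rewrite pow_1, pow_O in *.
  destruct n as [|[|[|[|n]]]]; try lia; rewrite ?pow_1, ?pow_O; lra.
Qed.

Section Jets.
Variable r : R.
Hypothesis Hr : (0 < r)%R.

Let r4 : (0 < r ^ 4)%R.
Proof. apply pow_lt, Hr. Qed.

Let pow_le4 (t : C) : (Cmod t < r)%R -> (Cmod t ^ 4 <= r ^ 4)%R.
Proof. intros Ht; apply pow_incr; split; [apply Cmod_ge_0|lra]. Qed.

Lemma jet_wt f c B : jet r f c B -> (wt r c <= B)%R.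
Proof. intros H; apply H. Qed.

Lemma jet_norm_ge_0 f c B : jet r f c B -> (0 <= B)%R.
Proof. intros H. pose proof (jet_wt _ _ _ H). pose proof (wt_ge_0 r c Hr). lra. Qed.

Lemma jet_coef f c B n : (n <= 3)%nat -> jet r f c B -> (Cmod (c n) <= B / r ^ n)%R.
Proof.
  intros Hn H. apply Rle_div_r; [apply pow_lt; exact Hr|].
  eapply Rle_trans; [apply wt_coef; assumption|apply (jet_wt _ _ _ H)].
Qed.

Lemma jet_bound f c B t : jet r f c B -> (Cmod t < r)%R -> (Cmod (f t) <= B)%R.
Proof.
  intros [H1 H2] Ht. specialize (H2 t Ht).
  replace (f t) with (cpol c t + (f t - cpol c t)) by ring.
  eapply Rle_trans; [apply Cmod_triangle|].
  pose proof (Cmod_cpol r c t Hr Ht).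
  assert (Cmod (f t - cpol c t) <= B - wt r c)%R; [|lra].
  apply Rmult_le_reg_r with (r ^ 4)%R; [exact r4|].
  eapply Rle_trans; [exact H2|]. apply Rmult_le_compat_l; [lra|apply pow_le4, Ht].
Qed.

(** Both the remainder and the polynomial minus its constant term are divisible
    by [t], and their weighted sizes add up to at most [B]. *)
Lemma jet_lipschitz f c B t : jet r f c B -> (Cmod t < r)%R ->
  (Cmod (f t - c 0%nat) * r <= B * Cmod t)%R.
Proof.
  intros [H1 H2] Ht. specialize (H2 t Ht). pose proof (Cmod_ge_0 t) as H0.
  assert (A1 : (Cmod (f t - cpol c t) * r <= (B - wt r c) * Cmod t)%R).
  { apply Rmult_le_reg_r with (r ^ 3)%R; [apply pow_lt, Hr|].
    apply Rle_trans with ((B - wt r c) * Cmod t ^ 4)%R; [lra|].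
    replace ((B - wt r c) * Cmod t ^ 4)%R with ((B - wt r c) * Cmod t * Cmod t ^ 3)%R by ring.
    apply Rmult_le_compat_l; [apply Rmult_le_pos; lra|]. apply pow_incr; lra. }
  assert (A2 : (Cmod (cpol c t - c 0%nat) * r <= wt r c * Cmod t)%R).
  { replace (cpol c t - c 0%nat) with (t * (c 1%nat + c 2%nat * t + c 3%nat * t ^ 2))
      by (unfold cpol; ring).
    assert (A3 : (Cmod (c 1%nat + c 2%nat * t + c 3%nat * t ^ 2)
      <= Cmod (c 1%nat) + Cmod (c 2%nat) * r + Cmod (c 3%nat) * r ^ 2)%R).
    { eapply Rle_trans; [apply Cmod_triangle|]; apply Rplus_le_compat;
        [eapply Rle_trans; [apply Cmod_triangle|]; apply Rplus_le_compat_l|];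
        rewrite Cmod_mult, ?Cmod_pow; (apply Rmult_le_compat_l; [apply Cmod_ge_0|]);
        [lra|apply pow_incr; lra]. }
    rewrite Cmod_mult. apply (Rmult_le_compat_r r) in A3; [|lra].
    pose proof (Cmod_ge_0 (c 0%nat)). unfold wt. nra. }
  replace (f t - c 0%nat) with ((f t - cpol c t) + (cpol c t - c 0%nat)) by ring.
  pose proof (Cmod_triangle (f t - cpol c t) (cpol c t - c 0%nat)). nra.
Qed.

Lemma jet_at_0 f c B : jet r f c B -> f 0 = c 0%nat.
Proof.
  intros [H1 H2]. specialize (H2 0 ltac:(rewrite Cmod_0; lra)).
  rewrite Cmod_0 in H2. replace (0 ^ 4)%R with 0%R in H2 by ring.
  rewrite Rmult_0_r in H2.
  assert (Cmod (f 0 - cpol c 0) = 0)%R as E.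
  { pose proof (Cmod_ge_0 (f 0 - cpol c 0)). apply Rle_antisym; [|lra].
    apply Rmult_le_reg_r with (r ^ 4)%R; [exact r4|lra]. }
  apply Cmod_eq_0 in E.
  replace (f 0) with ((f 0 - cpol c 0) + cpol c 0) by ring. rewrite E.
  unfold cpol; ring.
Qed.

Lemma jet_weaken f c B B' : (B <= B')%R -> jet r f c B -> jet r f c B'.
Proof.
  intros HB [H1 H2]; split; [lra|]. intros t Ht.
  eapply Rle_trans; [apply (H2 t Ht)|]. apply Rmult_le_compat_r; [|lra].
  apply pow_le, Cmod_ge_0.
Qed.

Lemma jet_ext f g c d B :
  (forall t, (Cmod t < r)%R -> f t = g t) -> (forall n, (n <= 3)%nat -> c n = d n) ->
  jet r f c B -> jet r g d B.
Proof.
  intros E1 E2 [H1 H2].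
  assert (Ew : wt r c = wt r d) by (unfold wt; rewrite !E2 by lia; reflexivity).
  assert (Ep : forall t, cpol c t = cpol d t)
    by (intros; unfold cpol; rewrite !E2 by lia; reflexivity).
  split; [rewrite <- Ew; exact H1|].
  intros t Ht. rewrite <- Ew, <- Ep, <- E1 by exact Ht. apply H2, Ht.
Qed.

Lemma jet_affine (a b : C) :
  jet r (fun t => a + b * t) (unit_seq a b) (Cmod a + Cmod b * r)%R.
Proof.
  assert (E : wt r (unit_seq a b) = (Cmod a + Cmod b * r)%R)
    by (unfold wt; simpl; rewrite Cmod_0; ring).
  split; [lra|]. intros t Ht. rewrite E.
  replace (a + b * t - cpol (unit_seq a b) t) with (RtoC 0) by (unfold cpol; simpl; ring).
  rewrite Cmod_0; apply Req_le; ring.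
Qed.

Lemma jet_const (a : C) : jet r (fun _ => a) (unit_seq a 0) (Cmod a).
Proof.
  apply jet_weaken with (Cmod a + Cmod 0 * r)%R; [rewrite Cmod_0; lra|].
  eapply jet_ext; [| |apply jet_affine]; intros; simpl; [ring|reflexivity].
Qed.

Lemma jet_plus f g c d B B' :
  jet r f c B -> jet r g d B' ->
  jet r (fun t => f t + g t) (fun n => c n + d n) (B + B')%R.
Proof.
  intros [F1 F2] [G1 G2].
  assert (Hw : (wt r (fun n => c n + d n)%C <= wt r c + wt r d)%R).
  { unfold wt.
    assert (H : forall n, (Cmod (c n + d n) * r ^ n
                           <= Cmod (c n) * r ^ n + Cmod (d n) * r ^ n)%R).
    { intros n. rewrite <- Rmult_plus_distr_r.
      apply Rmult_le_compat_r; [apply pow_le; lra|apply Cmod_triangle]. }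
    pose proof (H 0%nat); pose proof (H 1%nat); pose proof (H 2%nat); pose proof (H 3%nat).
    rewrite pow_1, pow_O in *. lra. }
  split; [lra|]. intros t Ht. specialize (F2 t Ht); specialize (G2 t Ht).
  replace (f t + g t - cpol (fun n => c n + d n) t)
    with ((f t - cpol c t) + (g t - cpol d t)) by (unfold cpol; ring).
  apply Rle_trans with ((Cmod (f t - cpol c t) + Cmod (g t - cpol d t)) * r ^ 4)%R.
  - apply Rmult_le_compat_r; [lra|apply Cmod_triangle].
  - apply Rle_trans with (((B - wt r c) + (B' - wt r d)) * Cmod t ^ 4)%R; [lra|].
    apply Rmult_le_compat_r; [apply pow_le, Cmod_ge_0|lra].
Qed.

(** The weighted sizes multiply like power series in [r].  The products of
    coefficients of total degree at least 4 ([high]) move into the remainder, and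
    [low + high] is the whole product, so nothing is lost in the bound. *)
Lemma jet_mult f g c d B B' :
  jet r f c B -> jet r g d B' ->
  jet r (fun t => f t * g t) (conv c d) (B * B')%R.
Proof.
  intros F G. pose proof (jet_norm_ge_0 _ _ _ F) as B0. pose proof (jet_norm_ge_0 _ _ _ G) as B0'.
  set (x := fun n => (Cmod (c n) * r ^ n)%R). set (y := fun n => (Cmod (d n) * r ^ n)%R).
  assert (Hx : forall n, (0 <= x n)%R).
  { intros n; apply Rmult_le_pos; [apply Cmod_ge_0|apply pow_le; lra]. }
  assert (Hy : forall n, (0 <= y n)%R).
  { intros n; apply Rmult_le_pos; [apply Cmod_ge_0|apply pow_le; lra]. }
  assert (Wc : wt r c = (x 0%nat + x 1%nat + x 2%nat + x 3%nat)%R)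
    by (unfold wt, x; ring).
  assert (Wd : wt r d = (y 0%nat + y 1%nat + y 2%nat + y 3%nat)%R)
    by (unfold wt, y; ring).
  assert (Hc : forall a b, (Cmod (c a * d b) * r ^ (a + b) = x a * y b)%R).
  { intros a b. rewrite Cmod_mult, pow_add. unfold x, y; ring. }
  pose proof (Hc 0 0)%nat as C00; pose proof (Hc 0 1)%nat as C01;
  pose proof (Hc 0 2)%nat as C02; pose proof (Hc 0 3)%nat as C03;
  pose proof (Hc 1 0)%nat as C10; pose proof (Hc 1 1)%nat as C11;
  pose proof (Hc 1 2)%nat as C12; pose proof (Hc 1 3)%nat as C13;
  pose proof (Hc 2 0)%nat as C20; pose proof (Hc 2 1)%nat as C21;
  pose proof (Hc 2 2)%nat as C22; pose proof (Hc 2 3)%nat as C23;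
  pose proof (Hc 3 0)%nat as C30; pose proof (Hc 3 1)%nat as C31;
  pose proof (Hc 3 2)%nat as C32; pose proof (Hc 3 3)%nat as C33.
  cbn [Nat.add] in *.
  (* Weighted products of coefficients, of total degree below 4 and at least 4. *)
  set (low := (x 0%nat * y 0%nat + (x 0%nat * y 1%nat + x 1%nat * y 0%nat)
    + (x 0%nat * y 2%nat + x 1%nat * y 1%nat + x 2%nat * y 0%nat)
    + (x 0%nat * y 3%nat + x 1%nat * y 2%nat + x 2%nat * y 1%nat + x 3%nat * y 0%nat))%R).
  set (high := (x 1%nat * y 3%nat + x 2%nat * y 2%nat + x 3%nat * y 1%nat
    + (x 2%nat * y 3%nat + x 3%nat * y 2%nat) + x 3%nat * y 3%nat)%R).
  assert (HW : (wt r (conv c d) <= low)%R).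
  { unfold wt. rewrite conv_0, conv_1, conv_2, conv_3.
    assert (Ht : forall n u v, (Cmod (u + v) * r ^ n <= Cmod u * r ^ n + Cmod v * r ^ n)%R).
    { intros n u v. rewrite <- Rmult_plus_distr_r.
      apply Rmult_le_compat_r; [apply pow_le; lra|apply Cmod_triangle]. }
    pose proof (Ht 1%nat (c 0%nat * d 1%nat) (c 1%nat * d 0%nat)).
    pose proof (Ht 2%nat (c 0%nat * d 2%nat + c 1%nat * d 1%nat) (c 2%nat * d 0%nat)).
    pose proof (Ht 2%nat (c 0%nat * d 2%nat) (c 1%nat * d 1%nat)).
    pose proof (Ht 3%nat (c 0%nat * d 3%nat + c 1%nat * d 2%nat + c 2%nat * d 1%nat)
                   (c 3%nat * d 0%nat)).
    pose proof (Ht 3%nat (c 0%nat * d 3%nat + c 1%nat * d 2%nat) (c 2%nat * d 1%nat)).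
    pose proof (Ht 3%nat (c 0%nat * d 3%nat) (c 1%nat * d 2%nat)).
    unfold low. rewrite pow_O in *. rewrite pow_1 in *. lra. }
  assert (Hsplit : (low + high = wt r c * wt r d)%R).
  { rewrite Wc, Wd; unfold low, high; ring. }
  assert (Hhigh : (0 <= high)%R).
  { unfold high. repeat apply Rplus_le_le_0_compat; apply Rmult_le_pos; auto. }
  pose proof (jet_wt _ _ _ F) as WB. pose proof (jet_wt _ _ _ G) as WB'.
  assert (Hmm : (wt r c * wt r d <= B * B')%R).
  { apply Rmult_le_compat; try assumption; apply wt_ge_0, Hr. }
  split; [lra|]. intros t Ht.
  destruct F as [_ F2], G as [_ G2]. specialize (F2 t Ht).
  assert (Gt : (Cmod (g t) <= B')%R) by (apply (jet_bound g d B'); [split; assumption|exact Ht]).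
  specialize (G2 t Ht).
  set (T := (Cmod t ^ 4)%R) in *. assert (T0 : (0 <= T)%R) by apply pow_le, Cmod_ge_0.
  set (rest := t ^ 4 * (c 1%nat * d 3%nat + c 2%nat * d 2%nat + c 3%nat * d 1%nat
      + (c 2%nat * d 3%nat + c 3%nat * d 2%nat) * t + c 3%nat * d 3%nat * t ^ 2)).
  replace (f t * g t - cpol (conv c d) t) with
    ((f t - cpol c t) * g t + cpol c t * (g t - cpol d t) + rest)
    by (unfold rest, cpol; rewrite conv_0, conv_1, conv_2, conv_3; ring).
  assert (R1 : (Cmod ((f t - cpol c t) * g t) * r ^ 4 <= (B - wt r c) * B' * T)%R).
  { rewrite Cmod_mult.
    apply Rle_trans with (((B - wt r c) * T) * B')%R; [|lra].
    replace (Cmod (f t - cpol c t) * Cmod (g t) * r ^ 4)%R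
      with (Cmod (f t - cpol c t) * r ^ 4 * Cmod (g t))%R by ring.
    apply Rmult_le_compat; try assumption; [|apply Cmod_ge_0].
    apply Rmult_le_pos; [apply Cmod_ge_0|lra]. }
  assert (R2 : (Cmod (cpol c t * (g t - cpol d t)) * r ^ 4 <= wt r c * (B' - wt r d) * T)%R).
  { rewrite Cmod_mult.
    replace (Cmod (cpol c t) * Cmod (g t - cpol d t) * r ^ 4)%R
      with (Cmod (cpol c t) * (Cmod (g t - cpol d t) * r ^ 4))%R by ring.
    rewrite Rmult_assoc.
    apply Rmult_le_compat; try assumption; [apply Cmod_ge_0| |apply Cmod_cpol; assumption].
    apply Rmult_le_pos; [apply Cmod_ge_0|lra]. }
  assert (R3 : (Cmod rest * r ^ 4 <= high * T)%R).
  { unfold rest. rewrite Cmod_mult, Cmod_pow. fold T.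
    rewrite (Rmult_comm high), Rmult_assoc. apply Rmult_le_compat_l; [exact T0|].
    set (cd := fun a b => Cmod (c a * d b)).
    assert (P0 : forall a b, (0 <= cd a b)%R) by (intros; apply Cmod_ge_0).
    assert (Q : (Cmod (c 1%nat * d 3%nat + c 2%nat * d 2%nat + c 3%nat * d 1%nat
      + (c 2%nat * d 3%nat + c 3%nat * d 2%nat) * t + c 3%nat * d 3%nat * t ^ 2)
      <= cd 1%nat 3%nat + cd 2%nat 2%nat + cd 3%nat 1%nat
         + (cd 2%nat 3%nat + cd 3%nat 2%nat) * r + cd 3%nat 3%nat * r ^ 2)%R).
    { eapply Rle_trans; [apply Cmod_triangle|]; apply Rplus_le_compat.
      - eapply Rle_trans; [apply Cmod_triangle|]; apply Rplus_le_compat.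
        + eapply Rle_trans; [apply Cmod_triangle|]; apply Rplus_le_compat; [|apply Rle_refl].
          apply Cmod_triangle.
        + rewrite Cmod_mult. apply Rmult_le_compat; try apply Cmod_ge_0; [apply Cmod_triangle|lra].
      - rewrite Cmod_mult, Cmod_pow. apply Rmult_le_compat_l; [apply Cmod_ge_0|].
        apply pow_incr; split; [apply Cmod_ge_0|lra]. }
    apply Rmult_le_compat_r with (r := (r ^ 4)%R) in Q; [|lra].
    eapply Rle_trans; [exact Q|]. unfold high, cd.
    rewrite <- C13, <- C22, <- C31, <- C23, <- C32, <- C33. apply Req_le; ring. }
  apply Rle_trans with ((Cmod ((f t - cpol c t) * g t) + Cmod (cpol c t * (g t - cpol d t))
                         + Cmod rest) * r ^ 4)%R.
  { apply Rmult_le_compat_r; [lra|].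
    eapply Rle_trans; [apply Cmod_triangle|]. apply Rplus_le_compat_r, Cmod_triangle. }
  apply Rle_trans with ((B * B' - low) * T)%R.
  - replace (B * B' - low)%R with ((B - wt r c) * B' + wt r c * (B' - wt r d) + high)%R; [lra|].
    replace high with (wt r c * wt r d - low)%R by lra. ring.
  - apply Rmult_le_compat_r; [exact T0|lra].
Qed.

Lemma jet_scal a f c B :
  jet r f c B -> jet r (fun t => a * f t) (fun n => a * c n) (Cmod a * B)%R.
Proof.
  intros H. eapply jet_ext; [reflexivity| |apply (jet_mult _ _ _ _ _ _ (jet_const a) H)].
  intros n Hn. destruct n as [|[|[|[|n]]]]; try lia;
    rewrite ?conv_0, ?conv_1, ?conv_2, ?conv_3; simpl; ring.
Qed.

(** The reciprocal of an affine function is a geometric series, whose norm is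
    the sum of the series of absolute values. *)
Lemma jet_inv_affine (a b : C) :
  (Cmod b * r < Cmod a)%R ->
  jet r (fun t => / (a + b * t)) (fun n => / a * (- b / a) ^ n)
    (/ (Cmod a - Cmod b * r))%R.
Proof.
  intros H.
  assert (Hbr : (0 <= Cmod b * r)%R) by (apply Rmult_le_pos; [apply Cmod_ge_0|lra]).
  assert (Ha : a <> 0) by (apply Cmod_gt_0; lra).
  assert (Ha' : (0 < Cmod a)%R) by (apply Cmod_gt_0, Ha).
  set (y := (Cmod b * r / Cmod a)%R).
  assert (Hy : (0 <= y < 1)%R).
  { split; [apply Rdiv_le_0_compat; lra|]. apply Rlt_div_l; lra. }
  assert (Hcoef : forall n, (Cmod (/ a * (- b / a) ^ n) * r ^ n = / Cmod a * y ^ n)%R).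
  { intros n. rewrite Cmod_mult, Cmod_pow, Cmod_div, Cmod_opp, Cmod_inv by exact Ha.
    unfold y. rewrite Rmult_assoc, <- Rpow_mult_distr. do 2 f_equal. field; lra. }
  assert (HW : (wt r (fun n => / a * (- b / a) ^ n)%C
                = / Cmod a * (1 + y + y ^ 2 + y ^ 3))%R).
  { unfold wt. pose proof (Hcoef 0%nat) as H0. pose proof (Hcoef 1%nat) as H1.
    rewrite pow_1 in H1. rewrite pow_O, Rmult_1_r in H0.
    rewrite H0, H1, (Hcoef 2%nat), (Hcoef 3%nat). ring. }
  assert (HB : (/ (Cmod a - Cmod b * r) = / Cmod a * / (1 - y))%R).
  { unfold y. field. split; lra. }
  assert (Hdiff : (/ Cmod a * / (1 - y) - / Cmod a * (1 + y + y ^ 2 + y ^ 3)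
                   = / Cmod a * y ^ 4 * / (1 - y))%R) by (field; lra).
  assert (Hpos : (0 <= / Cmod a * y ^ 4 * / (1 - y))%R).
  { assert (0 <= y ^ 4)%R by (apply pow_le; lra).
    assert (0 < / Cmod a)%R by (apply Rinv_0_lt_compat; lra).
    assert (0 < / (1 - y))%R by (apply Rinv_0_lt_compat; lra).
    apply Rmult_le_pos; [apply Rmult_le_pos|]; lra. }
  split; [rewrite HW, HB; lra|].
  intros t Ht. rewrite HW, HB, Hdiff.
  assert (Hbt : (Cmod (b * t) <= Cmod b * r)%R).
  { rewrite Cmod_mult; apply Rmult_le_compat_l; [apply Cmod_ge_0|lra]. }
  assert (Hden : (Cmod a - Cmod b * r <= Cmod (a + b * t))%R).
  { assert (Cmod a <= Cmod (a + b * t) + Cmod (b * t))%R; [|lra].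
    replace a with ((a + b * t) + - (b * t)) at 1 by ring.
    eapply Rle_trans; [apply Cmod_triangle|]. rewrite Cmod_opp; lra. }
  assert (Hd0 : a + b * t <> 0) by (apply Cmod_gt_0; lra).
  replace (/ (a + b * t) - cpol (fun n => / a * (- b / a) ^ n) t)
    with ((- b / a) ^ 4 * t ^ 4 * / (a + b * t))
    by (unfold cpol; field; split; assumption).
  rewrite !Cmod_mult, !Cmod_pow, Cmod_div, Cmod_opp by exact Ha.
  rewrite Cmod_inv by exact Hd0.
  replace ((Cmod b / Cmod a) ^ 4 * Cmod t ^ 4 * / Cmod (a + b * t) * r ^ 4)%R
    with (y ^ 4 * Cmod t ^ 4 * / Cmod (a + b * t))%R
    by (unfold y; field; split; [apply Rgt_not_eq; lra|lra]).
  replace (/ Cmod a * y ^ 4 * / (1 - y) * Cmod t ^ 4)%R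
    with (y ^ 4 * Cmod t ^ 4 * / (Cmod a - Cmod b * r))%R by (rewrite HB; ring).
  apply Rmult_le_compat_l.
  - apply Rmult_le_pos; apply pow_le; [lra|apply Cmod_ge_0].
  - apply Rinv_le_contravar; lra.
Qed.

Lemma jet_pow f c B n :
  jet r f c B -> jet r (fun t => f t ^ n) (fun b => Nat.iter n (conv c) (unit_seq 1 0) b) (B ^ n)%R.
Proof.
  intros H; induction n as [|n IH]; simpl.
  - apply jet_weaken with (Cmod 1); [rewrite Cmod_1; lra|apply jet_const].
  - exact (jet_mult _ _ _ _ _ _ H IH).
Qed.

(** One norm controls coefficients and remainder together, so a single summable
    bound allows both to be summed termwise. *)
Lemma jet_sum (f : nat -> C -> C) (c : nat -> nat -> C) (B : nat -> R) :
  (forall n, jet r (f n) (c n) (B n)) -> ex_series B ->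
  jet r (fun t => Csum (fun n => f n t)) (fun b => Csum (fun n => c n b)) (Series B).
Proof.
  intros H HB.
  assert (Hw : ex_series (fun n => wt r (c n))).
  { apply (ex_series_le (fun n => wt r (c n)) B); [|exact HB].
    intros n. unfold norm; simpl; unfold abs; simpl.
    rewrite Rabs_pos_eq by (apply wt_ge_0, Hr). apply (jet_wt _ _ _ (H n)). }
  assert (Hcs : forall b, (b <= 3)%nat -> Summable (fun n => c n b)).
  { intros b Hb. apply (Summable_le _ (fun n => / r ^ b * B n)%R).
    - intros n. pose proof (jet_coef _ _ _ b Hb (H n)). unfold Rdiv in *. lra.
    - apply (ex_series_scal_l (/ r ^ b)%R B HB). }
  assert (Hcw : ex_series (fun n => Cmod (c n 0%nat)) /\ ex_series (fun n => Cmod (c n 1%nat))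
    /\ ex_series (fun n => Cmod (c n 2%nat)) /\ ex_series (fun n => Cmod (c n 3%nat))).
  { repeat split; apply Hcs; lia. }
  destruct Hcw as [S0 [S1 [S2 S3]]].
  assert (HWs : (wt r (fun b => Csum (fun n => c n b)) <= Series (fun n => wt r (c n)))%R).
  { unfold wt at 2.
    rewrite (Series_plus (fun n => Cmod (c n 0%nat) + Cmod (c n 1%nat) * r
                                   + Cmod (c n 2%nat) * r ^ 2)%R
                         (fun n => Cmod (c n 3%nat) * r ^ 3)%R);
    [|repeat apply (@ex_series_plus R_AbsRing R_NormedModule);
        try apply ex_series_scal_r; assumption
     |apply ex_series_scal_r; assumption].
    rewrite (Series_plus (fun n => Cmod (c n 0%nat) + Cmod (c n 1%nat) * r)%R
                         (fun n => Cmod (c n 2%nat) * r ^ 2)%R);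
    [|repeat apply (@ex_series_plus R_AbsRing R_NormedModule);
        try apply ex_series_scal_r; assumption
     |apply ex_series_scal_r; assumption].
    rewrite (Series_plus (fun n => Cmod (c n 0%nat))
                         (fun n => Cmod (c n 1%nat) * r)%R);
    [|assumption|apply ex_series_scal_r; assumption].
    rewrite !Series_scal_r. unfold wt.
    repeat apply Rplus_le_compat; try apply Rmult_le_compat_r; try (apply pow_le; lra); try lra;
      apply Csum_le_Series; auto; intros; apply Rle_refl. }
  assert (HSB : (Series (fun n => wt r (c n)) <= Series B)%R).
  { apply Series_le; [|exact HB]. intros n; split; [apply wt_ge_0, Hr|apply (jet_wt _ _ _ (H n))]. }
  split; [lra|]. intros t Ht.
  assert (HfS : Summable (fun n => f n t)).
  { apply (Summable_le _ B); [|exact HB]. intros n; apply (jet_bound _ _ _ _ (H n) Ht). }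
  assert (E : Csum (fun n => f n t) - cpol (fun b => Csum (fun n => c n b)) t
              = Csum (fun n => f n t - cpol (c n) t)).
  { transitivity (Csum (fun n => f n t + (- c n 0%nat + ((- t) * c n 1%nat
       + ((- t ^ 2) * c n 2%nat + (- t ^ 3) * c n 3%nat))))).
    - pose proof (Summable_scal (- t) _ S1) as T1.
      pose proof (Summable_scal (- t ^ 2) _ S2) as T2.
      pose proof (Summable_scal (- t ^ 3) _ S3) as T3.
      pose proof (Summable_plus _ _ T2 T3) as T23.
      pose proof (Summable_plus _ _ T1 T23) as T123.
      pose proof (Summable_scal (- (1)) _ S0) as T0.
      assert (T0' : Summable (fun n => - c n 0%nat))
        by (eapply Summable_ext; [|exact T0]; intros; simpl; ring).
      rewrite (Csum_plus (fun n => f n t)), (Csum_plus (fun n => - c n 0%nat)),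
        (Csum_plus (fun n => (- t) * c n 1%nat)), (Csum_plus (fun n => (- t ^ 2) * c n 2%nat)),
        !Csum_scal; try assumption; [|apply Summable_plus; assumption].
      rewrite (Csum_ext (fun n => - c n 0%nat) (fun n => - (1) * c n 0%nat)) by (intros; ring).
      rewrite Csum_scal by exact S0. unfold cpol; ring.
    - apply Csum_ext; intros n; unfold cpol; ring. }
  rewrite E.
  assert (Hle : (Cmod (Csum (fun n => f n t - cpol (c n) t)%C)
                 <= Series (fun n => (B n - wt r (c n)) * (Cmod t ^ 4 / r ^ 4)))%R).
  { apply Csum_le_Series.
    - intros n. destruct (H n) as [_ Hn]. specialize (Hn t Ht).
      apply Rle_div_r in Hn; [|exact r4]. unfold Rdiv in *. lra.
    - apply ex_series_scal_r. apply (@ex_series_minus R_AbsRing R_NormedModule B); assumption. }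
  rewrite Series_scal_r, Series_minus in Hle by assumption.
  apply Rmult_le_compat_r with (r := (r ^ 4)%R) in Hle; [|lra].
  eapply Rle_trans; [exact Hle|].
  replace ((Series B - Series (fun n => wt r (c n))) * (Cmod t ^ 4 / r ^ 4) * r ^ 4)%R
    with ((Series B - Series (fun n => wt r (c n))) * Cmod t ^ 4)%R by (field; lra).
  apply Rmult_le_compat_r; [apply pow_le, Cmod_ge_0|lra].
Qed.

End Jets.

(** * Expansions modulo [(1 - P) ^ 4] *)

Lemma cpol_sum_n (c : nat -> C) (t : C) : sum_n (fun b => c b * t ^ b) 3 = cpol c t.
Proof.
  rewrite sum_n_bsum; unfold cpol; simpl. ring.
Qed.

Lemma eqmod4_trans (f g h : C -> C) : eqmod4 f g -> eqmod4 g h -> eqmod4 f h.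
Proof.
  intros [M1 [e1 [H1 F]]] [M2 [e2 [H2 G]]].
  exists (M1 + M2)%R, (Rmin e1 e2); split; [apply Rmin_glb_lt; assumption|].
  intros P HP. pose proof (Rmin_l e1 e2); pose proof (Rmin_r e1 e2).
  specialize (F P ltac:(lra)); specialize (G P ltac:(lra)).
  replace (f P - h P) with ((f P - g P) + (g P - h P)) by ring.
  eapply Rle_trans; [apply Cmod_triangle|]. lra.
Qed.

Lemma eqmod4_sym (f g : C -> C) : eqmod4 f g -> eqmod4 g f.
Proof.
  intros [M [e [He F]]]. exists M, e; split; [exact He|]. intros P HP.
  replace (g P - f P) with (- (f P - g P)) by ring. rewrite Cmod_opp. auto.
Qed.

Lemma eqmod4_near (f g : C -> C) (e : R) :
  (0 < e)%R -> (forall P, (Cmod (P - 1) < e)%R -> f P = g P) -> eqmod4 f g.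
Proof.
  intros He H. exists 0%R, e; split; [exact He|]. intros P HP. rewrite H by exact HP.
  replace (g P - g P) with (RtoC 0) by ring. rewrite Cmod_0; lra.
Qed.

Lemma eqmod4_plus (f g f' g' : C -> C) :
  eqmod4 f g -> eqmod4 f' g' -> eqmod4 (fun P => f P + f' P) (fun P => g P + g' P).
Proof.
  intros [M1 [e1 [H1 F]]] [M2 [e2 [H2 G]]].
  exists (M1 + M2)%R, (Rmin e1 e2); split; [apply Rmin_glb_lt; assumption|].
  intros P HP. pose proof (Rmin_l e1 e2); pose proof (Rmin_r e1 e2).
  specialize (F P ltac:(lra)); specialize (G P ltac:(lra)).
  replace (f P + f' P - (g P + g' P)) with ((f P - g P) + (f' P - g' P)) by ring.
  eapply Rle_trans; [apply Cmod_triangle|]. lra.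
Qed.

Lemma jet_expands (r : R) (f : C -> C) (c : nat -> C) (B : R) :
  (0 < r)%R -> jet r (fun t => f (1 - t)) c B -> expands f c.
Proof.
  intros Hr [_ H]. exists ((B - wt r c) / r ^ 4)%R, r. split; [exact Hr|].
  intros P HP. rewrite cpol_sum_n.
  specialize (H (1 - P)).
  rewrite <- Cmod_opp in HP. replace (- (P - 1)) with (1 - P) in HP by ring.
  specialize (H HP). replace (1 - (1 - P)) with P in H by ring.
  apply Rle_div_r in H; [|apply pow_lt; exact Hr].
  unfold Rdiv in *. lra.
Qed.

Lemma expands_jet (f : C -> C) (c : nat -> C) :
  expands f c ->
  exists r0, (0 < r0)%R /\
    forall r, (0 < r <= r0)%R -> exists B, jet r (fun t => f (1 - t)) c B.
Proof.
  intros [M [e [He H]]]. exists e; split; [exact He|]. intros r Hr.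
  exists (wt r c + Rabs M * r ^ 4)%R.
  assert (0 <= Rabs M * r ^ 4)%R
    by (apply Rmult_le_pos; [apply Rabs_pos|apply pow_le; lra]).
  split; [lra|]. intros t Ht.
  specialize (H (1 - t)). rewrite cpol_sum_n in H.
  replace (1 - t - 1) with (- t) in H by ring. rewrite Cmod_opp in H.
  specialize (H ltac:(lra)). replace (1 - (1 - t)) with t in H by ring.
  assert (H4 : (0 <= Cmod t ^ 4)%R) by apply pow_le, Cmod_ge_0.
  apply Rle_trans with (Rabs M * Cmod t ^ 4 * r ^ 4)%R; [|apply Req_le; ring].
  apply Rmult_le_compat_r; [apply pow_le; lra|].
  eapply Rle_trans; [exact H|]. apply Rmult_le_compat_r; [exact H4|apply Rle_abs].
Qed.

Lemma expands_eqmod4 (f g : C -> C) (c : nat -> C) :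
  eqmod4 f g -> expands g c -> expands f c.
Proof. apply eqmod4_trans. Qed.

Lemma expands_ext (f : C -> C) (c d : nat -> C) :
  (forall n, (n <= 3)%nat -> c n = d n) -> expands f c -> expands f d.
Proof.
  intros E H. eapply eqmod4_trans; [exact H|].
  apply eqmod4_near with 1%R; [lra|]. intros P _. rewrite !cpol_sum_n.
  unfold cpol; rewrite !E by lia; reflexivity.
Qed.

Lemma expands_mult (f g : C -> C) (c d : nat -> C) :
  expands f c -> expands g d -> expands (fun P => f P * g P) (conv c d).
Proof.
  intros Hf Hg.
  destruct (expands_jet _ _ Hf) as [r1 [H1 F]]. destruct (expands_jet _ _ Hg) as [r2 [H2 G]].
  pose proof (Rmin_glb_lt _ _ _ H1 H2) as Hr.
  destruct (F (Rmin r1 r2)) as [B FB]; [split; [exact Hr|apply Rmin_l]|].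
  destruct (G (Rmin r1 r2)) as [B' GB]; [split; [exact Hr|apply Rmin_r]|].
  eapply jet_expands; [exact Hr|]. apply (jet_mult _ Hr _ _ _ _ _ _ FB GB).
Qed.

Lemma expands_plus (f g : C -> C) (c d : nat -> C) :
  expands f c -> expands g d -> expands (fun P => f P + g P) (fun n => c n + d n).
Proof.
  intros Hf Hg. eapply eqmod4_trans; [apply eqmod4_plus; [exact Hf|exact Hg]|].
  apply eqmod4_near with 1%R; [lra|]. intros P _. rewrite !cpol_sum_n. unfold cpol; ring.
Qed.

Lemma expands_affine (a b : C) : expands (fun P => a + b * (1 - P)) (unit_seq a b).
Proof.
  apply eqmod4_near with 1%R; [lra|]. intros P _. rewrite cpol_sum_n.
  unfold cpol; simpl; ring.
Qed.

Lemma expands_scal (a : C) (f : C -> C) (c : nat -> C) :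
  expands f c -> expands (fun P => a * f P) (fun n => a * c n).
Proof.
  intros Hf.
  eapply expands_ext; [|eapply expands_eqmod4; [|apply (expands_mult _ _ _ _ (expands_affine a 0) Hf)]].
  - intros n Hn. destruct n as [|[|[|[|n]]]]; try lia;
      rewrite ?conv_0, ?conv_1, ?conv_2, ?conv_3; simpl; ring.
  - apply eqmod4_near with 1%R; [lra|]. intros; ring.
Qed.

Lemma expands_at_1 (f : C -> C) (c : nat -> C) : expands f c -> f 1 = c O.
Proof.
  intros H. destruct (expands_jet _ _ H) as [r [Hr F]].
  destruct (F r ltac:(lra)) as [B FB]. apply (jet_at_0 r Hr) in FB.
  rewrite <- FB. f_equal. ring.
Qed.

Lemma small_multiple_0 (a : C) (K e : R) (g : C -> C) :
  (0 < e)%R ->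
  (forall t, (0 < Cmod t < e)%R -> (Cmod (a + t * g t) <= K * Cmod t)%R) ->
  (forall t, (0 < Cmod t < e)%R -> (Cmod (g t) <= K)%R) -> a = 0.
Proof.
  intros He H Hg. apply Cmod_eq_0. apply Rle_antisym; [|apply Cmod_ge_0].
  apply Rnot_lt_le; intros Ha.
  assert (HK : (0 <= K)%R).
  { eapply Rle_trans; [apply Cmod_ge_0|]. apply (Hg (RtoC (e / 2))).
    rewrite Cmod_R, Rabs_pos_eq; lra. }
  set (s := Rmin (e / 2) (Cmod a / (4 * (K + 1)))).
  assert (Hs : (0 < s)%R).
  { apply Rmin_glb_lt; [lra|]. apply Rdiv_lt_0_compat; lra. }
  assert (Hs1 : (s <= e / 2)%R) by apply Rmin_l.
  assert (Hs2 : (s * (4 * (K + 1)) <= Cmod a)%R).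
  { apply Rle_div_r; [lra|apply Rmin_r]. }
  assert (Es : Cmod (RtoC s) = s) by (rewrite Cmod_R, Rabs_pos_eq; lra).
  specialize (H (RtoC s) ltac:(lra)). specialize (Hg (RtoC s) ltac:(lra)).
  assert (Cmod a <= K * s + s * K)%R.
  { replace a with ((a + s * g s) + - (s * g s)) by ring.
    eapply Rle_trans; [apply Cmod_triangle|]. rewrite Cmod_opp, Cmod_mult, Es in *.
    apply Rplus_le_compat; [lra|]. apply Rmult_le_compat_l; lra. }
  nra.
Qed.

Fixpoint horner (l : list C) (t : C) : C :=
  match l with nil => 0 | cons a l' => a + t * horner l' t end.

Lemma horner_bounded (l : list C) :
  exists K, (0 <= K)%R /\ forall t, (Cmod t < 1)%R -> (Cmod (horner l t) <= K)%R.
Proof.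
  induction l as [|a l [K [HK IH]]]; simpl.
  - exists 0%R. split; [lra|]. intros. rewrite Cmod_0; lra.
  - exists (Cmod a + K)%R. split; [pose proof (Cmod_ge_0 a); lra|]. intros t Ht.
    eapply Rle_trans; [apply Cmod_triangle|]. apply Rplus_le_compat_l.
    rewrite Cmod_mult. specialize (IH t Ht). pose proof (Cmod_ge_0 t).
    pose proof (Cmod_ge_0 (horner l t)). nra.
Qed.

(** In Horner form the lowest coefficient vanishes first, and dividing by [t]
    leaves the same problem for the remaining ones. *)
Lemma horner_small (l : list C) (M e : R) :
  (0 < e <= 1)%R -> (0 <= M)%R ->
  (forall t, (0 < Cmod t < e)%R -> (Cmod (horner l t) <= M * Cmod t ^ length l)%R) ->
  List.Forall (fun a : C => a = 0) l.
Proof.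
  intros He HM. induction l as [|a l IH]; intros H; [constructor|]. simpl in H.
  assert (Ha : a = 0).
  { destruct (horner_bounded l) as [K [HK Hl]].
    apply (small_multiple_0 a (K + M) e (horner l)); [lra| |].
    - intros t Ht. eapply Rle_trans; [apply (H t Ht)|].
      assert (0 <= Cmod t ^ length l <= 1)%R by (apply pow_01; lra).
      apply Rle_trans with (M * (Cmod t * 1))%R; [|nra].
      apply Rmult_le_compat_l; [exact HM|]. apply Rmult_le_compat_l; lra.
    - intros t Ht. specialize (Hl t ltac:(lra)). lra. }
  constructor; [exact Ha|]. apply IH. intros t Ht.
  specialize (H t Ht). rewrite Ha, Cplus_0_l, Cmod_mult in H.
  apply Rmult_le_reg_l with (Cmod t); lra.
Qed.

Lemma expands_unique (f : C -> C) (c d : nat -> C) (n : nat) :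
  (n <= 3)%nat -> expands f c -> expands f d -> c n = d n.
Proof.
  intros Hn Hc Hd.
  destruct (eqmod4_trans _ _ _ (eqmod4_sym _ _ Hc) Hd) as [M [e [He H]]].
  assert (HF : List.Forall (fun a : C => a = 0) (List.map (fun n => c n - d n) (List.seq 0 4))).
  { apply (horner_small _ (Rabs M) (Rmin e 1)).
    - split; [apply Rmin_glb_lt; lra|apply Rmin_r].
    - apply Rabs_pos.
    - intros t Ht. pose proof (Rmin_l e 1). specialize (H (1 - t)).
      replace (1 - t - 1) with (- t) in H by ring. rewrite Cmod_opp, !cpol_sum_n in H.
      specialize (H ltac:(lra)). replace (1 - (1 - t)) with t in H by ring.
      match goal with |- (Cmod ?x <= _)%R => replace x with (cpol c t - cpol d t)
        by (unfold cpol; simpl; ring) end.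
      eapply Rle_trans; [exact H|].
      apply Rmult_le_compat_r; [apply pow_le, Cmod_ge_0|apply Rle_abs]. }
  rewrite List.Forall_forall in HF. apply Ceq_minus, HF.
  apply (List.in_map (fun n => c n - d n)), List.in_seq. lia.
Qed.

(** Solves [conv c e = 1] degree by degree. *)
Definition inv_coef (c : nat -> C) (n : nat) : C :=
  let e0 := / c 0%nat in
  let e1 := - e0 * (c 1%nat * e0) in
  let e2 := - e0 * (c 1%nat * e1 + c 2%nat * e0) in
  let e3 := - e0 * (c 1%nat * e2 + c 2%nat * e1 + c 3%nat * e0) in
  match n with O => e0 | 1%nat => e1 | 2%nat => e2 | _ => e3 end.

(** If [f e = 1 + O(t^4)] for the polynomial [e], then [1/f - e = (1 - f e)/f] is
    of the same order, because [f] is bounded away from 0. *)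
Lemma expands_inv (f : C -> C) (c : nat -> C) :
  c O <> 0 -> expands f c -> expands (fun P => / f P) (inv_coef c).
Proof.
  intros Hc Hf. set (e := inv_coef c).
  assert (He : expands (fun P => cpol e (1 - P)) e).
  { apply eqmod4_near with 1%R; [lra|]. intros; now rewrite cpol_sum_n. }
  pose proof (expands_mult _ _ _ _ Hf He) as Hfe.
  assert (H1 : expands (fun P => f P * cpol e (1 - P)) (unit_seq 1 0)).
  { eapply expands_ext; [|exact Hfe].
    intros n Hn. destruct n as [|[|[|[|n]]]]; try lia;
      rewrite ?conv_0, ?conv_1, ?conv_2, ?conv_3; unfold e, inv_coef, unit_seq; field; exact Hc. }
  destruct H1 as [M [e1 [He1 H1]]].
  destruct (expands_jet _ _ Hf) as [r [Hr F]]. destruct (F r ltac:(lra)) as [B FB].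
  assert (Hm : (0 < Cmod (c O))%R) by (apply Cmod_gt_0, Hc).
  (* f stays away from 0 near P = 1 *)
  assert (Hlow : exists d, (0 < d)%R /\
    forall P, (Cmod (P - 1) < d)%R -> (Cmod (c O) / 2 <= Cmod (f P))%R).
  { pose proof (jet_norm_ge_0 r Hr _ _ _ FB) as HB.
    exists (Rmin r (Cmod (c O) * r / (2 * (B + 1)))). split.
    { apply Rmin_glb_lt; [exact Hr|]. apply Rdiv_lt_0_compat; [apply Rmult_lt_0_compat|]; lra. }
    intros P HP. set (t := 1 - P).
    assert (Et : Cmod t = Cmod (P - 1)) by (rewrite <- Cmod_opp; f_equal; unfold t; ring).
    pose proof (Rmin_l r (Cmod (c O) * r / (2 * (B + 1)))).
    pose proof (Rmin_r r (Cmod (c O) * r / (2 * (B + 1)))).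
    assert (Ht2 : (Cmod t * (2 * (B + 1)) <= Cmod (c O) * r)%R) by (apply Rle_div_r; lra).
    pose proof (jet_lipschitz r Hr _ _ _ t FB ltac:(lra)) as HE. cbv beta in HE.
    replace (1 - t) with P in HE by (unfold t; ring).
    pose proof (Cmod_triangle (f P) (- (f P - c O))) as T.
    replace (f P + - (f P - c O)) with (c O) in T by ring. rewrite Cmod_opp in T.
    pose proof (Cmod_ge_0 t). nra. }
  destruct Hlow as [d [Hd Hlow]].
  exists (2 / Cmod (c O) * Rabs M)%R, (Rmin d e1).
  split; [apply Rmin_glb_lt; assumption|]. intros P HP.
  pose proof (Rmin_l d e1); pose proof (Rmin_r d e1).
  specialize (Hlow P ltac:(lra)). specialize (H1 P ltac:(lra)).
  rewrite cpol_sum_n in *. 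
  assert (Hf0 : f P <> 0) by (apply Cmod_gt_0; lra).
  replace (cpol (unit_seq 1 0) (1 - P)) with (RtoC 1) in H1 by (unfold cpol; simpl; ring).
  replace (/ f P - cpol e (1 - P)) with (- (f P * cpol e (1 - P) - 1) * / f P) by (field; exact Hf0).
  rewrite Cmod_mult, Cmod_opp, Cmod_inv by exact Hf0.
  replace (2 / Cmod (c O) * Rabs M * Cmod (1 - P) ^ 4)%R
    with (Rabs M * Cmod (1 - P) ^ 4 * (2 / Cmod (c O)))%R by ring.
  apply Rmult_le_compat.
  - apply Cmod_ge_0.
  - left; apply Rinv_0_lt_compat; lra.
  - eapply Rle_trans; [exact H1|]. apply Rmult_le_compat_r; [apply pow_le, Cmod_ge_0|apply Rle_abs].
  - replace (2 / Cmod (c O))%R with (/ (Cmod (c O) / 2))%R by (field; lra).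
    apply Rinv_le_contravar; lra.
Qed.

(** * Power series *)

Lemma is_derive_quadratic (f : C -> C) (z l : C) (K d : R) :
  (0 < d)%R ->
  (forall h, (Cmod h < d)%R -> (Cmod (f (z + h)%C - f z - h * l) <= K * Cmod h ^ 2)%R) ->
  is_derive (K := C_AbsRing) (V := C_NormedModule) f z l.
Proof.
  intros Hd H. split; [apply is_linear_scal_l|].
  intros x Hx eps.
  assert (E : x = z).
  { apply (is_filter_lim_locally_unique (K := C_AbsRing) (V := AbsRing_NormedModule C_AbsRing)) in Hx.
    symmetry; exact Hx. }
  subst x.
  set (K' := (Rabs K + 1)%R). assert (HK' : (0 < K')%R) by (unfold K'; pose proof (Rabs_pos K); lra).
  assert (Hd' : (0 < Rmin d (eps / K'))%R).
  { apply Rmin_glb_lt; [exact Hd|]. apply Rdiv_lt_0_compat; [apply cond_pos|exact HK']. }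
  exists (mkposreal _ Hd'). intros y Hy.
  assert (Hy' : (Cmod (y - z) < Rmin d (eps / K'))%R) by exact Hy.
  pose proof (Rmin_l d (eps / K')). pose proof (Rmin_r d (eps / K')).
  specialize (H (y - z) ltac:(lra)). replace (z + (y - z))%C with (y : C) in H by (unfold Cminus; rewrite (Cplus_comm y), Cplus_assoc, Cplus_opp_r, Cplus_0_l; reflexivity).
  change (Cmod (f y - f z - (y - z) * l) <= eps * Cmod (y - z))%R.
  eapply Rle_trans; [exact H|].
  assert (Hh : (Cmod (y - z) * K' <= eps)%R) by (apply Rle_div_r; lra).
  pose proof (Cmod_ge_0 (y - z)). pose proof (Rle_abs K).
  replace (K * Cmod (y - z) ^ 2)%R with ((K * Cmod (y - z)) * Cmod (y - z))%R by ring.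
  apply Rmult_le_compat_r; [assumption|].
  eapply Rle_trans; [|exact Hh]. rewrite Rmult_comm. apply Rmult_le_compat_l; unfold K'; lra.
Qed.

Lemma jet_is_derive (r : R) (f : C -> C) (z : C) (c : nat -> C) (B : R) :
  (0 < r)%R -> jet r (fun h => f (z + h)) c B ->
  is_derive (K := C_AbsRing) (V := C_NormedModule) f z (c 1%nat).
Proof.
  intros Hr FB.
  pose proof (jet_at_0 r Hr _ _ _ FB) as E0.
  cbv beta in E0. replace (z + 0) with z in E0 by ring.
  pose proof (jet_wt _ _ _ _ FB) as HW.
  apply is_derive_quadratic with ((B - wt r c) / r ^ 2 + Cmod (c 2%nat) + Cmod (c 3%nat) * r)%R r;
    [exact Hr|].
  intros h Hh. destruct FB as [_ FB]. specialize (FB h Hh).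
  replace (f (z + h) - f z - h * c 1%nat) with
    ((f (z + h) - cpol c h) + (c 2%nat + c 3%nat * h) * h ^ 2)
    by (rewrite E0; unfold cpol; ring).
  eapply Rle_trans; [apply Cmod_triangle|].
  rewrite Rplus_assoc, Rmult_plus_distr_r. apply Rplus_le_compat.
  - apply Rmult_le_reg_r with (r ^ 4)%R; [apply pow_lt; exact Hr|].
    eapply Rle_trans; [exact FB|].
    replace ((B - wt r c) / r ^ 2 * Cmod h ^ 2 * r ^ 4)%R
      with ((B - wt r c) * (Cmod h ^ 2 * r ^ 2))%R by (field; lra).
    apply Rmult_le_compat_l; [lra|].
    replace (Cmod h ^ 4)%R with (Cmod h ^ 2 * Cmod h ^ 2)%R by ring.
    apply Rmult_le_compat_l; [apply pow_le, Cmod_ge_0|].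
    apply pow_incr; split; [apply Cmod_ge_0|lra].
  - rewrite Cmod_mult, Cmod_pow. apply Rmult_le_compat_r; [apply pow_le, Cmod_ge_0|].
    eapply Rle_trans; [apply Cmod_triangle|]. apply Rplus_le_compat_l.
    rewrite Cmod_mult; apply Rmult_le_compat_l; [apply Cmod_ge_0|lra].
Qed.

Definition pser (a : nat -> C) (z : C) : C := Csum (fun n => a n * z ^ n).

(** Absolute convergence on the open disc of radius [R0]. *)
Definition psconv (a : nat -> C) (R0 : R) : Prop :=
  forall s, (0 <= s < R0)%R -> ex_series (fun n => Cmod (a n) * s ^ n)%R.

Definition pderiv (a : nat -> C) (n : nat) : C := INR (S n) * a (S n).

Lemma psconv_Summable a R0 z :
  psconv a R0 -> (Cmod z < R0)%R -> Summable (fun n => a n * z ^ n).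
Proof.
  intros H Hz. eapply Summable_le; [|apply (H (Cmod z)); split; [apply Cmod_ge_0|exact Hz]].
  intros n; rewrite Cmod_mult, Cmod_pow; lra.
Qed.

Lemma psconv_bounded a (M : R) : (forall n, (Cmod (a n) <= M)%R) -> psconv a 1.
Proof.
  intros H s Hs. apply (ex_series_le (fun n => Cmod (a n) * s ^ n)%R (fun n => M * s ^ n)%R).
  - intros n. unfold norm; simpl; unfold abs; simpl.
    rewrite Rabs_pos_eq by (apply Rmult_le_pos; [apply Cmod_ge_0|apply pow_le; lra]).
    apply Rmult_le_compat_r; [apply pow_le; lra|apply H].
  - apply (ex_series_scal_l M (fun n => s ^ n)%R). apply ex_series_geom.
    rewrite Rabs_pos_eq; lra.
Qed.

(** The first two coefficients of [(z + h)^n] are its value and its derivative. *)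
Lemma power_coefs (z : C) (n : nat) :
  Nat.iter n (conv (unit_seq z 1)) (unit_seq 1 0) 0%nat = z ^ n /\
  Nat.iter n (conv (unit_seq z 1)) (unit_seq 1 0) 1%nat = INR n * z ^ pred n.
Proof.
  induction n as [|n [IH0 IH1]].
  - simpl; split; ring.
  - change (Nat.iter (S n) (conv (unit_seq z 1)) (unit_seq 1 0)) with
      (conv (unit_seq z 1) (Nat.iter n (conv (unit_seq z 1)) (unit_seq 1 0))).
    rewrite conv_0, conv_1, IH0, IH1. split; [reflexivity|].
    rewrite S_INR, RtoC_plus. simpl unit_seq.
    destruct n as [|n]; simpl; ring.
Qed.

(** The jet of [(z + h)^n] has norm at most [(|z| + r)^n], so the jets of the terms
    are summable as long as [|z| + r] stays inside the disc. *)
Lemma jet_pser (r : R) (a : nat -> C) (R0 : R) (z : C) :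
  (0 < r)%R -> psconv a R0 -> (Cmod z + r < R0)%R ->
  exists c B, jet r (fun h => pser a (z + h)) c B /\
    c 1%nat = Csum (fun n => a n * (INR n * z ^ pred n)) /\
    Summable (fun n => a n * (INR n * z ^ pred n)).
Proof.
  intros Hr Ha Hz.
  assert (Hj : forall n, jet r (fun h => a n * (z + h) ^ n)
     (fun b => a n * Nat.iter n (conv (unit_seq z 1)) (unit_seq 1 0) b)
     (Cmod (a n) * (Cmod z + r) ^ n)%R).
  { intros n. apply (jet_scal r Hr). apply (jet_pow r Hr).
    eapply jet_weaken; [|eapply (jet_ext r); [| |apply (jet_affine r z 1)]].
    - rewrite Cmod_1; lra.
    - intros; simpl; ring.
    - reflexivity. }
  assert (HB : ex_series (fun n => Cmod (a n) * (Cmod z + r) ^ n)%R).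
  { apply Ha. pose proof (Cmod_ge_0 z). lra. }
  do 2 eexists. split; [apply (jet_sum r Hr _ _ _ Hj HB)|].
  split.
  - apply Csum_ext; intros n. now rewrite (proj2 (power_coefs z n)).
  - eapply Summable_ext.
    { intros n. rewrite <- (proj2 (power_coefs z n)). reflexivity. }
    apply (Summable_le _ (fun n => / r ^ 1 * (Cmod (a n) * (Cmod z + r) ^ n))%R).
    + intros n. pose proof (jet_coef r Hr _ _ _ 1%nat ltac:(lia) (Hj n)) as H.
      unfold Rdiv in H. lra.
    + apply (ex_series_scal_l (/ r ^ 1)%R (fun n => Cmod (a n) * (Cmod z + r) ^ n)%R); exact HB.
Qed.

Lemma Csum_shift0 (a : nat -> C) : a O = 0 -> Summable a -> Csum a = Csum (fun n => a (S n)).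
Proof.
  intros H0 Ha. symmetry. apply Csum_eq.
  apply Cconv_ext with (fun n => bsum a (S n)).
  - intros n. rewrite bsum_shift, H0. ring.
  - apply (Cconv_subseq (bsum a) _ S); [auto|apply Csum_conv, Ha].
Qed.

Lemma psconv_pderiv (a : nat -> C) (R0 : R) : psconv a R0 -> psconv (pderiv a) R0.
Proof.
  intros Ha s Hs.
  destruct (jet_pser ((R0 - s) / 2) a R0 (RtoC s)) as [c [B [_ [_ H]]]];
    [lra|exact Ha|rewrite Cmod_R, Rabs_pos_eq; lra|].
  apply (ex_series_incr_1 (fun n => Cmod (a n * (INR n * s ^ pred n)))) in H.
  eapply ex_series_ext; [|exact H]. intros n; simpl pred.
  unfold pderiv. rewrite !Cmod_mult, Cmod_pow, !Cmod_R, (Rabs_pos_eq s) by lra.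
  change (Init.Nat.pred (S n)) with n.
  match goal with |- ?x = ?y => change (@eq R x y) end. ring.
Qed.

Lemma pser_is_derive (a : nat -> C) (R0 : R) (z : C) :
  psconv a R0 -> (Cmod z < R0)%R ->
  is_derive (K := C_AbsRing) (V := C_NormedModule) (pser a) z (pser (pderiv a) z).
Proof.
  intros Ha Hz.
  destruct (jet_pser ((R0 - Cmod z) / 2) a R0 z) as [c [B [HJ [Hc HS]]]]; [lra|exact Ha|lra|].
  replace (pser (pderiv a) z) with (c 1%nat);
    [eapply jet_is_derive; [|exact HJ]; lra|].
  rewrite Hc, Csum_shift0; [|simpl; ring|exact HS].
  apply Csum_ext; intros n; unfold pderiv. simpl pred. ring.
Qed.

Lemma pser_ex_derive (a : nat -> C) (R0 : R) (z : C) :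
  psconv a R0 -> (Cmod z < R0)%R ->
  ex_derive (K := C_AbsRing) (V := C_NormedModule) (pser a) z.
Proof. intros Ha Hz. eexists. eapply pser_is_derive; eassumption. Qed.

(** * Finite and infinite q-Pochhammer products *)

Lemma exp_mono (x y : R) : (x <= y)%R -> (exp x <= exp y)%R.
Proof. intros [H|H]; [left; apply exp_increasing, H|rewrite H; apply Rle_refl]. Qed.

Section Qpoch.
Variable q : C.
Hypothesis Hq : (0 < Cmod q < 1)%R.

Lemma q_neq0 : q <> 0.
Proof. apply Cmod_gt_0; lra. Qed.

Lemma qn_neq0 n : q ^ n <> 0.
Proof. apply Cpow_nz, q_neq0. Qed.

Lemma qpoch_bprod a n : qpoch a q n = bprod (fun j => 1 - a * q ^ j) n.
Proof. induction n as [|n IH]; simpl; [reflexivity|now rewrite IH]. Qed.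

Lemma qpoch_app a n m : qpoch a q (n + m) = qpoch a q n * qpoch (a * q ^ n) q m.
Proof.
  rewrite !qpoch_bprod, bprod_app. f_equal. apply bprod_ext; intros i _.
  rewrite Cpow_add_r; ring.
Qed.

Lemma qpoch_S_l a n : qpoch a q (S n) = (1 - a) * qpoch (a * q) q n.
Proof.
  change (S n) with (1 + n)%nat. rewrite qpoch_app. simpl. rewrite !Cmult_1_r. ring.
Qed.

Lemma qpoch_neq0 a n :
  (forall j, (j < n)%nat -> a * q ^ j <> 1) -> qpoch a q n <> 0.
Proof.
  intros H. rewrite qpoch_bprod. apply bprod_neq0. intros i Hi E.
  apply (H i Hi). symmetry. now apply Ceq_minus.
Qed.

(** The factor [(-1)^n q^(-n(n+1)/2)] produced when [n] factors of a product
    are reflected.  It cancels from every quotient with equally many reflected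
    factors above and below. *)
Fixpoint refl_factor (n : nat) : C :=
  match n with O => 1 | S k => refl_factor k * (- / q ^ S k) end.

Lemma refl_factor_neq0 n : refl_factor n <> 0.
Proof.
  induction n as [|n IH]; simpl; [apply C1_nz|].
  apply Cmult_neq_0; [exact IH|]. intros E.
  apply (C1_nz). rewrite <- (Cinv_l _ (qn_neq0 (S n))).
  change (q ^ S n) with (q * q ^ n). rewrite <- (Cmult_0_l (- (q * q ^ n))), <- E. ring.
Qed.

(** Reflection: the factors of [(x q^-n; q)_N] with negative powers of [q]
    form, up to a monomial, the product [(q/x; q)_n]. *)
Lemma qpoch_reflect (x : C) (n N : nat) :
  x <> 0 -> (n <= N)%nat ->
  qpoch (x / q ^ n) q N = refl_factor n * x ^ n * qpoch (q / x) q n * qpoch x q (N - n).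
Proof.
  intros Hx HN.
  replace N with (n + (N - n))%nat at 1 by lia. rewrite qpoch_app.
  replace (x / q ^ n * q ^ n) with x by (field; apply qn_neq0).
  f_equal. clear N HN.
  induction n as [|n IH]; [simpl; field|].
  rewrite qpoch_S_l.
  replace (x / q ^ S n * q) with (x / q ^ n)
    by (simpl; field; auto using q_neq0, qn_neq0).
  rewrite IH. simpl. field. auto using q_neq0, qn_neq0.
Qed.

(** [U x] bounds [|(a; q)_n|] for [|a| <= x], and [L x] bounds [|1/(a; q)_n|] for
    [|a| <= x < 1], for all [n] at once: [1 + y <= exp y], and [|q|^j] sums to
    [1/(1 - |q|)]. *)
Definition U (x : R) : R := exp (x / (1 - Cmod q)).
Definition L (x : R) : R := exp (x / ((1 - x) * (1 - Cmod q))).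

Lemma geom_partial n : ((1 - Cmod q ^ n) / (1 - Cmod q) <= / (1 - Cmod q))%R.
Proof.
  unfold Rdiv. rewrite <- (Rmult_1_l (/ (1 - Cmod q))) at 2.
  apply Rmult_le_compat_r; [left; apply Rinv_0_lt_compat; lra|].
  assert (0 <= Cmod q ^ n)%R by (apply pow_le; lra). lra.
Qed.

Lemma U_mono x y : (x <= y)%R -> (U x <= U y)%R.
Proof.
  intros H. apply exp_mono. apply Rmult_le_compat_r; [|exact H].
  left; apply Rinv_0_lt_compat; lra.
Qed.

Lemma prod_bound_U (x : R) (u : nat -> R) :
  (0 <= x)%R -> u O = 1%R ->
  (forall n, (0 <= u (S n) <= u n * (1 + x * Cmod q ^ n))%R) ->
  forall n, (0 <= u n <= U x)%R.
Proof.
  intros Hx H0 HS n.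
  assert (H : (0 <= u n <= exp (x * ((1 - Cmod q ^ n) / (1 - Cmod q))))%R).
  { induction n as [|n IH].
    - rewrite H0. simpl. replace (x * ((1 - 1) / (1 - Cmod q)))%R with 0%R by (field; lra).
      rewrite exp_0; lra.
    - destruct (HS n) as [H1 H2]. split; [exact H1|].
      eapply Rle_trans; [exact H2|].
      replace (x * ((1 - Cmod q ^ S n) / (1 - Cmod q)))%R
        with (x * ((1 - Cmod q ^ n) / (1 - Cmod q)) + x * Cmod q ^ n)%R
        by (simpl; field; lra).
      rewrite exp_plus. apply Rmult_le_compat; [lra| |apply IH|apply exp_ineq1_le].
      assert (0 <= x * Cmod q ^ n)%R by (apply Rmult_le_pos; [exact Hx|apply pow_le; lra]). lra. }
  split; [apply H|]. eapply Rle_trans; [apply H|]. apply exp_mono.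
  unfold Rdiv at 2. apply Rmult_le_compat_l; [exact Hx|apply geom_partial].
Qed.

Lemma prod_bound_L (x : R) (u : nat -> R) :
  (0 <= x < 1)%R -> u O = 1%R ->
  (forall n, (0 <= u (S n) <= u n * / (1 - x * Cmod q ^ n))%R) ->
  forall n, (0 <= u n <= L x)%R.
Proof.
  intros Hx H0 HS n.
  assert (E : L x = U (x / (1 - x))) by (unfold L, U; f_equal; field; lra).
  rewrite E. apply prod_bound_U; [apply Rdiv_le_0_compat; lra|exact H0|].
  intros k. destruct (HS k) as [H1 H2]. split; [exact H1|].
  assert (Hk : (0 <= Cmod q ^ k <= 1)%R) by (apply pow_01; lra).
  assert (Hy : (0 <= x * Cmod q ^ k <= x)%R).
  { split; [apply Rmult_le_pos; lra|]. apply Rle_trans with (x * 1)%R; [apply Rmult_le_compat_l; lra|lra]. }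
  assert (Hi : (0 < / (1 - x * Cmod q ^ k))%R) by (apply Rinv_0_lt_compat; lra).
  assert (Hu : (0 <= u k)%R).
  { apply Rmult_le_reg_r with (/ (1 - x * Cmod q ^ k))%R; lra. }
  eapply Rle_trans; [exact H2|]. apply Rmult_le_compat_l; [exact Hu|].
  replace (/ (1 - x * Cmod q ^ k))%R with (1 + x * Cmod q ^ k * / (1 - x * Cmod q ^ k))%R by (field; lra).
  apply Rplus_le_compat_l.
  replace (x / (1 - x) * Cmod q ^ k)%R with (x * Cmod q ^ k * / (1 - x))%R by (field; lra).
  apply Rmult_le_compat_l; [lra|]. apply Rinv_le_contravar; lra.
Qed.

Lemma qpoch_upper a n : (Cmod (qpoch a q n) <= U (Cmod a))%R.
Proof.
  apply (prod_bound_U (Cmod a) (fun n => Cmod (qpoch a q n))); [apply Cmod_ge_0|apply Cmod_1|].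
  intros k. split; [apply Cmod_ge_0|]. simpl. rewrite Cmod_mult.
  apply Rmult_le_compat_l; [apply Cmod_ge_0|].
  unfold Cminus. eapply Rle_trans; [apply Cmod_triangle|].
  rewrite Cmod_1, Cmod_opp, Cmod_mult, Cmod_pow. lra.
Qed.

Lemma factor_lower a n : (Cmod a < 1)%R -> (0 < 1 - Cmod a * Cmod q ^ n <= Cmod (1 - a * q ^ n))%R.
Proof.
  intros Ha.
  assert (Hk : (0 <= Cmod q ^ n <= 1)%R) by (apply pow_01; lra).
  pose proof (Cmod_ge_0 a). split; [nra|].
  pose proof (Cmod_triangle (1 - a * q ^ n) (a * q ^ n)) as T.
  replace (1 - a * q ^ n + a * q ^ n) with (RtoC 1) in T by ring.
  rewrite Cmod_1, (Cmod_mult a), Cmod_pow in T. lra.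
Qed.

Lemma qpoch_neq0_small a n : (Cmod a < 1)%R -> qpoch a q n <> 0.
Proof.
  intros Ha. rewrite qpoch_bprod. apply bprod_neq0. intros i _.
  apply Cmod_gt_0. pose proof (factor_lower a i Ha). lra.
Qed.

Lemma qpoch_lower a x n :
  (Cmod a <= x)%R -> (x < 1)%R -> (Cmod (/ qpoch a q n) <= L x)%R.
Proof.
  intros Hax Hx. pose proof (Cmod_ge_0 a).
  assert (Ha : (Cmod a < 1)%R) by lra.
  apply (prod_bound_L x (fun n => Cmod (/ qpoch a q n))); [lra| |].
  - simpl. rewrite Cmod_inv, Cmod_1 by apply C1_nz. field.
  - intros k. split; [apply Cmod_ge_0|]. 
    pose proof (factor_lower a k Ha) as Hf.
    assert (1 - a * q ^ k <> 0) by (apply Cmod_gt_0; lra).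
    pose proof (qpoch_neq0_small a k Ha).
    simpl. rewrite !Cmod_inv, Cmod_mult, Rinv_mult by (try apply Cmult_neq_0; assumption).
    apply Rmult_le_compat_l; [left; apply Rinv_0_lt_compat, Cmod_gt_0; assumption|].
    assert (Hk : (0 <= Cmod q ^ k <= 1)%R) by (apply pow_01; lra).
    apply Rinv_le_contravar; nra.
Qed.

Lemma Summable_q_pow (a : nat -> C) (M : R) :
  (forall n, (Cmod (a n) <= M)%R) -> Summable (fun n => a n * q ^ n).
Proof. intros H. apply (Summable_bounded_geom a M q); [lra|exact H]. Qed.

(** Telescoped form of the infinite product, which turns convergence and
    expansions of products into statements about series. *)
Lemma qpoch_telescope a n : qpoch a q n = 1 + bsum (fun j => - a * qpoch a q j * q ^ j) n.
Proof. induction n as [|n IH]; simpl; [ring|]. rewrite IH at 1. ring_simplify. rewrite IH. ring. Qed.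

Lemma qpoch_series a : Summable (fun j => - a * qpoch a q j * q ^ j).
Proof.
  apply (Summable_q_pow _ (Cmod a * U (Cmod a))%R). intros n.
  rewrite Cmod_mult, Cmod_opp. apply Rmult_le_compat_l; [apply Cmod_ge_0|apply qpoch_upper].
Qed.

Lemma qpoch_conv_series a :
  Cconv (qpoch a q) (1 + Csum (fun j => - a * qpoch a q j * q ^ j)).
Proof.
  eapply Cconv_ext; [intros n; symmetry; apply qpoch_telescope|].
  apply Cconv_plus; [apply Cconv_const|apply Csum_conv, qpoch_series].
Qed.

Lemma qpoch_inf_series a :
  qpoch_inf a q = 1 + Csum (fun j => - a * qpoch a q j * q ^ j).
Proof. apply Clim_seq_eq, qpoch_conv_series. Qed.

Lemma qpoch_inf_conv a : Cconv (qpoch a q) (qpoch_inf a q).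
Proof. rewrite qpoch_inf_series. apply qpoch_conv_series. Qed.

Lemma qpoch_inf_split a n : qpoch_inf a q = qpoch a q n * qpoch_inf (a * q ^ n) q.
Proof.
  apply (Cconv_unique (fun m => qpoch a q (n + m))).
  - apply (Cconv_subseq (qpoch a q) _ (fun m => (n + m)%nat)); [lia|apply qpoch_inf_conv].
  - eapply Cconv_ext; [intros m; symmetry; apply qpoch_app|].
    apply Cconv_scal, qpoch_inf_conv.
Qed.

Lemma qpoch_inf_S_l a : qpoch_inf a q = (1 - a) * qpoch_inf (a * q) q.
Proof. rewrite (qpoch_inf_split a 1). simpl. rewrite !Cmult_1_r. ring. Qed.

(** The partial products stay above [1/L]. *)
Lemma qpoch_inf_neq0_small a : (Cmod a < 1)%R -> qpoch_inf a q <> 0.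
Proof.
  intros Ha E.
  pose proof (qpoch_inf_conv a) as H. rewrite E in H.
  destruct (H (/ (2 * L (Cmod a)))%R) as [N HN].
  { apply Rinv_0_lt_compat. pose proof (exp_pos (Cmod a / ((1 - Cmod a) * (1 - Cmod q)))).
    unfold L; lra. }
  specialize (HN N (le_n _)). replace (qpoch a q N - 0) with (qpoch a q N) in HN by ring.
  pose proof (qpoch_lower a (Cmod a) N (Rle_refl _) Ha) as Hl.
  pose proof (qpoch_neq0_small a N Ha) as Hn.
  rewrite Cmod_inv in Hl by exact Hn. apply Cmod_gt_0 in Hn.
  set (l := L (Cmod a)) in *. set (m := Cmod (qpoch a q N)) in *.
  assert (0 < l)%R by (pose proof (Rinv_0_lt_compat _ Hn); lra).
  assert (/ l <= m)%R.
  { rewrite <- (Rinv_inv m). apply Rinv_le_contravar; [apply Rinv_0_lt_compat; exact Hn|exact Hl]. }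
  assert (/ (2 * l) < / l)%R.
  { apply Rinv_lt_contravar; [|lra]. apply Rmult_lt_0_compat; lra. }
  lra.
Qed.

Lemma qpow_small (M : R) : exists n, (M * Cmod q ^ n < 1)%R.
Proof.
  destruct (Rle_lt_dec M 0) as [HM|HM].
  - exists O. simpl; lra.
  - destruct (pow_lt_1_zero (Cmod q) ltac:(rewrite Rabs_pos_eq; lra) (/ M)) as [N HN].
    { apply Rinv_0_lt_compat; exact HM. }
    exists N. specialize (HN N (le_n _)). rewrite Rabs_pos_eq in HN by (apply pow_le; lra).
    apply (Rmult_lt_compat_l M) in HN; [|exact HM].
    rewrite Rinv_r in HN; lra.
Qed.

Lemma qpoch_inf_neq0 a : (forall j, a * q ^ j <> 1) -> qpoch_inf a q <> 0.
Proof.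
  intros H. destruct (qpow_small (Cmod a)) as [n Hn].
  rewrite (qpoch_inf_split a n). apply Cmult_neq_0.
  - apply qpoch_neq0; auto.
  - apply qpoch_inf_neq0_small. rewrite Cmod_mult, Cmod_pow; exact Hn.
Qed.

(** Only finitely many factors of the product can vanish near a given point,
    and each of them has one zero. *)
Lemma qpoch_inf_isolated (z0 : C) :
  exists r, (0 < r)%R /\
    forall z, (0 < Cmod (z - z0) < r)%R -> qpoch_inf z q <> 0.
Proof.
  destruct (qpow_small (Cmod z0 + 1)) as [n Hn].
  assert (Hfin : exists r, (0 < r)%R /\
    forall z, (0 < Cmod (z - z0) < r)%R -> qpoch z q n <> 0).
  { clear Hn. induction n as [|n [r [Hr IH]]].
    - exists 1%R; split; [lra|]. intros; simpl; apply C1_nz.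
    - destruct (Ceq_dec (1 - z0 * q ^ n) 0) as [E|E].
      + exists r; split; [exact Hr|]. intros z Hz. simpl.
        apply Cmult_neq_0; [apply IH, Hz|]. intros E'.
        assert (Hz0 : (z - z0) * q ^ n = 0).
        { replace ((z - z0) * q ^ n) with ((1 - z0 * q ^ n) - (1 - z * q ^ n)) by ring.
          rewrite E, E'; ring. }
        apply (Cmult_neq_0 (z - z0) (q ^ n)); [apply Cmod_gt_0; lra|apply qn_neq0|exact Hz0].
      + assert (Hm : (0 < Cmod (1 - z0 * q ^ n))%R) by (apply Cmod_gt_0; exact E).
        exists (Rmin r (Cmod (1 - z0 * q ^ n))).
        split; [apply Rmin_glb_lt; assumption|]. intros z Hz.
        pose proof (Rmin_l r (Cmod (1 - z0 * q ^ n))).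
        pose proof (Rmin_r r (Cmod (1 - z0 * q ^ n))).
        simpl. apply Cmult_neq_0; [apply IH; lra|]. intros E'.
        assert (E2 : 1 - z0 * q ^ n = (z - z0) * q ^ n).
        { replace ((z - z0) * q ^ n) with ((1 - z0 * q ^ n) - (1 - z * q ^ n)) by ring.
          rewrite E'; ring. }
        apply (f_equal Cmod) in E2. rewrite (Cmod_mult (z - z0)), Cmod_pow in E2.
        assert (Cmod q ^ n <= 1)%R by (rewrite <- (pow1 n); apply pow_incr; lra).
        nra. }
  destruct Hfin as [r [Hr Hfin]].
  exists (Rmin r 1); split; [apply Rmin_glb_lt; lra|]. intros z Hz.
  pose proof (Rmin_l r 1); pose proof (Rmin_r r 1).
  rewrite (qpoch_inf_split z n). apply Cmult_neq_0; [apply Hfin; lra|].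
  apply qpoch_inf_neq0_small. rewrite Cmod_mult, Cmod_pow.
  assert (Cmod z <= Cmod z0 + 1)%R.
  { replace z with (z0 + (z - z0)) by ring. eapply Rle_trans; [apply Cmod_triangle|]. lra. }
  eapply Rle_lt_trans; [|exact Hn]. apply Rmult_le_compat_r; [apply pow_le; lra|assumption].
Qed.

(** ** Jets of products *)

Section QpochJets.
Variable r : R.
Hypothesis Hr : (0 < r)%R.

(** The [n]-th factor has norm at most [1 + B |q|^n], so the bound is uniform in
    the number of factors. *)
Lemma jet_qpoch (g : C -> C) (c : nat -> C) (B : R) :
  jet r g c B ->
  exists C : nat -> nat -> Complex.C, forall n,
    jet r (fun t => qpoch (g t) q n) (C n) (U B).
Proof.
  intros Hg. pose proof (jet_norm_ge_0 r Hr _ _ _ Hg) as HB.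
  set (fac := fun (n b : nat) => unit_seq 1 0 b + (- q ^ n) * c b).
  set (CC := fix CC n := match n with O => unit_seq 1 0 | S k => conv (CC k) (fac k) end).
  set (u := fix u (n : nat) : R := match n with O => 1%R | S k => (u k * (1 + B * Cmod q ^ k))%R end).
  assert (Hu : forall n, (0 <= u n <= U B)%R).
  { apply prod_bound_U; [exact HB|reflexivity|].
    assert (Hu0 : forall n, (0 <= u n)%R).
    { induction n as [|n IH]; simpl; [lra|]. apply Rmult_le_pos; [exact IH|].
      assert (0 <= B * Cmod q ^ n)%R by (apply Rmult_le_pos; [exact HB|apply pow_le; lra]). lra. }
    intros n; split; [apply (Hu0 (S n))|apply Rle_refl]. }
  exists CC. intros n. apply jet_weaken with (u n); [apply Hu|]. clear Hu.
  induction n as [|n IH]; simpl.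
  - apply jet_weaken with (Cmod 1); [rewrite Cmod_1; lra|apply (jet_const r)].
  - apply (jet_mult r Hr); [exact IH|].
    eapply jet_weaken; [|eapply (jet_ext r);
      [| |apply (jet_plus r Hr); [apply (jet_const r 1)|apply (jet_scal r Hr (- q ^ n)); exact Hg]]].
    + rewrite Cmod_1, Cmod_opp, Cmod_pow. lra.
    + intros t _; simpl; ring.
    + intros k _. reflexivity.
Qed.

Lemma jet_qpoch_inf (g : C -> C) (c : nat -> C) (B : R) :
  jet r g c B -> exists d B', jet r (fun t => qpoch_inf (g t) q) d B'.
Proof.
  intros Hg. destruct (jet_qpoch g c B Hg) as [CC HC].
  assert (HJ : forall n, jet r (fun t => (- q ^ n) * (g t * qpoch (g t) q n))
     (fun b => (- q ^ n) * conv c (CC n) b) (Cmod (- q ^ n) * (B * U B))%R).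
  { intros n. apply (jet_scal r Hr). apply (jet_mult r Hr); [exact Hg|apply HC]. }
  assert (HS : ex_series (fun n => Cmod (- q ^ n) * (B * U B))%R).
  { apply ex_series_scal_r. eapply ex_series_ext; [|apply (ex_series_geom (Cmod q))].
    - intros n; now rewrite Cmod_opp, Cmod_pow.
    - rewrite Rabs_pos_eq; lra. }
  pose proof (jet_plus r Hr _ _ _ _ _ _ (jet_const r 1) (jet_sum r Hr _ _ _ HJ HS)) as H.
  do 2 eexists. eapply (jet_ext r); [|reflexivity|exact H].
  intros t Ht; simpl. rewrite qpoch_inf_series. f_equal.
  apply Csum_ext; intros n; ring.
Qed.

(** As for the product itself, each reciprocal factor being a geometric series of
    norm at most [1/(1 - |a| (1 + r) |q|^n)]. *)
Lemma jet_inv_qpoch (a : C) :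
  (Cmod a * (1 + r) < 1)%R ->
  exists C : nat -> nat -> Complex.C, forall n,
    jet r (fun t => / qpoch (a * (1 - t)) q n) (C n) (L (Cmod a * (1 + r))).
Proof.
  intros Ha. pose proof (Cmod_ge_0 a) as Ha0. set (x := (Cmod a * (1 + r))%R) in *.
  assert (Hx0 : (0 <= x)%R) by (apply Rmult_le_pos; lra).
  set (fac := fun (n b : nat) => / (1 - a * q ^ n) * (- (a * q ^ n) / (1 - a * q ^ n)) ^ b).
  set (CC := fix CC n := match n with O => unit_seq 1 0 | S k => conv (CC k) (fac k) end).
  set (u := fix u (n : nat) : R := match n with O => 1%R | S k => (u k * / (1 - x * Cmod q ^ k))%R end).
  assert (Hk : forall k, (0 <= Cmod q ^ k <= 1)%R) by (intros; apply pow_01; lra).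
  assert (Hxk : forall k, (0 <= x * Cmod q ^ k < 1)%R).
  { intros k. specialize (Hk k). split; [apply Rmult_le_pos; lra|nra]. }
  assert (Hu : forall n, (0 <= u n <= L x)%R).
  { apply prod_bound_L; [lra|reflexivity|].
    assert (Hu0 : forall n, (0 <= u n)%R).
    { induction n as [|n IH]; simpl; [lra|]. apply Rmult_le_pos; [exact IH|].
      left; apply Rinv_0_lt_compat. specialize (Hxk n); lra. }
    intros n; split; [apply (Hu0 (S n))|apply Rle_refl]. }
  assert (Ha1 : (Cmod a < 1)%R) by (unfold x in Ha; nra).
  exists CC. intros n. apply jet_weaken with (u n); [apply Hu|]. clear Hu.
  induction n as [|n IH]; simpl.
  - apply jet_weaken with (Cmod 1); [rewrite Cmod_1; lra|].
    eapply (jet_ext r); [| |apply (jet_const r 1)]; intros; simpl; [field; apply C1_nz|reflexivity].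
  - assert (Hlow : (1 - x * Cmod q ^ n <= Cmod (1 - a * q ^ n) - Cmod (a * q ^ n) * r)%R).
    { pose proof (factor_lower a n Ha1). rewrite Cmod_mult, Cmod_pow. unfold x. lra. }
    pose proof (Hxk n) as Hxn.
    assert (Hfac : jet r (fun t => / (1 - a * (1 - t) * q ^ n)) (fac n) (/ (1 - x * Cmod q ^ n))%R).
    { eapply jet_weaken; [|eapply (jet_ext r);
        [| |apply (jet_inv_affine r Hr (1 - a * q ^ n) (a * q ^ n))]].
      - apply Rinv_le_contravar; [lra|exact Hlow].
      - intros t _; simpl; f_equal; ring.
      - reflexivity.
      - lra. }
    eapply (jet_ext r); [|reflexivity|apply (jet_mult r Hr _ _ _ _ _ _ IH Hfac)].
    intros t Ht; simpl.
    assert (Hsm : (Cmod (a * (1 - t)) < 1)%R).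
    { rewrite Cmod_mult. assert (Cmod (1 - t) <= 1 + r)%R.
      { unfold Cminus; eapply Rle_trans; [apply Cmod_triangle|]. rewrite Cmod_1, Cmod_opp; lra. }
      eapply Rle_lt_trans; [|exact Ha]. unfold x. apply Rmult_le_compat_l; assumption. }
    pose proof (qpoch_neq0_small (a * (1 - t)) n Hsm).
    assert (1 - a * (1 - t) * q ^ n <> 0).
    { apply Cmod_gt_0. pose proof (factor_lower _ n Hsm); lra. }
    field; split; assumption.
Qed.

End QpochJets.
End Qpoch.

(** * Partial fractions *)

(** The coefficient of the pole [u = 1/al j], for a numerator with zeros [1/be l];
    [be l = 0] stands for a missing factor. *)
Definition residue (al be : nat -> C) (M j : nat) : C :=
  bprod (fun l => 1 - be l / al j) M
  / bprod (fun i => if Nat.eqb i j then 1 else 1 - al i / al j) (S M).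

Lemma one_minus_div_neq0 (a b : C) : b <> 0 -> a <> b -> 1 - a / b <> 0.
Proof.
  intros Hb Hab E. apply Hab. apply Ceq_minus.
  replace (a - b) with (- (1 - a / b) * b) by (field; exact Hb). rewrite E; ring.
Qed.

(** By induction on the number of factors: multiplying by one more quotient
    [(1 - b u) / (1 - a u)] splits each old fraction in two, and the total
    coefficient of the new pole is the old function evaluated at [u = 1/a],
    hence again a product. *)
Lemma partial_fractions (al be : nat -> C) (M : nat) :
  (forall i, (i <= M)%nat -> al i <> 0) ->
  (forall i j, (i <= M)%nat -> (j <= M)%nat -> i <> j -> al i <> al j) ->
  forall u, (forall i, (i <= M)%nat -> 1 - al i * u <> 0) ->
  bprod (fun l => 1 - be l * u) M / bprod (fun i => 1 - al i * u) (S M)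
  = bsum (fun j => residue al be M j / (1 - al j * u)) (S M).
Proof.
  induction M as [|M IH]; intros H0 Hd u Hu.
  - unfold residue; simpl. specialize (Hu O (le_n _)). field. exact Hu.
  - assert (IH' : forall v, (forall i, (i <= M)%nat -> 1 - al i * v <> 0) ->
      bprod (fun l => 1 - be l * v) M / bprod (fun i => 1 - al i * v) (S M)
      = bsum (fun j => residue al be M j / (1 - al j * v)) (S M))
      by (apply IH; intros; [apply H0|apply Hd]; lia).
    clear IH.
    set (a := al (S M)) in *. set (b := be M).
    assert (Ha : a <> 0) by (apply H0; lia).
    assert (Hau : 1 - a * u <> 0) by (apply Hu; lia).
    assert (Hj : forall j, (j <= M)%nat -> al j <> 0 /\ 1 - al j * u <> 0 /\ al j - a <> 0).
    { intros j Hj. split; [apply H0; lia|]. split; [apply Hu; lia|].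
      apply Cminus_eq_contra. apply Hd; lia. }
    assert (E1 : bprod (fun l => 1 - be l * u) (S M) / bprod (fun i => 1 - al i * u) (S (S M))
      = bprod (fun l => 1 - be l * u) M / bprod (fun i => 1 - al i * u) (S M)
        * ((1 - b * u) / (1 - a * u))).
    { change (bprod (fun l => 1 - be l * u) (S M))
        with (bprod (fun l => 1 - be l * u) M * (1 - b * u)).
      change (bprod (fun i => 1 - al i * u) (S (S M)))
        with (bprod (fun i => 1 - al i * u) (S M) * (1 - a * u)).
      field. split; [exact Hau|]. apply bprod_neq0. intros i Hi; apply Hu; lia. }
    assert (Hnew : residue al be (S M) (S M)
       = (1 - b / a) * bsum (fun j => residue al be M j / (1 - al j * / a)) (S M)).
    { rewrite <- IH'.
      2:{ intros i Hi. apply one_minus_div_neq0; [exact Ha|]. apply Hd; lia. }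
      unfold residue. fold a.
      change (bprod (fun l => 1 - be l / a) (S M)) with (bprod (fun l => 1 - be l / a) M * (1 - b / a)).
      change (bprod (fun i => if Nat.eqb i (S M) then RtoC 1 else 1 - al i / a) (S (S M)))
        with (bprod (fun i => if Nat.eqb i (S M) then RtoC 1 else 1 - al i / a) (S M)
              * (if Nat.eqb (S M) (S M) then RtoC 1 else 1 - al (S M) / a)).
      rewrite Nat.eqb_refl.
      rewrite (bprod_ext (fun i => if Nat.eqb i (S M) then RtoC 1 else 1 - al i / a)
                         (fun i => 1 - al i / a)).
      2:{ intros i Hi. replace (Nat.eqb i (S M)) with false; [reflexivity|].
          symmetry; apply Nat.eqb_neq; lia. }
      assert (Hn : bprod (fun i => 1 - al i / a) (S M) <> 0).
      { apply bprod_neq0. intros i Hi. apply one_minus_div_neq0; [exact Ha|]. apply Hd; lia. }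
      unfold Cdiv in *. field. split; assumption. }
    assert (Hold : forall j, (j <= M)%nat ->
       residue al be (S M) j = residue al be M j * ((1 - b / al j) / (1 - a / al j))).
    { intros j Hjm. unfold residue.
      change (bprod (fun l => 1 - be l / al j) (S M))
        with (bprod (fun l => 1 - be l / al j) M * (1 - b / al j)).
      change (bprod (fun i => if Nat.eqb i j then RtoC 1 else 1 - al i / al j) (S (S M)))
        with (bprod (fun i => if Nat.eqb i j then RtoC 1 else 1 - al i / al j) (S M)
              * (if Nat.eqb (S M) j then RtoC 1 else 1 - a / al j)).
      replace (Nat.eqb (S M) j) with false by (symmetry; apply Nat.eqb_neq; lia).
      destruct (Hj j Hjm) as [A1 [A2 A3]].
      assert (A4 : 1 - a / al j <> 0).
      { apply one_minus_div_neq0; [exact A1|]. intros E; apply A3; rewrite E; ring. }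
      assert (A5 : bprod (fun i => if Nat.eqb i j then RtoC 1 else 1 - al i / al j) (S M) <> 0).
      { apply bprod_neq0. intros i Hi. destruct (Nat.eqb_spec i j); [apply C1_nz|].
        apply one_minus_div_neq0; [exact A1|]. apply Hd; lia. }
      generalize dependent (bprod (fun i => if Nat.eqb i j then RtoC 1 else 1 - al i / al j) (S M)).
      intros D HD. generalize dependent (1 - a / al j). intros D2 HD2. field. repeat split; assumption. }
    rewrite E1, IH' by (intros; apply Hu; lia).
    change (bsum (fun j => residue al be (S M) j / (1 - al j * u)) (S (S M)))
      with (bsum (fun j => residue al be (S M) j / (1 - al j * u)) (S M)
            + residue al be (S M) (S M) / (1 - a * u)).
    rewrite Hnew.
    rewrite (bsum_ext (fun j => residue al be (S M) j / (1 - al j * u))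
      (fun j => residue al be M j * ((1 - b / al j) / (1 - a / al j)) / (1 - al j * u)))
      by (intros j Hjm; rewrite Hold by lia; reflexivity).
    replace ((1 - b / a) * bsum (fun j => residue al be M j / (1 - al j * / a)) (S M) / (1 - a * u))
      with (((1 - b / a) / (1 - a * u))
            * bsum (fun j => residue al be M j / (1 - al j * / a)) (S M)) by (field; auto).
    rewrite <- bsum_scal, <- bsum_plus, Cmult_comm, <- bsum_scal.
    apply bsum_ext. intros j Hjm. destruct (Hj j ltac:(lia)) as [A1 [A2 A3]].
    assert (a - al j <> 0).
    { intros E. apply A3. replace (al j - a) with (- (a - al j)) by ring. rewrite E; ring. }
    field. repeat split; assumption.
Qed.

Section Finite.
Variable q : C.
Hypothesis Hq : (0 < Cmod q < 1)%R.

Lemma qpow_neq1 n : (0 < n)%nat -> q ^ n <> 1.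
Proof.
  intros Hn E. apply (f_equal Cmod) in E. rewrite Cmod_pow, Cmod_1 in E.
  pose proof (pow_lt_1_compat (Cmod q) n ltac:(lra) Hn). lra.
Qed.

Lemma qpow_inj i j : q ^ i = q ^ j -> i = j.
Proof.
  assert (H : forall a b, (a < b)%nat -> q ^ a <> q ^ b).
  { intros a b Hab E. apply (qpow_neq1 (b - a)); [lia|].
    replace b with (a + (b - a))%nat in E by lia. rewrite Cpow_add_r in E.
    apply (f_equal (fun z => / q ^ a * z)) in E.
    rewrite Cmult_assoc, Cinv_l, Cmult_1_l in E by (apply qn_neq0; exact Hq). now rewrite <- E. }
  intros E. destruct (Nat.lt_trichotomy i j) as [Hl|[Hl|Hl]]; [|exact Hl|].
  - destruct (H i j Hl E).
  - destruct (H j i Hl (eq_sym E)).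
Qed.

(** The product of the differences of one pole with all the others, for poles
    in geometric progression. *)
Lemma bprod_omit (M j : nat) :
  (j <= M)%nat ->
  bprod (fun i => if Nat.eqb i j then 1 else 1 - q ^ i / q ^ j) (S M)
  = refl_factor q j * qpoch q q j * qpoch q q (M - j).
Proof.
  intros Hj. replace (S M) with (j + S (M - j))%nat by lia.
  rewrite bprod_app. f_equal.
  - rewrite (bprod_ext _ (fun i => 1 - 1 / q ^ j * q ^ i)).
    + rewrite <- qpoch_bprod.
      rewrite (qpoch_reflect q Hq 1 j j C1_nz (le_n _)).
      replace (j - j)%nat with O by lia. rewrite Cpow_1_l.
      replace (q / 1) with q by (field; apply C1_nz). simpl; ring.
    + intros i Hi. replace (Nat.eqb i j) with false by (symmetry; apply Nat.eqb_neq; lia).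
      field. apply qn_neq0; exact Hq.
  - set (f := fun i => if Nat.eqb (j + i) j then RtoC 1 else 1 - q ^ (j + i) / q ^ j).
    replace (S (M - j)) with (1 + (M - j))%nat by lia. rewrite bprod_app.
    replace (bprod f 1) with (RtoC 1)
      by (unfold f; simpl; rewrite Nat.add_0_r, Nat.eqb_refl; ring).
    rewrite Cmult_1_l, qpoch_bprod. apply bprod_ext. intros i Hi. unfold f.
    replace (Nat.eqb (j + (1 + i)) j) with false by (symmetry; apply Nat.eqb_neq; lia).
    rewrite Cpow_add_r. simpl. field. apply qn_neq0; exact Hq.
Qed.

(** ** The kernel: a truncated bilateral series in closed form *)

(** The quotient of theta functions [theta(-c Q) / theta(-c)], truncated. *)
Definition kern (Q : C) (N : nat) (c : C) : C :=
  qpoch (c * Q) q N * qpoch (q / (c * Q)) q N / (qpoch c q (S N) * qpoch (q / c) q N).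

(** The residue belonging to [q^d] with [d = n - N], close to a multiple of [Q^d]. *)
Definition kern_wt (Q : C) (N n : nat) : C :=
  Q ^ n / Q ^ N * (qpoch (q / Q) q n * qpoch Q q (2 * N - n))
  / (qpoch q q n * qpoch q q (2 * N - n)).

(** Partial fractions in the variable [c q^-N], with poles at [q^-n] and zeros at
    [q^-l / Q]. *)
Lemma kern_sum (Q : C) (N : nat) (c : C) :
  Q <> 0 -> c <> 0 -> (forall n, (n <= 2 * N)%nat -> 1 - q ^ n * (c / q ^ N) <> 0) ->
  kern Q N c = bsum (fun n => kern_wt Q N n / (1 - q ^ n * (c / q ^ N))) (S (2 * N)).
Proof.
  intros HQ Hc Hu.
  pose proof (qn_neq0 q Hq) as Hqn. pose proof (refl_factor_neq0 q Hq) as Hrf.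
  assert (Hqq : forall n, qpoch q q n <> 0) by (intros n; apply qpoch_neq0_small; [exact Hq|lra]).
  pose proof (partial_fractions (fun n => q ^ n) (fun l => Q * q ^ l) (2 * N)) as PF.
  specialize (PF ltac:(intros; apply Hqn) ltac:(intros i j _ _ Hij E; apply Hij, qpow_inj, E)
                 (c / q ^ N) Hu).
  assert (Hden : bprod (fun i => 1 - q ^ i * (c / q ^ N)) (S (2 * N)) <> 0)
    by (apply bprod_neq0; intros i Hi; apply Hu; lia).
  rewrite (bprod_ext (fun i => 1 - q ^ i * (c / q ^ N)) (fun i => 1 - c / q ^ N * q ^ i)) in PF, Hden
    by (intros; f_equal; ring).
  rewrite (bprod_ext _ (fun l => 1 - c * Q / q ^ N * q ^ l)) in PF
    by (intros; field; apply Hqn).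
  rewrite <- !qpoch_bprod in PF. rewrite <- qpoch_bprod in Hden.
  rewrite (qpoch_reflect q Hq (c * Q) N (2 * N)) in PF by (try apply Cmult_neq_0; auto; lia).
  rewrite (qpoch_reflect q Hq c N (S (2 * N))) in PF, Hden by (auto; lia).
  replace (2 * N - N)%nat with N in PF by lia.
  replace (S (2 * N) - N)%nat with (S N) in PF, Hden by lia.
  assert (D1 : qpoch (q / c) q N <> 0 /\ qpoch c q (S N) <> 0).
  { split; intros E; apply Hden; rewrite E; ring. }
  destruct D1 as [D1 D2].
  assert (HQN : Q ^ N <> 0) by (apply Cpow_nz; exact HQ).
  transitivity (/ Q ^ N * bsum (fun j => residue (fun n => q ^ n) (fun l => Q * q ^ l) (2 * N) j
                  / (1 - q ^ j * (c / q ^ N))) (S (2 * N))).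
  - rewrite <- PF. unfold kern. rewrite Cpow_mult_l. field.
    repeat split; auto; apply Cpow_nz; assumption.
  - rewrite <- bsum_scal. apply bsum_ext. intros n Hn.
    assert (HR : residue (fun n => q ^ n) (fun l => Q * q ^ l) (2 * N) n
      = Q ^ n * (qpoch (q / Q) q n * qpoch Q q (2 * N - n))
        / (qpoch q q n * qpoch q q (2 * N - n))).
    { unfold residue. rewrite bprod_omit by lia.
      rewrite (bprod_ext _ (fun l => 1 - Q / q ^ n * q ^ l)) by (intros; field; apply Hqn).
      rewrite <- qpoch_bprod, (qpoch_reflect q Hq Q n (2 * N)) by (auto; lia).
      field. repeat split; auto. }
    rewrite HR. unfold kern_wt. specialize (Hu n ltac:(lia)).
    generalize dependent (1 - q ^ n * (c / q ^ N)). intros D HD. field. repeat split; auto.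
Qed.

(** Truncated form of the quasi-periodicity of the theta quotient under
    [c |-> q c], which costs a factor [1/Q]. *)
Lemma kern_shift (Q : C) (N n : nat) (c : C) :
  Q <> 0 -> c <> 0 -> (n <= N)%nat ->
  qpoch c q (S (N + n)) <> 0 -> qpoch (q / c) q (N - n) <> 0 ->
  kern Q N (c * q ^ n) =
  / Q ^ n * (qpoch (c * Q) q (N + n) * qpoch (q / (c * Q)) q (N - n))
  / (qpoch c q (S (N + n)) * qpoch (q / c) q (N - n)).
Proof.
  intros HQ Hc HnN D1 D2.
  pose proof (qn_neq0 q Hq) as Hqn. pose proof (refl_factor_neq0 q Hq n) as Hrf.
  pose proof (q_neq0 q Hq) as Hq0.
  assert (HcQ : c * Q <> 0) by (apply Cmult_neq_0; assumption).
  assert (Hqx : forall x : C, x <> 0 -> q / x <> 0).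
  { intros x Hx. apply Cmult_neq_0; [exact Hq0|]. intros E. apply C1_nz.
    rewrite <- (Cinv_r x Hx), E; ring. }
  unfold kern.
  replace (c * q ^ n * Q) with (c * Q * q ^ n) by ring.
  replace (q / (c * Q * q ^ n)) with (q / (c * Q) / q ^ n) by (field; auto).
  replace (q / (c * q ^ n)) with (q / c / q ^ n) by (field; auto).
  rewrite (qpoch_reflect q Hq (q / (c * Q)) n N) by auto.
  rewrite (qpoch_reflect q Hq (q / c) n N) by auto.
  replace (q / (q / (c * Q))) with (c * Q) by (field; auto).
  replace (q / (q / c)) with c by (field; auto).
  replace (S (N + n)) with (n + S N)%nat in * by lia.
  replace (N + n)%nat with (n + N)%nat by lia.
  rewrite qpoch_app in D1.
  rewrite (qpoch_app q (c * Q)), (qpoch_app q c).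
  assert (D3 : qpoch c q n <> 0) by (intros E; apply D1; rewrite E; ring).
  assert (D4 : qpoch (c * q ^ n) q (S N) <> 0) by (intros E; apply D1; rewrite E; ring).
  replace ((q / (c * Q)) ^ n) with ((q / c) ^ n * / Q ^ n).
  - assert (D5 : (q / c) ^ n <> 0) by (apply Cpow_nz; auto).
    assert (D6 : Q ^ n <> 0) by (apply Cpow_nz; auto).
    field. repeat split; auto.
  - rewrite <- Cpow_inv by exact HQ. rewrite <- Cpow_mult_l. f_equal. field; auto.
Qed.

End Finite.

Section Connection.
Variables q p : C.
Hypothesis Hq : (0 < Cmod q < 1)%R.
Hypothesis Hp : p ^ 5 = q.

Lemma Cmod_p : (0 < Cmod p < 1)%R.
Proof.
  assert (E : (Cmod p ^ 5 = Cmod q)%R) by (rewrite <- Cmod_pow, Hp; reflexivity).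
  pose proof (Cmod_ge_0 p). split.
  - apply Rnot_le_lt; intros Hle. assert (Cmod p = 0)%R as Z by lra.
    rewrite Z in E. simpl in E. lra.
  - apply Rnot_le_lt; intros Hle. pose proof (pow_R1_Rle (Cmod p) 5 Hle). lra.
Qed.

Lemma p_neq0 : p <> 0.
Proof. apply Cmod_gt_0. pose proof Cmod_p; lra. Qed.

Lemma pn_neq0 n : p ^ n <> 0.
Proof. apply Cpow_nz, p_neq0. Qed.

Lemma qpow_p n : q ^ n = p ^ (5 * n).
Proof. rewrite Cpow_mult_r, Hp; reflexivity. Qed.

(** ** The quotient of products whose values are the coefficients of the series *)

Definition quot (N : nat) (u : C) : C :=
  qpoch (q * u) q N ^ 4
  / (qpoch (p ^ 1 * u) q (S N) * qpoch (p ^ 2 * u) q (S N)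
     * qpoch (p ^ 3 * u) q (S N) * qpoch (p ^ 4 * u) q (S N)).

(** The coefficient of [1/(1 - p^k q^n u)] in [quot N u]; the factors involving
    [n] alone are those of the series at infinity with argument [q^2/Q]. *)
Definition quot_res (k n N : nat) : C :=
  (q ^ 2) ^ n
  * (qpoch (p ^ k) q n ^ 4
     / (qpoch q q n * Cprod (others k) (fun i => qpoch (p ^ (5 + k - i)) q n)))
  * (qpoch (p ^ (5 - k)) q (N - n) ^ 4
     / (Cprod (others k) (fun i => qpoch (p ^ i / p ^ k) q (S N - n))
        * qpoch q q (N - n))).

Definition sum4 (f : nat -> C) : C := f 1%nat + f 2%nat + f 3%nat + f 4%nat.

(** Enumerates the [p^m] with [m] not divisible by 5, four per power of [q];
    their inverses are the poles of [quot N]. *)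
Definition pole (m : nat) : C := p ^ (5 * (m / 4) + m mod 4 + 1).

(** The [4 N] zeros of [quot N], padded by three absent factors so that the
    numerator has exactly one factor less than the denominator. *)
Definition zer (N m : nat) : C := if Nat.ltb m (4 * N) then q ^ (m / 4 + 1) else 0.

Lemma divmod4 j i : (i < 4)%nat -> ((4 * j + i) / 4 = j /\ (4 * j + i) mod 4 = i)%nat.
Proof.
  intros Hi. split.
  - symmetry; apply (Nat.div_unique _ 4 j i); lia.
  - symmetry; apply (Nat.mod_unique _ 4 j i); lia.
Qed.

Lemma pole_eq j i : (i < 4)%nat -> pole (4 * j + i) = p ^ (S i) * q ^ j.
Proof.
  intros Hi. unfold pole. destruct (divmod4 j i Hi) as [-> ->].
  rewrite qpow_p, <- Cpow_add_r. f_equal; lia.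
Qed.

Lemma ppow_inj i j : p ^ i = p ^ j -> i = j.
Proof. apply qpow_inj. apply Cmod_p. Qed.

Lemma pole_inj m m' : m <> m' -> pole m <> pole m'.
Proof.
  intros H E. unfold pole in E. apply ppow_inj in E. apply H.
  pose proof (Nat.div_mod m 4 ltac:(lia)). pose proof (Nat.div_mod m' 4 ltac:(lia)).
  pose proof (Nat.mod_upper_bound m 4 ltac:(lia)). pose proof (Nat.mod_upper_bound m' 4 ltac:(lia)).
  lia.
Qed.

Lemma bprod_zer N u : bprod (fun l => 1 - zer N l * u) (4 * N + 3) = qpoch (q * u) q N ^ 4.
Proof.
  rewrite bprod_app.
  replace (bprod (fun i => 1 - zer N (4 * N + i) * u) 3) with (RtoC 1).
  2:{ cbn [bprod]. unfold zer.
      replace (Nat.ltb (4 * N + 0) (4 * N)) with false by (symmetry; apply Nat.ltb_ge; lia).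
      replace (Nat.ltb (4 * N + 1) (4 * N)) with false by (symmetry; apply Nat.ltb_ge; lia).
      replace (Nat.ltb (4 * N + 2) (4 * N)) with false by (symmetry; apply Nat.ltb_ge; lia).
      ring. }
  assert (H : forall i, (i < 4)%nat ->
    bprod (fun j => 1 - zer N (4 * j + i) * u) N = qpoch (q * u) q N).
  { intros i Hi. rewrite qpoch_bprod. apply bprod_ext. intros j Hj. unfold zer.
    replace (Nat.ltb (4 * j + i) (4 * N)) with true by (symmetry; apply Nat.ltb_lt; lia).
    destruct (divmod4 j i Hi) as [-> _]. rewrite Cpow_add_r. simpl. ring. }
  rewrite bprod_mod4, <- (H 0%nat), (H 1%nat), (H 2%nat), (H 3%nat) by lia.
  rewrite (bprod_ext (fun j => 1 - zer N (4 * j) * u) (fun j => 1 - zer N (4 * j + 0) * u))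
    by (intros; rewrite Nat.add_0_r; reflexivity).
  rewrite H by lia. ring.
Qed.

Lemma bprod_pole N u :
  bprod (fun i => 1 - pole i * u) (4 * S N) =
  qpoch (p ^ 1 * u) q (S N) * qpoch (p ^ 2 * u) q (S N)
     * qpoch (p ^ 3 * u) q (S N) * qpoch (p ^ 4 * u) q (S N).
Proof.
  assert (H : forall i, (i < 4)%nat ->
    bprod (fun j => 1 - pole (4 * j + i) * u) (S N) = qpoch (p ^ S i * u) q (S N)).
  { intros i Hi. rewrite qpoch_bprod. apply bprod_ext. intros j Hj.
    rewrite pole_eq by exact Hi. ring. }
  rewrite bprod_mod4, (H 1%nat), (H 2%nat), (H 3%nat), <- (H 0%nat) by lia.
  rewrite (bprod_ext (fun j => 1 - pole (4 * j) * u) (fun j => 1 - pole (4 * j + 0) * u))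
    by (intros; rewrite Nat.add_0_r; reflexivity). reflexivity.
Qed.

(** Grouping the poles by residue class turns the three other classes into plain
    products and leaves the omitted factor in the class of [i0]. *)
Lemma bprod_pole_omit N n i0 : (i0 < 4)%nat -> (n <= N)%nat ->
  bprod (fun i => if Nat.eqb i (4 * n + i0) then 1 else 1 - pole i / pole (4 * n + i0)) (4 * S N) =
  refl_factor q n * qpoch q q n * qpoch q q (N - n)
  * Cprod (others (S i0)) (fun i => qpoch (p ^ i / p ^ S i0 / q ^ n) q (S N)).
Proof.
  intros Hi0 Hn. rewrite bprod_mod4.
  pose proof (qn_neq0 q Hq) as Hqn. pose proof pn_neq0 as Hpn.
  assert (Hd : forall i, (i < 4)%nat -> i <> i0 ->
    bprod (fun j => if Nat.eqb (4 * j + i) (4 * n + i0) then 1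
                    else 1 - pole (4 * j + i) / pole (4 * n + i0)) (S N)
    = qpoch (p ^ S i / p ^ S i0 / q ^ n) q (S N)).
  { intros i Hi Hii. rewrite qpoch_bprod. apply bprod_ext. intros j Hj.
    replace (Nat.eqb (4 * j + i) (4 * n + i0)) with false by (symmetry; apply Nat.eqb_neq; lia).
    rewrite !pole_eq by assumption. field. auto. }
  assert (Hs : bprod (fun j => if Nat.eqb (4 * j + i0) (4 * n + i0) then 1
                    else 1 - pole (4 * j + i0) / pole (4 * n + i0)) (S N)
    = refl_factor q n * qpoch q q n * qpoch q q (N - n)).
  { rewrite <- (bprod_omit q Hq N n Hn). apply bprod_ext. intros j Hj.
    rewrite !pole_eq by assumption.
    destruct (Nat.eqb_spec j n) as [->|Hjn].
    - rewrite Nat.eqb_refl; reflexivity.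
    - replace (Nat.eqb (4 * j + i0) (4 * n + i0)) with false by (symmetry; apply Nat.eqb_neq; lia).
      field. auto. }
  assert (E0 : forall m, bprod (fun j => if Nat.eqb (4 * j) m then 1 else 1 - pole (4 * j) / pole m) (S N)
    = bprod (fun j => if Nat.eqb (4 * j + 0) m then 1 else 1 - pole (4 * j + 0) / pole m) (S N)).
  { intros m; apply bprod_ext; intros; rewrite Nat.add_0_r; reflexivity. }
  rewrite E0.
  destruct i0 as [|[|[|[|i0]]]]; try lia; rewrite Hs, !Hd by lia;
    unfold others, Cprod; cbn [filter map fold_right Nat.eqb negb]; ring.
Qed.

Lemma ratio_neq0 (a b : C) : a <> 0 -> b <> 0 -> a / b <> 0.
Proof.
  intros Ha Hb E. apply Ha. replace a with (a / b * b) by (field; exact Hb). rewrite E; ring.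
Qed.

(** The exponents of [q] and [p] produced by the four reflections add up to
    [q^(4n) p^(-10n) = q^(2n)], the source of the argument [q^2/Q]. *)
Lemma quot_partial_fractions (N : nat) (u : C) :
  (forall k n, (1 <= k <= 4)%nat -> (n <= N)%nat -> 1 - p ^ k * q ^ n * u <> 0) ->
  quot N u =
  bsum (fun n => sum4 (fun k => quot_res k n N / (1 - p ^ k * q ^ n * u))) (S N).
Proof.
  intros Hu.
  pose proof (qn_neq0 q Hq) as Hqn. pose proof pn_neq0 as Hpn. pose proof (q_neq0 q Hq) as Hq0.
  pose proof (partial_fractions pole (zer N) (4 * N + 3)) as PF.
  assert (Hu' : forall i, (i <= 4 * N + 3)%nat -> 1 - pole i * u <> 0).
  { intros i Hi. pose proof (Nat.mod_upper_bound i 4 ltac:(lia)).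
    rewrite (Nat.div_mod i 4) by lia. rewrite pole_eq by assumption.
    apply Hu; [lia|]. assert (i / 4 < S N)%nat; [|lia]. apply Nat.Div0.div_lt_upper_bound; lia. }
  specialize (PF ltac:(intros; apply Hpn) ltac:(intros i j _ _; apply pole_inj) u Hu').
  replace (S (4 * N + 3)) with (4 * S N)%nat in PF by lia.
  rewrite bprod_zer, bprod_pole in PF. unfold quot. rewrite PF.
  rewrite bsum_mod4. apply bsum_ext. intros n Hn.
  assert (HR : forall i0, (i0 < 4)%nat ->
     residue pole (zer N) (4 * N + 3) (4 * n + i0) = quot_res (S i0) n N).
  { intros i0 Hi0. unfold residue.
    replace (S (4 * N + 3)) with (4 * S N)%nat by lia.
    rewrite bprod_pole_omit by lia.
    rewrite (bprod_ext _ (fun l => 1 - zer N l * / pole (4 * n + i0))) by reflexivity.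
    rewrite bprod_zer, pole_eq by assumption.
    replace (q * / (p ^ S i0 * q ^ n)) with (p ^ (5 - S i0) / q ^ n).
    2:{ replace q with (p ^ (5 - S i0) * p ^ S i0) at 2
          by (rewrite <- Cpow_add_r, <- Hp; f_equal; lia). field. auto. }
    rewrite (qpoch_reflect q Hq _ n N) by (auto; lia).
    assert (Hx : forall a, p ^ a <> 0 /\ True) by auto.
    assert (HqI : forall a b, (b <= 4)%nat -> (b <= 5 + a)%nat -> q / (p ^ b / p ^ a) = p ^ (5 + a - b)).
    { intros a b Hb Hab. rewrite <- Hp. 
      transitivity (p ^ (5 + a) / p ^ b); [rewrite Cpow_add_r; field; auto|].
      replace (5 + a)%nat with (5 + a - b + b)%nat at 1 by lia. rewrite (Cpow_add_r p _ b). field. auto. }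
    pose proof (refl_factor_neq0 q Hq n) as Hrf.
    assert (Hqq : forall n, qpoch q q n <> 0) by (intros m; apply qpoch_neq0_small; [exact Hq|lra]).
    assert (Hsm : forall a m, (1 <= a)%nat -> qpoch (p ^ a) q m <> 0).
    { intros a m Ha. apply qpoch_neq0_small; [exact Hq|].
      rewrite Cmod_pow. apply pow_lt_1_compat; [pose proof Cmod_p; lra|lia]. }
    assert (Hany : forall a b m, (a <= 4)%nat -> (b <= 4)%nat -> a <> b -> qpoch (p ^ a / p ^ b) q m <> 0).
    { intros a b m Ha Hb Hab. apply qpoch_neq0. intros j _ E.
      assert (E' : p ^ (a + 5 * j) = p ^ b).
      { rewrite Cpow_add_r, <- qpow_p.
        transitivity (p ^ b * (p ^ a / p ^ b * q ^ j)); [field; auto|rewrite E; ring]. }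
      apply ppow_inj in E'. lia. }
    assert (Hpq : q / p ^ (5 - S i0) = p ^ S i0).
    { rewrite <- Hp. replace 5%nat with (S i0 + (5 - S i0))%nat at 1 by lia.
      rewrite Cpow_add_r. field. auto. }
    unfold quot_res. rewrite Hpq.
    assert (Hpn' : forall a m, (p ^ a) ^ m = (p ^ m) ^ a).
    { intros a m. rewrite <- !Cpow_mult_r. f_equal; lia. }
    assert (Hqn' : (q ^ 2) ^ n = (p ^ n) ^ 10).
    { rewrite <- Hp, <- !Cpow_mult_r. f_equal; lia. }
    assert (Hdiv : forall a b m, (p ^ a / p ^ b) ^ m = (p ^ m) ^ a / (p ^ m) ^ b).
    { intros a b m. unfold Cdiv. rewrite Cpow_mult_l, Cpow_inv by auto. rewrite (Hpn' a m), (Hpn' b m). reflexivity. }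
    rewrite Hqn', (Hpn' (5 - S i0)%nat n).
    set (w := p ^ n). assert (Hw : w <> 0) by apply Hpn.
    destruct i0 as [|[|[|[|i0]]]]; try lia; unfold others, Cprod;
      cbn [filter map fold_right Nat.eqb negb];
      rewrite !(qpoch_reflect q Hq _ n (S N)) by first [apply ratio_neq0; apply Hpn|lia].
    all: rewrite !HqI by lia; rewrite !Hdiv; fold w.
    all: cbn [Nat.sub Nat.add].
    all: field; repeat split; auto; try (apply Hany; lia); try (apply Hsm; lia). }
  unfold sum4. rewrite <- (HR 0%nat), <- (HR 1%nat), <- (HR 2%nat), <- (HR 3%nat) by lia.
  replace (4 * n)%nat with (4 * n + 0)%nat at 1 2 by lia.
  rewrite !pole_eq by lia. reflexivity.
Qed.

(** ** The finite form of the connection formula *)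

(** No denominator of the double sum vanishes near [P = 1]: a multiple of 5 and
    [k] plus a multiple of 5 differ by at least one power of [p]. *)
Lemma not_resonant (P : C) (k a b : nat) :
  (Cmod p < Cmod P)%R -> (Cmod P * Cmod p < 1)%R -> (1 <= k <= 4)%nat ->
  P * p ^ k * q ^ a <> q ^ b.
Proof.
  intros H1 H2 Hk E. rewrite !qpow_p, <- Cmult_assoc, <- Cpow_add_r in E.
  pose proof Cmod_p as Hm.
  destruct (Nat.lt_ge_cases (5 * b) (k + 5 * a)) as [Hl|Hl].
  - replace (k + 5 * a)%nat with (5 * b + (1 + (k + 5 * a - 5 * b - 1)))%nat in E by lia.
    set (m := (k + 5 * a - 5 * b - 1)%nat) in *.
    assert (E' : P * p ^ (1 + m) = 1).
    { transitivity (P * p ^ (5 * b + (1 + m)) / p ^ (5 * b)).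
      - rewrite (Cpow_add_r p (5 * b)). field. apply pn_neq0.
      - rewrite E. field. apply pn_neq0. }
    apply (f_equal Cmod) in E'. rewrite Cmod_mult, Cmod_pow, Cmod_1 in E'. simpl in E'.
    assert (Cmod p ^ m <= 1)%R by (rewrite <- (pow1 m); apply pow_incr; lra).
    assert (0 <= Cmod P * Cmod p)%R by (apply Rmult_le_pos; apply Cmod_ge_0). nra.
  - replace (5 * b)%nat with (k + 5 * a + (1 + (5 * b - k - 5 * a - 1)))%nat in E by lia.
    set (m := (5 * b - k - 5 * a - 1)%nat) in *.
    rewrite (Cpow_add_r p (k + 5 * a)), Cmult_comm in E.
    assert (E' : P = p ^ (1 + m)).
    { transitivity (/ p ^ (k + 5 * a) * (p ^ (k + 5 * a) * P)).
      - field. apply pn_neq0.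
      - rewrite E. field. apply pn_neq0. }
    apply (f_equal Cmod) in E'. rewrite Cmod_pow in E'. simpl in E'.
    assert (0 <= Cmod p ^ m <= 1)%R by (apply pow_01; lra).
    nra.
Qed.

(** Both sides are the double sum of
    [kern_wt Q N m * quot_res k n N / (1 - P p^k q^(n + m - N))]. *)
Lemma finite_connection (P Q : C) (N : nat) :
  Q <> 0 -> (Cmod p < Cmod P)%R -> (Cmod P * Cmod p < 1)%R ->
  bsum (fun m => kern_wt q Q N m * quot N (P * q ^ m / q ^ N)) (S (2 * N))
  = bsum (fun n => sum4 (fun k => quot_res k n N * kern q Q N (P * p ^ k * q ^ n))) (S N).
Proof.
  intros HQ H1 H2.
  pose proof (qn_neq0 q Hq) as Hqn. pose proof pn_neq0 as Hpn. pose proof Cmod_p as Hm.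
  assert (HP : P <> 0) by (apply Cmod_gt_0; lra).
  assert (HD : forall k n m, (1 <= k <= 4)%nat -> 1 - p ^ k * q ^ n * (P * q ^ m / q ^ N) <> 0).
  { intros k n m Hk E. apply (not_resonant P k (n + m) N H1 H2 Hk).
    symmetry. apply Ceq_minus. rewrite Cpow_add_r.
    transitivity (q ^ N * (1 - p ^ k * q ^ n * (P * q ^ m / q ^ N))); [field; auto|rewrite E; ring]. }
  rewrite (bsum_ext _ (fun m => bsum (fun n => sum4 (fun k =>
      kern_wt q Q N m * (quot_res k n N / (1 - p ^ k * q ^ n * (P * q ^ m / q ^ N))))) (S N))).
  2:{ intros m Hmm. rewrite quot_partial_fractions by (intros; apply HD; assumption).
      rewrite <- bsum_scal. apply bsum_ext. intros n Hn. unfold sum4. ring. }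
  rewrite bsum_swap. apply bsum_ext. intros n Hn.
  assert (HK : forall k, (1 <= k <= 4)%nat ->
     quot_res k n N * kern q Q N (P * p ^ k * q ^ n)
     = bsum (fun m => kern_wt q Q N m
          * (quot_res k n N / (1 - p ^ k * q ^ n * (P * q ^ m / q ^ N)))) (S (2 * N))).
  { intros k Hk. rewrite (kern_sum q Hq).
    - rewrite <- bsum_scal. apply bsum_ext. intros m Hmm.
      replace (q ^ m * (P * p ^ k * q ^ n / q ^ N)) with (p ^ k * q ^ n * (P * q ^ m / q ^ N))
        by (field; auto).
      specialize (HD k n m Hk). generalize dependent (1 - p ^ k * q ^ n * (P * q ^ m / q ^ N)).
      intros D HD. field. exact HD.
    - exact HQ.
    - repeat apply Cmult_neq_0; auto.
    - intros m Hmm. replace (q ^ m * (P * p ^ k * q ^ n / q ^ N)) with (p ^ k * q ^ n * (P * q ^ m / q ^ N))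
        by (field; auto). apply HD, Hk. }
  unfold sum4. rewrite !HK by lia. rewrite <- !bsum_plus. reflexivity.
Qed.

End Connection.

(** * The connection formula modulo [(1 - P) ^ 4] *)

Lemma Cconv_bounded_all (u : nat -> C) (l : C) :
  Cconv u l -> exists M, (0 <= M)%R /\ forall n, (Cmod (u n) <= M)%R.
Proof.
  intros H. destruct (Cconv_bounded u l H) as [N HN].
  assert (HF : exists M, (0 <= M)%R /\ forall n, (n < N)%nat -> (Cmod (u n) <= M)%R).
  { clear HN. induction N as [|N [M [HM IH]]].
    - exists 0%R; split; [lra|lia].
    - exists (Rmax M (Cmod (u N))). split; [eapply Rle_trans; [exact HM|apply Rmax_l]|].
      intros n Hn. destruct (Nat.eq_dec n N) as [->|Hne]; [apply Rmax_r|].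
      eapply Rle_trans; [apply IH; lia|apply Rmax_l]. }
  destruct HF as [M [HM HF]]. exists (Rmax M (Cmod l + 1)).
  split; [eapply Rle_trans; [exact HM|apply Rmax_l]|]. intros n.
  destruct (Nat.lt_ge_cases n N) as [Hn|Hn].
  - eapply Rle_trans; [apply HF, Hn|apply Rmax_l].
  - eapply Rle_trans; [apply HN, Hn|apply Rmax_r].
Qed.

(* Purely syntactic descent into products: [apply] would also unfold powers. *)
Ltac mul_pos := repeat match goal with |- (0 <= ?a * ?b)%R => apply Rmult_le_pos end.
Ltac mul_compat :=
  repeat match goal with |- (?a * ?b <= ?c * ?d)%R => apply Rmult_le_compat end.

Lemma Cmod_sum4 (f : nat -> C) :
  (Cmod (sum4 f) <= Cmod (f 1%nat) + Cmod (f 2%nat) + Cmod (f 3%nat) + Cmod (f 4%nat))%R.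
Proof.
  unfold sum4.
  eapply Rle_trans; [apply Cmod_triangle|]; apply Rplus_le_compat_r.
  eapply Rle_trans; [apply Cmod_triangle|]; apply Rplus_le_compat_r.
  apply Cmod_triangle.
Qed.

Section Limit.
Variables q p : C.
Hypothesis Hq : (0 < Cmod q < 1)%R.
Hypothesis Hp : p ^ 5 = q.

Let Hm : (0 < Cmod p < 1)%R := Cmod_p q p Hq Hp.
Let Hpn : forall n, p ^ n <> 0 := pn_neq0 q p Hq Hp.
Let Hqn : forall n, q ^ n <> 0 := qn_neq0 q Hq.
Let Hq0 : q <> 0 := q_neq0 q Hq.

Lemma inv_qpoch_bounded (x : C) :
  (forall j, x * q ^ j <> 1) ->
  exists M, (0 <= M)%R /\ forall n, (Cmod (/ qpoch x q n) <= M)%R.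
Proof.
  intros Hx. apply (Cconv_bounded_all _ (/ qpoch_inf x q)).
  apply Cconv_inv; [apply qpoch_inf_neq0; assumption|apply qpoch_inf_conv, Hq].
Qed.

Lemma ppow_small (a : nat) : (1 <= a)%nat -> (Cmod (p ^ a) < 1)%R.
Proof. intros Ha. rewrite Cmod_pow. apply pow_lt_1_compat; [lra|lia]. Qed.

Lemma p_ratio_neq1 (a b j : nat) :
  (1 <= a <= 4)%nat -> (1 <= b <= 4)%nat -> a <> b -> p ^ a / p ^ b * q ^ j <> 1.
Proof.
  intros Ha Hb Hab E.
  assert (E' : p ^ (a + 5 * j) = p ^ b).
  { rewrite Cpow_add_r, <- (qpow_p q p Hp).
    transitivity (p ^ b * (p ^ a / p ^ b * q ^ j)); [field; auto|rewrite E; ring]. }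
  apply (ppow_inj q p Hq Hp) in E'. lia.
Qed.

Lemma others_range (k i : nat) : In i (others k) -> (1 <= i <= 4)%nat /\ i <> k.
Proof.
  unfold others. intros H. apply filter_In in H. destruct H as [H1 H2].
  apply Bool.negb_true_iff, Nat.eqb_neq in H2. split; [|exact H2].
  simpl in H1. lia.
Qed.

Lemma Cprod_conv (l : list nat) (f : nat -> nat -> C) (g : nat -> C) :
  (forall i, In i l -> Cconv (fun N => f N i) (g i)) ->
  Cconv (fun N => Cprod l (f N)) (Cprod l g).
Proof.
  unfold Cprod. induction l as [|i l IH]; intros H; simpl; [apply Cconv_const|].
  apply (Cconv_mult (fun N => f N i)); [apply H; left; reflexivity|].
  apply IH. intros; apply H; right; assumption.
Qed.

Lemma Cprod_neq0 (l : list nat) (g : nat -> C) :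
  (forall i, In i l -> g i <> 0) -> Cprod l g <> 0.
Proof.
  unfold Cprod. induction l as [|i l IH]; intros H; simpl; [apply C1_nz|].
  apply Cmult_neq_0; [apply H; left; reflexivity|].
  apply IH. intros; apply H; right; assumption.
Qed.

Definition phi_coef (k n : nat) : C :=
  qpoch (p ^ k) q n ^ 4
  / (qpoch q q n * Cprod (others k) (fun i => qpoch (p ^ (5 + k - i)) q n)).

(** The factor of [quot_res k n N] that depends on [N - n] only. *)
Definition res_lim (k : nat) (N : nat) : C :=
  qpoch (p ^ (5 - k)) q N ^ 4
  / (Cprod (others k) (fun i => qpoch (p ^ i / p ^ k) q (S N)) * qpoch q q N).

Definition kap (k : nat) : C :=
  qpoch_inf (p ^ (5 - k)) q ^ 4
  / (Cprod (others k) (fun i => qpoch_inf (p ^ i / p ^ k) q) * qpoch_inf q q).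

Lemma quot_res_split k n N : (n <= N)%nat ->
  quot_res q p k n N = (q ^ 2) ^ n * phi_coef k n * res_lim k (N - n).
Proof.
  intros Hn. unfold quot_res, phi_coef, res_lim.
  replace (S N - n)%nat with (S (N - n)) by lia. reflexivity.
Qed.

Lemma qpoch_conv_S x : Cconv (fun N => qpoch x q (S N)) (qpoch_inf x q).
Proof. apply (Cconv_subseq (qpoch x q) _ S); [auto|apply qpoch_inf_conv, Hq]. Qed.

Lemma res_lim_conv k : (1 <= k <= 4)%nat -> Cconv (res_lim k) (kap k).
Proof.
  intros Hk. unfold res_lim, kap. apply Cconv_div.
  - apply Cmult_neq_0.
    + apply Cprod_neq0. intros i Hi. apply others_range in Hi.
      apply qpoch_inf_neq0; [exact Hq|]. intros j. apply p_ratio_neq1; lia.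
    + apply qpoch_inf_neq0_small; [exact Hq|lra].
  - apply Cconv_pow, qpoch_inf_conv, Hq.
  - apply Cconv_mult; [|apply qpoch_inf_conv, Hq].
    apply (Cprod_conv (others k) (fun N i => qpoch (p ^ i / p ^ k) q (S N))).
    intros i Hi. apply qpoch_conv_S.
Qed.

Lemma phi_coef_bounded k : (1 <= k <= 4)%nat ->
  exists M, (0 <= M)%R /\ forall n, (Cmod (phi_coef k n) <= M)%R.
Proof.
  intros Hk. apply (Cconv_bounded_all _ (qpoch_inf (p ^ k) q ^ 4
    / (qpoch_inf q q * Cprod (others k) (fun i => qpoch_inf (p ^ (5 + k - i)) q)))).
  unfold phi_coef. apply Cconv_div.
  - apply Cmult_neq_0; [apply qpoch_inf_neq0_small; [exact Hq|lra]|].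
    apply Cprod_neq0. intros i Hi. apply others_range in Hi.
    apply qpoch_inf_neq0_small; [exact Hq|]. apply ppow_small; lia.
  - apply Cconv_pow, qpoch_inf_conv, Hq.
  - apply Cconv_mult; [apply qpoch_inf_conv, Hq|].
    apply (Cprod_conv (others k) (fun N i => qpoch (p ^ (5 + k - i)) q N)).
    intros i Hi. apply qpoch_inf_conv, Hq.
Qed.

(** ** Points near [P = 1] *)

(** The radius keeps [P p^i] and [p^i / P] in the disc of radius [(1 + |p|)/2] for
    all [i >= 1], where products are bounded below uniformly. *)
Definition near1 (P : C) : Prop := (Cmod (P - 1) < (1 - Cmod p) / 2)%R.

Let x0 : R := ((1 + Cmod p) / 2)%R.

Lemma near1_bounds P : near1 P ->
  (Cmod p < Cmod P)%R /\ (Cmod P <= 2)%R /\ (Cmod P * Cmod p <= x0)%R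
  /\ (Cmod p <= x0 * Cmod P)%R /\ (x0 < 1)%R.
Proof.
  unfold near1, x0. intros H. set (m := Cmod p) in *.
  assert (H1 : (Cmod P <= 1 + Cmod (P - 1))%R).
  { replace P with (1 + (P - 1)) at 1 by ring.
    eapply Rle_trans; [apply Cmod_triangle|]. rewrite Cmod_1; lra. }
  assert (H2 : (1 <= Cmod P + Cmod (P - 1))%R).
  { pose proof (Cmod_triangle P (- (P - 1))) as T.
    replace (P + - (P - 1)) with (RtoC 1) in T by ring. rewrite Cmod_1, Cmod_opp in T. exact T. }
  pose proof (Cmod_ge_0 (P - 1)). repeat split; nra.
Qed.

Lemma near1_neq0 P : near1 P -> P <> 0.
Proof. intros H. apply Cmod_gt_0. pose proof (near1_bounds P H). lra. Qed.

Lemma near1_num P i : near1 P -> (1 <= i)%nat -> (Cmod (p ^ i * P) <= x0)%R.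
Proof.
  intros H Hi. destruct (near1_bounds P H) as [_ [_ [H1 _]]].
  destruct i as [|i]; [lia|]. rewrite Cmod_mult, Cmod_pow. simpl.
  assert (Cmod p ^ i <= 1)%R by (rewrite <- (pow1 i); apply pow_incr; lra).
  assert (0 <= Cmod P * Cmod p)%R by (apply Rmult_le_pos; apply Cmod_ge_0). nra.
Qed.

Lemma near1_den P i : near1 P -> (1 <= i)%nat -> (Cmod (p ^ i / P) <= x0)%R.
Proof.
  intros H Hi. destruct (near1_bounds P H) as [H0 [_ [_ [H1 _]]]].
  destruct i as [|i]; [lia|]. rewrite Cmod_div by (apply near1_neq0, H).
  rewrite Cmod_pow. simpl. apply Rle_div_l; [lra|].
  assert (0 <= Cmod p ^ i <= 1)%R by (apply pow_01; lra).
  assert (Cmod p * Cmod p ^ i <= Cmod p * 1)%R by (apply Rmult_le_compat_l; lra). lra.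
Qed.

Section FixedQ.
Variable Q : C.
Hypothesis HQ : (Cmod q ^ 2 < Cmod Q < 1)%R.

Let HQ0 : Q <> 0.
Proof. apply Cmod_gt_0. pose proof (pow2_ge_0 (Cmod q)). lra. Qed.

Let Hq2Q : (Cmod (q ^ 2 / Q) < 1)%R.
Proof.
  rewrite Cmod_div, Cmod_pow by exact HQ0.
  apply Rlt_div_l; [|lra]. apply Cmod_gt_0, HQ0.
Qed.

Definition theta_ratio (k : nat) (P : C) : C :=
  (qpoch_inf (P * p ^ k * Q) q * qpoch_inf (q / (P * p ^ k * Q)) q)
  / (qpoch_inf (P * p ^ k) q * qpoch_inf (q / (P * p ^ k)) q).

(** Dominated convergence with ratio [|q^2/Q|]: [q^(2n)] from the residue and
    [Q^-n] from the shift of the kernel. *)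
Lemma far_side_conv (P : C) : near1 P ->
  Cconv (fun N => bsum (fun n => sum4 (fun k =>
            quot_res q p k n N * kern q Q N (P * p ^ k * q ^ n))) (S N))
        (Csum (fun n => sum4 (fun k =>
            (kap k * theta_ratio k P) * (phi_coef k n * (q ^ 2 / Q) ^ n)))).
Proof.
  intros HP. destruct (near1_bounds P HP) as [B1 [B2 [B3 [B4 B5]]]].
  assert (HP0 : P <> 0) by (apply near1_neq0, HP).
  assert (Hc0 : forall k, P * p ^ k <> 0) by (intros k; apply Cmult_neq_0; auto).
  assert (Hc1 : forall k j, (1 <= k <= 4)%nat -> P * p ^ k * q ^ j <> 1).
  { intros k j Hk. replace (RtoC 1) with (q ^ 0) by reflexivity.
    apply (not_resonant q p Hq Hp); try assumption; lra. }
  assert (Hc2 : forall k j, (1 <= k <= 4)%nat -> q / (P * p ^ k) * q ^ j <> 1).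
  { intros k j Hk E. apply (not_resonant q p Hq Hp P k 0 (S j)); try assumption; [lra|].
    transitivity ((P * p ^ k) * 1); [simpl; ring|]. rewrite <- E. simpl. field. auto. }
  set (term := fun N n k => (q ^ 2 / Q) ^ n * phi_coef k n * res_lim k (N - n)
     * ((qpoch (P * p ^ k * Q) q (N + n) * qpoch (q / (P * p ^ k * Q)) q (N - n))
        / (qpoch (P * p ^ k) q (S (N + n)) * qpoch (q / (P * p ^ k)) q (N - n)))).
  apply Cconv_ext with (fun N => bsum (fun n => sum4 (term N n)) (S N)).
  { intros N. apply bsum_ext. intros n Hn.
    assert (E : forall k, (1 <= k <= 4)%nat ->
      term N n k = quot_res q p k n N * kern q Q N (P * p ^ k * q ^ n)).
    { intros k Hk. unfold term. rewrite quot_res_split by lia.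
      assert (D1 : qpoch (P * p ^ k) q (S (N + n)) <> 0) by (apply qpoch_neq0; auto).
      assert (D2 : qpoch (q / (P * p ^ k)) q (N - n) <> 0) by (apply qpoch_neq0; auto).
      rewrite (kern_shift q Hq); auto; [|lia].
      unfold Cdiv at 1. rewrite Cpow_mult_l, Cpow_inv by exact HQ0.
      field. repeat split; auto; apply Cpow_nz, HQ0. }
    unfold sum4. rewrite !E by lia. reflexivity. }
  assert (HT : forall k, (1 <= k <= 4)%nat -> exists M, (0 <= M)%R /\
     forall N n, (n <= N)%nat -> (Cmod (term N n k) <= M * Cmod (q ^ 2 / Q) ^ n)%R).
  { intros k Hk.
    destruct (phi_coef_bounded k Hk) as [M1 [P1 M1H]].
    destruct (Cconv_bounded_all _ _ (res_lim_conv k Hk)) as [M2 [P2 M2H]].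
    destruct (Cconv_bounded_all _ _ (qpoch_inf_conv q Hq (P * p ^ k * Q))) as [M3 [P3 M3H]].
    destruct (Cconv_bounded_all _ _ (qpoch_inf_conv q Hq (q / (P * p ^ k * Q)))) as [M4 [P4 M4H]].
    destruct (inv_qpoch_bounded (P * p ^ k) ltac:(auto)) as [M5 [P5 M5H]].
    destruct (inv_qpoch_bounded (q / (P * p ^ k)) ltac:(auto)) as [M6 [P6 M6H]].
    exists (M1 * M2 * (M3 * M4 * (M5 * M6)))%R. split; [mul_pos; assumption|].
    intros N n Hn. unfold term.
    assert (D1 : qpoch (P * p ^ k) q (S (N + n)) <> 0) by (apply qpoch_neq0; auto).
    assert (D2 : qpoch (q / (P * p ^ k)) q (N - n) <> 0) by (apply qpoch_neq0; auto).
    replace ((q ^ 2 / Q) ^ n * phi_coef k n * res_lim k (N - n) *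
     (qpoch (P * p ^ k * Q) q (N + n) * qpoch (q / (P * p ^ k * Q)) q (N - n)
      / (qpoch (P * p ^ k) q (S (N + n)) * qpoch (q / (P * p ^ k)) q (N - n))))
    with (phi_coef k n * res_lim k (N - n) * (qpoch (P * p ^ k * Q) q (N + n)
      * qpoch (q / (P * p ^ k * Q)) q (N - n) * (/ qpoch (P * p ^ k) q (S (N + n))
       * / qpoch (q / (P * p ^ k)) q (N - n))) * (q ^ 2 / Q) ^ n).
    2:{ generalize dependent (qpoch (P * p ^ k) q (S (N + n))).
        generalize dependent (qpoch (q / (P * p ^ k)) q (N - n)).
        generalize ((q ^ 2 / Q) ^ n). generalize (qpoch (q / (P * p ^ k * Q)) q (N - n)).
        intros; field; split; assumption. }
    rewrite (Cmod_mult _ ((q ^ 2 / Q) ^ n)), Cmod_pow.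
    apply Rmult_le_compat_r; [apply pow_le, Cmod_ge_0|].
    rewrite !Cmod_mult.
    mul_compat; mul_pos; try apply Cmod_ge_0; auto. }
  destruct (HT 1%nat ltac:(lia)) as [M1 [P1 T1]]. destruct (HT 2%nat ltac:(lia)) as [M2 [P2 T2]].
  destruct (HT 3%nat ltac:(lia)) as [M3 [P3 T3]]. destruct (HT 4%nat ltac:(lia)) as [M4 [P4 T4]].
  apply (tannery (fun N n => sum4 (term N n)) _
    (fun n => (M1 + M2 + M3 + M4) * Cmod (q ^ 2 / Q) ^ n)%R S).
  - auto.
  - intros N n Hn. eapply Rle_trans; [apply Cmod_sum4|].
    pose proof (T1 N n ltac:(lia)); pose proof (T2 N n ltac:(lia));
    pose proof (T3 N n ltac:(lia)); pose proof (T4 N n ltac:(lia)). lra.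
  - intros n. apply Rmult_le_pos; [lra|apply pow_le, Cmod_ge_0].
  - apply (ex_series_scal_l (M1 + M2 + M3 + M4)%R (fun n => Cmod (q ^ 2 / Q) ^ n)%R).
    apply ex_series_geom. rewrite Rabs_pos_eq; [exact Hq2Q|apply Cmod_ge_0].
  - intros n.
    assert (HC : forall k, (1 <= k <= 4)%nat -> Cconv (fun N => term N n k)
       (kap k * theta_ratio k P * (phi_coef k n * (q ^ 2 / Q) ^ n))).
    { intros k Hk. unfold term, theta_ratio.
      assert (S1 : forall x, Cconv (fun N => qpoch x q (N + n)) (qpoch_inf x q)).
      { intros x. apply (Cconv_subseq (qpoch x q) _ (fun N => (N + n)%nat)); [lia|apply qpoch_inf_conv, Hq]. }
      assert (S2 : forall x, Cconv (fun N => qpoch x q (S (N + n))) (qpoch_inf x q)).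
      { intros x. apply (Cconv_subseq (qpoch x q) _ (fun N => S (N + n))); [lia|apply qpoch_inf_conv, Hq]. }
      assert (S3 : forall x, Cconv (fun N => qpoch x q (N - n)) (qpoch_inf x q)).
      { intros x. apply Cconv_shift_minus, qpoch_inf_conv, Hq. }
      match goal with |- Cconv _ (?a * ?b * (?c * ?d)) =>
        replace (a * b * (c * d)) with (d * c * a * b) by ring end.
      apply Cconv_mult; [apply Cconv_mult; [apply Cconv_const|]|].
      - apply (Cconv_shift_minus (res_lim k)), res_lim_conv, Hk.
      - apply Cconv_div; [|apply Cconv_mult; auto|apply Cconv_mult; auto].
        apply Cmult_neq_0; apply qpoch_inf_neq0; auto. }
    unfold sum4. repeat apply Cconv_plus; apply HC; lia.
Qed.

Lemma quot_near (P : C) (N j : nat) : near1 P ->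
  (Cmod (quot q p N (P * q ^ j)) <= U q 2 ^ 4 * (L q x0 * L q x0 * L q x0 * L q x0))%R.
Proof.
  intros HP. destruct (near1_bounds P HP) as [B1 [B2 [B3 [B4 B5]]]].
  assert (Hj : (0 <= Cmod q ^ j <= 1)%R) by (apply pow_01; lra).
  assert (Hsm : forall i, (1 <= i)%nat -> (Cmod (p ^ i * (P * q ^ j)) <= x0)%R).
  { intros i Hi. rewrite Cmult_assoc, Cmod_mult, Cmod_pow.
    pose proof (near1_num P i HP Hi). pose proof (Cmod_ge_0 (p ^ i * P)). nra. }
  unfold quot.
  assert (Hn : forall i, (1 <= i)%nat -> qpoch (p ^ i * (P * q ^ j)) q (S N) <> 0).
  { intros i Hi. apply qpoch_neq0_small; [exact Hq|]. pose proof (Hsm i Hi); lra. }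
  pose proof (Hn 1 ltac:(lia))%nat; pose proof (Hn 2 ltac:(lia))%nat;
  pose proof (Hn 3 ltac:(lia))%nat; pose proof (Hn 4 ltac:(lia))%nat.
  unfold Cdiv. rewrite Cmod_mult.
  apply Rmult_le_compat; try apply Cmod_ge_0.
  - rewrite Cmod_pow. apply pow_incr. split; [apply Cmod_ge_0|].
    eapply Rle_trans; [apply (qpoch_upper q Hq)|]. apply (U_mono q Hq).
    rewrite !Cmod_mult, Cmod_pow. pose proof (Cmod_ge_0 P).
    assert (Cmod P * Cmod q ^ j <= 2)%R by nra.
    assert (0 <= Cmod P * Cmod q ^ j)%R by (apply Rmult_le_pos; lra). nra.
  - assert (Hl : forall i, (1 <= i)%nat -> (Cmod (/ qpoch (p ^ i * (P * q ^ j)) q (S N)) <= L q x0)%R).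
    { intros i Hi. apply (qpoch_lower q Hq); [apply Hsm, Hi|exact B5]. }
    replace (/ (qpoch (p ^ 1 * (P * q ^ j)) q (S N) * qpoch (p ^ 2 * (P * q ^ j)) q (S N) *
      qpoch (p ^ 3 * (P * q ^ j)) q (S N) * qpoch (p ^ 4 * (P * q ^ j)) q (S N)))
    with (/ qpoch (p ^ 1 * (P * q ^ j)) q (S N) * / qpoch (p ^ 2 * (P * q ^ j)) q (S N) *
      / qpoch (p ^ 3 * (P * q ^ j)) q (S N) * / qpoch (p ^ 4 * (P * q ^ j)) q (S N))
      by (field; repeat split; assumption).
    rewrite !Cmod_mult.
    mul_compat; mul_pos; try apply Cmod_ge_0; apply Hl; lia.
Qed.

Definition quot_inf (u : C) : C :=
  qpoch_inf (q * u) q ^ 4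
  / (qpoch_inf (p ^ 1 * u) q * qpoch_inf (p ^ 2 * u) q
     * qpoch_inf (p ^ 3 * u) q * qpoch_inf (p ^ 4 * u) q).

(** The limit of [kern_wt Q N (N + d) / Q^d]. *)
Definition theta_unit : C :=
  (qpoch_inf (q / Q) q * qpoch_inf Q q) / (qpoch_inf q q * qpoch_inf q q).

(** Dominated convergence with ratio [|Q|], for the terms [d = j >= 0]. *)
Lemma near_side_conv (P : C) : near1 P ->
  Cconv (fun N => bsum (fun j => kern_wt q Q N (N + j) * quot q p N (P * q ^ (N + j) / q ^ N)) (S N))
        (Csum (fun j => theta_unit * (quot_inf (P * q ^ j) * Q ^ j))).
Proof.
  intros HP. destruct (near1_bounds P HP) as [B1 [B2 [B3 [B4 B5]]]].
  assert (Hqq : forall n, qpoch q q n <> 0) by (intros m; apply qpoch_neq0_small; [exact Hq|lra]).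
  set (term := fun N j => Q ^ j * ((qpoch (q / Q) q (N + j) * qpoch Q q (N - j))
     / (qpoch q q (N + j) * qpoch q q (N - j))) * quot q p N (P * q ^ j)).
  apply Cconv_ext with (fun N => bsum (term N) (S N)).
  { intros N. apply bsum_ext. intros j Hj. unfold term, kern_wt.
    replace (2 * N - (N + j))%nat with (N - j)%nat by lia.
    replace (P * q ^ (N + j) / q ^ N) with (P * q ^ j) by (rewrite Cpow_add_r; field; auto).
    rewrite (Cpow_add_r Q). field. repeat split; auto. apply Cpow_nz, HQ0. }
  destruct (Cconv_bounded_all _ _ (qpoch_inf_conv q Hq (q / Q))) as [M1 [P1 M1H]].
  destruct (Cconv_bounded_all _ _ (qpoch_inf_conv q Hq Q)) as [M2 [P2 M2H]].
  set (K := (U q 2 ^ 4 * (L q x0 * L q x0 * L q x0 * L q x0))%R).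
  assert (HK : (0 <= K)%R).
  { eapply Rle_trans; [apply Cmod_ge_0|apply (quot_near P 0 0 HP)]. }
  assert (HLp : (0 <= L q (Cmod q))%R).
  { eapply Rle_trans; [apply Cmod_ge_0|apply (qpoch_lower q Hq q (Cmod q) 0); lra]. }
  apply (tannery term _ (fun j => (M1 * M2 * (L q (Cmod q) * L q (Cmod q)) * K) * Cmod Q ^ j)%R S).
  - auto.
  - intros N j Hj. unfold term.
    replace (Q ^ j * (qpoch (q / Q) q (N + j) * qpoch Q q (N - j)
        / (qpoch q q (N + j) * qpoch q q (N - j))) * quot q p N (P * q ^ j))
      with (qpoch (q / Q) q (N + j) * qpoch Q q (N - j)
        * (/ qpoch q q (N + j) * / qpoch q q (N - j)) * quot q p N (P * q ^ j) * Q ^ j)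
      by (generalize (quot q p N (P * q ^ j)); intros; field; auto).
    rewrite (Cmod_mult _ (Q ^ j)), Cmod_pow.
    apply Rmult_le_compat_r; [apply pow_le, Cmod_ge_0|].
    rewrite !Cmod_mult.
    mul_compat; mul_pos; try apply Cmod_ge_0; auto;
      first [apply (quot_near P N j HP)|apply (qpoch_lower q Hq); lra].
  - intros j. apply Rmult_le_pos; [|apply pow_le, Cmod_ge_0].
    apply Rmult_le_pos; [|exact HK]. mul_pos; assumption.
  - apply (ex_series_scal_l _ (fun n => Cmod Q ^ n)%R).
    apply ex_series_geom. rewrite Rabs_pos_eq; [apply HQ|apply Cmod_ge_0].
  - intros j. unfold term, theta_unit.
    assert (S1 : forall x, Cconv (fun N => qpoch x q (N + j)) (qpoch_inf x q)).
    { intros x. apply (Cconv_subseq (qpoch x q) _ (fun N => (N + j)%nat)); [lia|apply qpoch_inf_conv, Hq]. }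
    assert (S3 : forall x, Cconv (fun N => qpoch x q (N - j)) (qpoch_inf x q)).
    { intros x. apply Cconv_shift_minus, qpoch_inf_conv, Hq. }
    assert (Hqi : qpoch_inf q q <> 0) by (apply qpoch_inf_neq0_small; [exact Hq|lra]).
    match goal with |- Cconv _ (?a * (?b * ?c)) =>
      replace (a * (b * c)) with (c * a * b) by ring end.
    apply Cconv_mult; [apply Cconv_mult; [apply Cconv_const|]|].
    + apply Cconv_div; [apply Cmult_neq_0; assumption| |]; apply Cconv_mult; auto.
    + unfold quot, quot_inf. apply Cconv_div.
      * assert (Hsm : forall i, (1 <= i)%nat -> qpoch_inf (p ^ i * (P * q ^ j)) q <> 0).
        { intros i Hi. apply qpoch_inf_neq0_small; [exact Hq|].
          rewrite Cmult_assoc, Cmod_mult, Cmod_pow.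
          pose proof (near1_num P i HP Hi). pose proof (Cmod_ge_0 (p ^ i * P)).
          assert (0 <= Cmod q ^ j <= 1)%R by (apply pow_01; lra).
          nra. }
        repeat apply Cmult_neq_0; apply Hsm; lia.
      * apply Cconv_pow, qpoch_inf_conv, Hq.
      * repeat apply Cconv_mult; apply qpoch_conv_S.
Qed.

(** Below [d = 0] the product [(Pq; q)_d^4] is a denominator with a factor
    [(1 - 1/P)^4] in its reciprocal: this half of the bilateral series is
    invisible modulo [(1 - P)^4]. *)
Lemma quot_negative (P : C) (N m : nat) : near1 P -> (S m <= N)%nat ->
  (Cmod (quot q p N (P / q ^ S m))
   <= Cmod (q ^ 2) ^ S m * ((Cmod (1 - P) / Cmod p) ^ 4 * (U q 1 ^ 4 * U q 2 ^ 4
        * (L q x0 * L q x0 * L q x0 * L q x0 * (L q x0 * L q x0 * L q x0 * L q x0)))))%R.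
Proof.
  intros HP HmN. destruct (near1_bounds P HP) as [B1 [B2 [B3 [B4 B5]]]].
  assert (HP0 : P <> 0) by (apply near1_neq0, HP).
  set (n := S m) in *.
  assert (E : quot q p N (P / q ^ n) =
    (q ^ 2) ^ n * (((1 - / P) ^ 4 * (qpoch (q / P) q m ^ 4 * qpoch (q * P) q (N - n) ^ 4
      * (/ qpoch (p ^ 4 / P) q n * / qpoch (p ^ 3 / P) q n * / qpoch (p ^ 2 / P) q n
         * / qpoch (p ^ 1 / P) q n
         * (/ qpoch (p ^ 1 * P) q (S N - n) * / qpoch (p ^ 2 * P) q (S N - n)
            * / qpoch (p ^ 3 * P) q (S N - n) * / qpoch (p ^ 4 * P) q (S N - n))))))).
  { unfold quot.
    replace (q * (P / q ^ n)) with (q * P / q ^ n) by (field; auto).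
    replace (p ^ 1 * (P / q ^ n)) with (p ^ 1 * P / q ^ n) by (field; auto).
    replace (p ^ 2 * (P / q ^ n)) with (p ^ 2 * P / q ^ n) by (field; auto).
    replace (p ^ 3 * (P / q ^ n)) with (p ^ 3 * P / q ^ n) by (field; auto).
    replace (p ^ 4 * (P / q ^ n)) with (p ^ 4 * P / q ^ n) by (field; auto).
    rewrite (qpoch_reflect q Hq (q * P) n N) by (try apply Cmult_neq_0; auto).
    rewrite (qpoch_reflect q Hq (p ^ 1 * P) n (S N)) by (try apply Cmult_neq_0; auto; lia).
    rewrite (qpoch_reflect q Hq (p ^ 2 * P) n (S N)) by (try apply Cmult_neq_0; auto; lia).
    rewrite (qpoch_reflect q Hq (p ^ 3 * P) n (S N)) by (try apply Cmult_neq_0; auto; lia).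
    rewrite (qpoch_reflect q Hq (p ^ 4 * P) n (S N)) by (try apply Cmult_neq_0; auto; lia).
    pose proof (p_neq0 q p Hq Hp) as Hp0.
    replace (q / (q * P)) with (/ P) by (field; auto).
    replace (q / (p ^ 1 * P)) with (p ^ 4 / P) by (rewrite <- Hp; field; auto).
    replace (q / (p ^ 2 * P)) with (p ^ 3 / P) by (rewrite <- Hp; field; auto).
    replace (q / (p ^ 3 * P)) with (p ^ 2 / P) by (rewrite <- Hp; field; auto).
    replace (q / (p ^ 4 * P)) with (p ^ 1 / P) by (rewrite <- Hp; field; auto).
    replace (qpoch (/ P) q n) with ((1 - / P) * qpoch (q / P) q m).
    2:{ unfold n. rewrite qpoch_S_l. do 2 f_equal. field; auto. }
    rewrite !Cpow_mult_l.
    assert (Hpn' : forall a, (p ^ a) ^ n = (p ^ n) ^ a).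
    { intros a. rewrite <- !Cpow_mult_r. f_equal; lia. }
    assert (E1 : (q ^ 2) ^ n = (p ^ n) ^ 10).
    { rewrite <- Hp, <- !Cpow_mult_r. f_equal; lia. }
    assert (E2 : q ^ n = (p ^ n) ^ 5).
    { rewrite <- Hp, <- !Cpow_mult_r. f_equal; lia. }
    rewrite E1, E2, (Hpn' 1%nat), (Hpn' 2%nat), (Hpn' 3%nat), (Hpn' 4%nat).
    assert (Hw : p ^ n <> 0) by apply Hpn. assert (HPn : P ^ n <> 0) by (apply Cpow_nz, HP0).
    pose proof (refl_factor_neq0 q Hq n) as Hrf.
    assert (N1 : forall i, (1 <= i)%nat -> qpoch (p ^ i / P) q n <> 0).
    { intros i Hi. apply qpoch_neq0_small; [exact Hq|]. pose proof (near1_den P i HP Hi); lra. }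
    assert (N2 : forall i, (1 <= i)%nat -> qpoch (p ^ i * P) q (S N - n) <> 0).
    { intros i Hi. apply qpoch_neq0_small; [exact Hq|]. pose proof (near1_num P i HP Hi); lra. }
    pose proof (N1 1 ltac:(lia))%nat as F1; pose proof (N1 2 ltac:(lia))%nat as F2;
    pose proof (N1 3 ltac:(lia))%nat as F3; pose proof (N1 4 ltac:(lia))%nat as F4;
    pose proof (N2 1 ltac:(lia))%nat as G1; pose proof (N2 2 ltac:(lia))%nat as G2;
    pose proof (N2 3 ltac:(lia))%nat as G3; pose proof (N2 4 ltac:(lia))%nat as G4.
    clear N1 N2.
    generalize dependent (qpoch (p ^ 1 / P) q n); generalize dependent (qpoch (p ^ 2 / P) q n);
    generalize dependent (qpoch (p ^ 3 / P) q n); generalize dependent (qpoch (p ^ 4 / P) q n);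
    generalize dependent (qpoch (p ^ 1 * P) q (S N - n)); generalize dependent (qpoch (p ^ 2 * P) q (S N - n));
    generalize dependent (qpoch (p ^ 3 * P) q (S N - n)); generalize dependent (qpoch (p ^ 4 * P) q (S N - n)).
    generalize dependent (p ^ n). generalize dependent (P ^ n). generalize dependent (refl_factor q n).
    generalize (1 - / P). generalize (qpoch (q / P) q m). generalize (qpoch (q * P) q (N - n)).
    intros. field. repeat split; assumption. }
  rewrite E, Cmod_mult, Cmod_pow. apply Rmult_le_compat_l; [apply pow_le, Cmod_ge_0|].
  rewrite Cmod_mult, Cmod_pow.
  apply Rmult_le_compat; [apply pow_le, Cmod_ge_0|apply Cmod_ge_0| |].
  - apply pow_incr. split; [apply Cmod_ge_0|].
    replace (1 - / P) with (- (1 - P) / P) by (field; exact HP0).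
    rewrite Cmod_div, Cmod_opp by exact HP0.
    apply Rmult_le_compat_l; [apply Cmod_ge_0|]. apply Rinv_le_contravar; lra.
  - rewrite !Cmod_mult, !Cmod_pow.
    assert (HL1 : forall i, (1 <= i)%nat -> (Cmod (/ qpoch (p ^ i / P) q n) <= L q x0)%R).
    { intros i Hi. apply (qpoch_lower q Hq); [apply near1_den; assumption|exact B5]. }
    assert (HL2 : forall i, (1 <= i)%nat -> (Cmod (/ qpoch (p ^ i * P) q (S N - n)) <= L q x0)%R).
    { intros i Hi. apply (qpoch_lower q Hq); [apply near1_num; assumption|exact B5]. }
    mul_compat; mul_pos; try apply Cmod_ge_0;
      try (apply pow_le, Cmod_ge_0); try (apply HL1; lia); try (apply HL2; lia).
    + apply pow_incr; split; [apply Cmod_ge_0|].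
      eapply Rle_trans; [apply (qpoch_upper q Hq)|]. apply (U_mono q Hq).
      rewrite <- Hp. pose proof (near1_den P 5 HP ltac:(lia)). lra.
    + apply pow_incr; split; [apply Cmod_ge_0|].
      eapply Rle_trans; [apply (qpoch_upper q Hq)|]. apply (U_mono q Hq).
      rewrite Cmod_mult. pose proof (Cmod_ge_0 P). nra.
Qed.

(** The terms [d = -(j + 1)], summed against a geometric series of ratio
    [|q^2/Q|]; the constant does not depend on [P] and [N]. *)
Lemma negative_side_bound :
  exists M, forall P N, near1 P ->
    (Cmod (bsum (fun j => kern_wt q Q N (N - S j) * quot q p N (P * q ^ (N - S j) / q ^ N))%C N)
     <= M * Cmod (1 - P) ^ 4)%R.
Proof.
  destruct (Cconv_bounded_all _ _ (qpoch_inf_conv q Hq (q / Q))) as [M1 [P1 M1H]].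
  destruct (Cconv_bounded_all _ _ (qpoch_inf_conv q Hq Q)) as [M2 [P2 M2H]].
  assert (Hqq : forall n, qpoch q q n <> 0) by (intros m; apply qpoch_neq0_small; [exact Hq|lra]).
  assert (HLp : (0 <= L q (Cmod q))%R).
  { eapply Rle_trans; [apply Cmod_ge_0|apply (qpoch_lower q Hq q (Cmod q) 0); lra]. }
  set (K := (U q 1 ^ 4 * U q 2 ^ 4
        * (L q x0 * L q x0 * L q x0 * L q x0 * (L q x0 * L q x0 * L q x0 * L q x0)))%R).
  assert (HK : (0 <= K)%R).
  { unfold K, U, L. mul_pos; try apply pow_le; left; apply exp_pos. }
  set (A := (M1 * M2 * (L q (Cmod q) * L q (Cmod q)))%R).
  assert (HA : (0 <= A)%R) by (unfold A; mul_pos; assumption).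
  exists (Series (fun j => A * (K / Cmod p ^ 4) * Cmod (q ^ 2 / Q) ^ S j))%R.
  intros P N HP.
  assert (HS : ex_series (fun j => A * (K / Cmod p ^ 4) * Cmod (q ^ 2 / Q) ^ S j)%R).
  { apply (ex_series_scal_l _ (fun n => Cmod (q ^ 2 / Q) ^ S n)%R).
    apply (ex_series_incr_1 (fun n => Cmod (q ^ 2 / Q) ^ n)%R).
    apply ex_series_geom. rewrite Rabs_pos_eq; [exact Hq2Q|apply Cmod_ge_0]. }
  rewrite <- Series_scal_r.
  assert (H4 : (0 <= Cmod (1 - P) ^ 4)%R) by apply pow_le, Cmod_ge_0.
  apply bsum_le_Series.
  - intros j Hj.
    replace (P * q ^ (N - S j) / q ^ N) with (P / q ^ S j).
    2:{ replace N with (N - S j + S j)%nat at 2 by lia. rewrite (Cpow_add_r q (N - S j)). field. auto. }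
    unfold kern_wt.
    replace (2 * N - (N - S j))%nat with (N + S j)%nat by lia.
    replace (Q ^ (N - S j) / Q ^ N) with (/ Q ^ S j).
    2:{ assert (HQn : forall n, Q ^ n <> 0) by (intros; apply Cpow_nz, HQ0).
        replace N with (N - S j + S j)%nat at 2 by lia. rewrite (Cpow_add_r Q (N - S j)). field. auto. }
    replace (/ Q ^ S j * (qpoch (q / Q) q (N - S j) * qpoch Q q (N + S j))
        / (qpoch q q (N - S j) * qpoch q q (N + S j)) * quot q p N (P / q ^ S j))
      with (qpoch (q / Q) q (N - S j) * qpoch Q q (N + S j)
        * (/ qpoch q q (N - S j) * / qpoch q q (N + S j)) * (quot q p N (P / q ^ S j) * / Q ^ S j)).
    2:{ assert (HQn : Q ^ S j <> 0) by (apply Cpow_nz, HQ0).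
        generalize dependent (Q ^ S j). generalize (quot q p N (P / q ^ S j)).
        intros; field; repeat split; auto. }
    rewrite Cmod_mult.
    replace (A * (K / Cmod p ^ 4) * Cmod (q ^ 2 / Q) ^ S j * Cmod (1 - P) ^ 4)%R
      with (A * (Cmod (q ^ 2) ^ S j * ((Cmod (1 - P) / Cmod p) ^ 4 * K) * / Cmod Q ^ S j))%R.
    2:{ rewrite Cmod_div by exact HQ0. unfold Rdiv.
        rewrite !Rpow_mult_distr, !pow_inv. ring. }
    apply Rmult_le_compat; try apply Cmod_ge_0.
    + unfold A. rewrite !Cmod_mult.
      mul_compat; mul_pos; try apply Cmod_ge_0; auto;
      apply (qpoch_lower q Hq); lra.
    + rewrite Cmod_mult, Cmod_inv, Cmod_pow by (apply Cpow_nz, HQ0).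
      apply Rmult_le_compat_r; [left; apply Rinv_0_lt_compat, pow_lt, Cmod_gt_0, HQ0|].
      apply quot_negative; [exact HP|lia].
  - intros j. mul_pos; try assumption; try (apply pow_le, Cmod_ge_0).
    apply Rdiv_le_0_compat; [exact HK|apply pow_lt; lra].
  - apply ex_series_scal_r, HS.
Qed.

Lemma connection_series_mod4 :
  exists M, forall P, near1 P ->
    (Cmod (Csum (fun j => theta_unit * (quot_inf (P * q ^ j) * Q ^ j))%C
           - Csum (fun n => sum4 (fun k =>
            (kap k * theta_ratio k P) * (phi_coef k n * (q ^ 2 / Q) ^ n)))%C)
     <= M * Cmod (1 - P) ^ 4)%R.
Proof.
  destruct negative_side_bound as [M HM]. exists M. intros P HP.
  destruct (near1_bounds P HP) as [B1 [B2 [B3 [B4 B5]]]].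
  eapply Cconv_le; [apply Cconv_minus; [apply near_side_conv, HP|apply far_side_conv, HP]|].
  intros N. cbv beta. rewrite <- (finite_connection q p Hq Hp P Q N HQ0) by lra.
  rewrite bsum_center.
  match goal with |- (Cmod (?a - (?a + ?b)) <= _)%R =>
    replace (a - (a + b)) with (- b) by ring end.
  rewrite Cmod_opp. apply HM, HP.
Qed.

End FixedQ.
End Limit.

(** * Complex derivatives *)

Notation Cder := (is_derive (K := C_AbsRing) (V := C_NormedModule)).
Notation Cdiffable := (ex_derive (K := C_AbsRing) (V := C_NormedModule)).

(** The two normed-module structures on the complex numbers have the same norm
   but different balls; derivatives only see the norm. *)
Lemma Cder_AbsRing (f : C -> C) (z l : C) :
  Cder f z l <-> is_derive (K := C_AbsRing) (V := AbsRing_NormedModule C_AbsRing) f z l.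
Proof. split; intros [_ H]; (split; [apply is_linear_scal_l|exact H]). Qed.

Lemma Cder_mult (f g : C -> C) (z a b : C) :
  Cder f z a -> Cder g z b -> Cder (fun t => f t * g t) z (a * g z + f z * b).
Proof.
  intros H1 H2. apply Cder_AbsRing in H1. apply Cder_AbsRing in H2. apply Cder_AbsRing.
  exact (is_derive_mult (K := C_AbsRing) f g z a b H1 H2 Cmult_comm).
Qed.

Lemma Cder_plus (f g : C -> C) (z a b : C) :
  Cder f z a -> Cder g z b -> Cder (fun t => f t + g t) z (a + b).
Proof. intros H1 H2. exact (is_derive_plus (K := C_AbsRing) f g z a b H1 H2). Qed.

Lemma Cder_comp (f g : C -> C) (z a b : C) :
  Cder g z b -> Cder f (g z) a -> Cder (fun t => f (g t)) z (b * a).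
Proof.
  intros H1 H2. apply Cder_AbsRing in H1.
  exact (is_derive_comp (K := C_AbsRing) (V := C_NormedModule) f g z a b H2 H1).
Qed.

Lemma Cder_const (c z : C) : Cder (fun _ => c) z (RtoC 0).
Proof. exact (is_derive_const (K := C_AbsRing) (V := C_NormedModule) c z). Qed.

Lemma Cder_id (z : C) : Cder (fun t => t) z (RtoC 1).
Proof. apply Cder_AbsRing. exact (is_derive_id (K := C_AbsRing) z). Qed.

Lemma Cder_scal (c : C) (f : C -> C) (z a : C) :
  Cder f z a -> Cder (fun t => c * f t) z (c * a).
Proof.
  intros H. replace (c * a) with (0 * f z + c * a) by ring.
  apply (Cder_mult (fun _ => c)); [apply Cder_const|exact H].
Qed.

Lemma Cder_inv (z : C) : z <> 0 -> Cder (fun t => / t) z (- / z ^ 2).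
Proof.
  intros Hz. assert (Hm : (0 < Cmod z)%R) by (apply Cmod_gt_0, Hz).
  apply is_derive_quadratic with (2 / Cmod z ^ 3)%R (Cmod z / 2)%R; [lra|].
  intros h Hh.
  assert (Hzh : (Cmod z / 2 <= Cmod (z + h))%R).
  { pose proof (Cmod_triangle (z + h) (- h)) as T. replace (z + h + - h) with z in T by ring.
    rewrite Cmod_opp in T. lra. }
  assert (Hzh0 : z + h <> 0) by (apply Cmod_gt_0; lra).
  replace (/ (z + h) - / z - h * - / z ^ 2) with (h ^ 2 / (z ^ 2 * (z + h)))
    by (field; auto).
  rewrite Cmod_div, Cmod_mult, !Cmod_pow by (apply Cmult_neq_0; [apply Cpow_nz|]; assumption).
  unfold Rdiv. rewrite (Rmult_comm (Cmod h ^ 2)).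
  apply Rmult_le_compat_r; [apply pow_le, Cmod_ge_0|].
  replace (2 * / Cmod z ^ 3)%R with (/ (Cmod z ^ 2 * (Cmod z / 2)))%R by (field; lra).
  apply Rinv_le_contravar.
  - apply Rmult_lt_0_compat; [apply pow_lt; exact Hm|lra].
  - apply Rmult_le_compat_l; [apply pow_le; lra|exact Hzh].
Qed.

Lemma Cder_ext_loc (f g : C -> C) (z l : C) (r : R) :
  (0 < r)%R -> (forall w, (Cmod (w - z) < r)%R -> f w = g w) -> Cder f z l -> Cder g z l.
Proof.
  intros Hr E H. eapply is_derive_ext_loc; [|exact H].
  exists (mkposreal _ Hr). intros w Hw. apply E. exact Hw.
Qed.

(** * Punctured neighbourhoods and meromorphy *)

(** Statements between meromorphic functions hold on punctured discs. *)
Definition pnear (z0 : C) (A : C -> Prop) : Prop :=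
  exists r : R, (0 < r)%R /\ forall z, (0 < Cmod (z - z0) < r)%R -> A z.

Definition holo_at (z0 : C) (f : C -> C) : Prop :=
  exists r : R, (0 < r)%R /\ holomorphic_disc z0 r f.

Lemma pnear_mono (z0 : C) (A B : C -> Prop) :
  (forall z, A z -> B z) -> pnear z0 A -> pnear z0 B.
Proof. intros H [r [Hr HA]]. exists r; split; [exact Hr|]. intros z Hz. apply H, HA, Hz. Qed.

Lemma pnear_and (z0 : C) (A B : C -> Prop) :
  pnear z0 A -> pnear z0 B -> pnear z0 (fun z => A z /\ B z).
Proof.
  intros [r1 [H1 HA]] [r2 [H2 HB]]. exists (Rmin r1 r2).
  split; [apply Rmin_glb_lt; assumption|]. intros z Hz.
  pose proof (Rmin_l r1 r2); pose proof (Rmin_r r1 r2).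
  split; [apply HA|apply HB]; lra.
Qed.

Lemma pnear_lt (z0 : C) (r : R) : (0 < r)%R -> pnear z0 (fun z => (Cmod (z - z0) < r)%R).
Proof. intros Hr. exists r; split; [exact Hr|]. intros z Hz; lra. Qed.

Lemma Cmod_close (z z0 : C) :
  (Cmod z <= Cmod z0 + Cmod (z - z0) /\ Cmod z0 - Cmod (z - z0) <= Cmod z)%R.
Proof.
  split.
  - replace z with (z0 + (z - z0)) at 1 by ring. apply Cmod_triangle.
  - pose proof (Cmod_triangle z (- (z - z0))) as T. replace (z + - (z - z0)) with z0 in T by ring.
    rewrite Cmod_opp in T. lra.
Qed.

Lemma pnear_neq0 (z0 : C) : z0 <> 0 -> pnear z0 (fun z => z <> 0).
Proof.
  intros Hz. apply (pnear_mono z0 (fun z => (Cmod (z - z0) < Cmod z0)%R)).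
  - intros z H. apply Cmod_gt_0. pose proof (Cmod_close z z0). lra.
  - apply pnear_lt, Cmod_gt_0, Hz.
Qed.

Lemma pnear_scal (A : C -> Prop) (c z0 : C) :
  c <> 0 -> pnear (c * z0) A -> pnear z0 (fun z => A (c * z)).
Proof.
  intros Hc [r [Hr HA]]. assert (Hm : (0 < Cmod c)%R) by (apply Cmod_gt_0, Hc).
  exists (r / Cmod c)%R; split; [apply Rdiv_lt_0_compat; assumption|]. intros z Hz. apply HA.
  replace (c * z - c * z0) with ((z - z0) * c) by ring. rewrite Cmod_mult.
  split; [apply Rmult_lt_0_compat; lra|]. apply Rlt_div_r; lra.
Qed.

Lemma pnear_inv (A : C -> Prop) (c z0 : C) :
  c <> 0 -> z0 <> 0 -> pnear (c / z0) A -> pnear z0 (fun z => A (c / z)).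
Proof.
  intros Hc Hz0 [r [Hr HA]].
  assert (Hm : (0 < Cmod c)%R) by (apply Cmod_gt_0, Hc).
  assert (Hm0 : (0 < Cmod z0)%R) by (apply Cmod_gt_0, Hz0).
  assert (Hmm : (0 < Cmod z0 * Cmod z0)%R) by (apply Rmult_lt_0_compat; assumption).
  set (d := (r / Cmod c * (Cmod z0 * Cmod z0 / 2))%R).
  assert (Hrc : (0 < r / Cmod c)%R) by (apply Rdiv_lt_0_compat; assumption).
  assert (Hd : (0 < d)%R) by (apply Rmult_lt_0_compat; lra).
  exists (Rmin d (Cmod z0 / 2)); split; [apply Rmin_glb_lt; lra|].
  intros z Hz. pose proof (Rmin_l d (Cmod z0 / 2)); pose proof (Rmin_r d (Cmod z0 / 2)).
  pose proof (Cmod_close z z0).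
  assert (Hz' : z <> 0) by (apply Cmod_gt_0; lra).
  apply HA. replace (c / z - c / z0) with (- (c * (z - z0)) / (z * z0)) by (field; auto).
  assert (Hzz : z * z0 <> 0) by (apply Cmult_neq_0; assumption).
  rewrite Cmod_div, Cmod_opp, !Cmod_mult by exact Hzz.
  assert (Hlow : (Cmod z0 * Cmod z0 / 2 < Cmod z * Cmod z0)%R) by nra.
  split.
  - apply Rdiv_lt_0_compat; [apply Rmult_lt_0_compat; lra|lra].
  - apply Rlt_div_l; [lra|].
    apply Rlt_trans with (r * (Cmod z0 * Cmod z0 / 2))%R; [|apply Rmult_lt_compat_l; lra].
    replace (r * (Cmod z0 * Cmod z0 / 2))%R with (Cmod c * d)%R by (unfold d; field; lra).
    apply Rmult_lt_compat_l; lra.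
Qed.

Definition mero_at (z0 : C) (f : C -> C) : Prop :=
  exists (r : R) (g h : C -> C),
    (0 < r)%R /\ holomorphic_disc z0 r g /\ holomorphic_disc z0 r h /\
    forall z, (0 < Cmod (z - z0) < r)%R -> h z <> 0 /\ f z = g z / h z.

Lemma holo_at_mult (z0 : C) (f g : C -> C) :
  holo_at z0 f -> holo_at z0 g -> holo_at z0 (fun z => f z * g z).
Proof.
  intros [r1 [H1 F]] [r2 [H2 G]]. exists (Rmin r1 r2).
  split; [apply Rmin_glb_lt; assumption|]. intros z Hz.
  pose proof (Rmin_l r1 r2); pose proof (Rmin_r r1 r2).
  destruct (F z ltac:(lra)) as [a Ha]. destruct (G z ltac:(lra)) as [b Hb].
  eexists. apply (Cder_mult f g z a b Ha Hb).
Qed.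

Lemma holo_at_plus (z0 : C) (f g : C -> C) :
  holo_at z0 f -> holo_at z0 g -> holo_at z0 (fun z => f z + g z).
Proof.
  intros [r1 [H1 F]] [r2 [H2 G]]. exists (Rmin r1 r2).
  split; [apply Rmin_glb_lt; assumption|]. intros z Hz.
  pose proof (Rmin_l r1 r2); pose proof (Rmin_r r1 r2).
  destruct (F z ltac:(lra)) as [a Ha]. destruct (G z ltac:(lra)) as [b Hb].
  eexists. apply (Cder_plus f g z a b Ha Hb).
Qed.

Lemma holo_at_const (z0 c : C) : holo_at z0 (fun _ => c).
Proof. exists 1%R; split; [lra|]. intros z _. eexists; apply Cder_const. Qed.

Lemma mero_at_quot (z0 : C) (f g h : C -> C) :
  holo_at z0 g -> holo_at z0 h -> pnear z0 (fun z => h z <> 0 /\ f z = g z / h z) ->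
  mero_at z0 f.
Proof.
  intros [r1 [H1 G]] [r2 [H2 H]] [r3 [H3 E]].
  exists (Rmin (Rmin r1 r2) r3), g, h.
  pose proof (Rmin_l (Rmin r1 r2) r3); pose proof (Rmin_r (Rmin r1 r2) r3).
  pose proof (Rmin_l r1 r2); pose proof (Rmin_r r1 r2).
  split; [repeat apply Rmin_glb_lt; assumption|].
  split; [intros z Hz; apply G; lra|]. split; [intros z Hz; apply H; lra|].
  intros z Hz; apply E; lra.
Qed.

Lemma mero_at_inv (z0 : C) (f : C -> C) : mero_at z0 f ->
  exists g h, holo_at z0 g /\ holo_at z0 h /\ pnear z0 (fun z => h z <> 0 /\ f z = g z / h z).
Proof.
  intros [r [g [h [Hr [G [H E]]]]]]. exists g, h.
  split; [exists r; auto|]. split; [exists r; auto|]. exists r; auto.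
Qed.

Lemma holo_mero (z0 : C) (f : C -> C) : holo_at z0 f -> mero_at z0 f.
Proof.
  intros H. apply (mero_at_quot z0 f f (fun _ => 1)); [exact H|apply holo_at_const|].
  exists 1%R; split; [lra|]. intros z _. split; [apply C1_nz|]. field; apply C1_nz.
Qed.

Lemma mero_at_mult (z0 : C) (f f' : C -> C) :
  mero_at z0 f -> mero_at z0 f' -> mero_at z0 (fun z => f z * f' z).
Proof.
  intros H H'. destruct (mero_at_inv _ _ H) as [g [h [G [Hh E]]]].
  destruct (mero_at_inv _ _ H') as [g' [h' [G' [Hh' E']]]].
  apply (mero_at_quot z0 _ (fun z => g z * g' z) (fun z => h z * h' z));
    try (apply holo_at_mult; assumption).
  eapply pnear_mono; [|apply (pnear_and _ _ _ E E')].
  intros z [[N1 E1] [N2 E2]]. split; [apply Cmult_neq_0; assumption|].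
  rewrite E1, E2. field; auto.
Qed.

Lemma mero_at_plus (z0 : C) (f f' : C -> C) :
  mero_at z0 f -> mero_at z0 f' -> mero_at z0 (fun z => f z + f' z).
Proof.
  intros H H'. destruct (mero_at_inv _ _ H) as [g [h [G [Hh E]]]].
  destruct (mero_at_inv _ _ H') as [g' [h' [G' [Hh' E']]]].
  apply (mero_at_quot z0 _ (fun z => g z * h' z + g' z * h z) (fun z => h z * h' z));
    [apply holo_at_plus; apply holo_at_mult; assumption|apply holo_at_mult; assumption|].
  eapply pnear_mono; [|apply (pnear_and _ _ _ E E')].
  intros z [[N1 E1] [N2 E2]]. split; [apply Cmult_neq_0; assumption|].
  rewrite E1, E2. field; auto.
Qed.

Lemma mero_at_ext (z0 : C) (f f' : C -> C) :
  pnear z0 (fun z => f z = f' z) -> mero_at z0 f -> mero_at z0 f'.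
Proof.
  intros E H. destruct (mero_at_inv _ _ H) as [g [h [G [Hh E1]]]].
  apply (mero_at_quot z0 f' g h G Hh).
  eapply pnear_mono; [|apply (pnear_and _ _ _ E E1)].
  intros z [Ez [N E2]]. split; [exact N|]. rewrite <- Ez; exact E2.
Qed.

(** Meromorphy only concerns punctured neighbourhoods, so it is enough to know
    it for one side of an equality. *)
Lemma mero_eq_of_holo (D : C -> Prop) (f g : C -> C) :
  (forall z0, D z0 -> mero_at z0 f) -> (forall z0, D z0 -> pnear z0 (fun z => f z = g z)) ->
  mero_eq D f g.
Proof.
  intros Hf E. split; [exact Hf|]. split; [|exact E].
  intros z0 Hz0. apply (mero_at_ext z0 f g); [apply E|apply Hf]; exact Hz0.
Qed.

Lemma mero_eq_0 (D : C -> Prop) (f : C -> C) :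
  (forall z0, D z0 -> pnear z0 (fun z => f z = 0)) -> mero_eq D f (fun _ => 0).
Proof.
  intros E.
  assert (M0 : forall z0 : C, mero_at z0 (fun _ => 0))
    by (intros z0; apply holo_mero, holo_at_const).
  split; [|split; [intros z0 _; apply M0|exact E]].
  intros z0 Hz0. apply (mero_at_ext z0 (fun _ => 0)); [|apply M0].
  apply (pnear_mono z0 (fun z => f z = 0)); [intros z H; symmetry; exact H|apply E, Hz0].
Qed.

(** * Theta functions *)

(** [n (n - 1) / 2]. *)
Fixpoint tri (n : nat) : nat := match n with O => O | S k => (tri k + k)%nat end.

Lemma tri_double n : (2 * Z.of_nat (tri n) = Z.of_nat n * (Z.of_nat n - 1))%Z.
Proof. induction n as [|n IH]; [reflexivity|]. cbn [tri]. lia. Qed.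

(** Bookkeeping of exponents in the two halves of the finite triple product. *)
Lemma tri_add m j : (tri (m + j) + tri (S m) = tri j + m * (m + j))%nat.
Proof.
  pose proof (tri_double (m + j)); pose proof (tri_double (S m)); pose proof (tri_double j). nia.
Qed.

Lemma tri_sub m j : (tri m + tri (S (m + j)) = tri (S j) + m * (m + j))%nat.
Proof.
  pose proof (tri_double m); pose proof (tri_double (S (m + j))); pose proof (tri_double (S j)). nia.
Qed.

Lemma Cpowz_nat z n : Cpowz z (Z.of_nat n) = z ^ n.
Proof.
  destruct n as [|n]; [reflexivity|].
  change (z ^ Pos.to_nat (Pos.of_succ_nat n) = z ^ S n).
  rewrite SuccNat2Pos.id_succ. reflexivity.
Qed.

Lemma Cpowz_neg z n : Cpowz z (- Z.of_nat (S n)) = / z ^ S n.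
Proof.
  change (/ z ^ Pos.to_nat (Pos.of_succ_nat n) = / z ^ S n).
  rewrite SuccNat2Pos.id_succ. reflexivity.
Qed.

Section Theta.
Variable q : C.
Hypothesis Hq : (0 < Cmod q < 1)%R.

Let Hq0 : q <> 0 := q_neq0 q Hq.
Let Hqn : forall n, q ^ n <> 0 := qn_neq0 q Hq.

(** Theta is a power series in [z] plus a power series in [1/z], both entire. *)
Definition th_pos (n : nat) : C := q ^ tri n.
Definition th_neg (n : nat) : C := match n with O => 0 | S k => q ^ tri (S (S k)) end.

Lemma psconv_tri (R0 : R) : psconv th_pos R0.
Proof.
  intros s [Hs _].
  assert (H : ex_series (fun n => Rabs (Cmod q ^ tri n * (s + 1) ^ n))%R).
  { apply ex_series_DAlembert with 0%R; [lra| |].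
    - intros n. apply Rgt_not_eq, Rmult_lt_0_compat; apply pow_lt; lra.
    - apply is_lim_seq_ext with (fun n => Cmod q ^ n * (s + 1))%R.
      + intros n. rewrite Rabs_pos_eq.
        * cbn [tri]. rewrite pow_add. simpl. field.
          split; apply pow_nonzero; lra.
        * apply Rdiv_le_0_compat; [apply Rmult_le_pos; apply pow_le; lra|].
          apply Rmult_lt_0_compat; apply pow_lt; lra.
      + replace 0%R with (0 * (s + 1))%R by ring.
        apply (is_lim_seq_scal_r _ (s + 1) 0). apply is_lim_seq_geom.
        rewrite Rabs_pos_eq; lra. }
  eapply (ex_series_le (fun n => Cmod (th_pos n) * s ^ n)%R); [|exact H].
  intros n. unfold norm; simpl; unfold abs; simpl. unfold th_pos. rewrite Cmod_pow.
  rewrite !Rabs_mult, (Rabs_pos_eq (s ^ n)), (Rabs_pos_eq ((s + 1) ^ n)) by (apply pow_le; lra).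
  apply Rmult_le_compat_l; [apply Rabs_pos|]. apply pow_incr; lra.
Qed.

Lemma psconv_th_neg (R0 : R) : psconv th_neg R0.
Proof.
  intros s Hs.
  assert (H : ex_series (fun n => s * (Cmod (th_pos n) * s ^ n))%R).
  { apply (ex_series_scal_l s (fun n => Cmod (th_pos n) * s ^ n)%R). apply (psconv_tri R0 s Hs). }
  apply ex_series_incr_1. 
  eapply (ex_series_le (fun n => Cmod (th_neg (S n)) * s ^ S n)%R); [|exact H].
  intros n. unfold norm; simpl; unfold abs; simpl. unfold th_pos. rewrite !Cmod_pow.
  rewrite Rabs_pos_eq by (apply Rmult_le_pos; [apply pow_le; lra|apply Rmult_le_pos; [|apply pow_le]; lra]).
  replace (s * (Cmod q ^ tri n * s ^ n))%R with (Cmod q ^ tri n * (s * s ^ n))%R by ring.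
  apply Rmult_le_compat_r; [apply Rmult_le_pos; [|apply pow_le]; lra|].
  replace (tri n + n + S n)%nat with ((n + S n) + tri n)%nat by lia. rewrite pow_add.
  rewrite <- (Rmult_1_l (Cmod q ^ tri n)) at 2. apply Rmult_le_compat_r; [apply pow_le; lra|].
  rewrite <- (pow1 (n + S n)). apply pow_incr; lra.
Qed.

Lemma theta_pser (z : C) : z <> 0 -> theta q z = pser th_pos z + pser th_neg (/ z).
Proof.
  intros Hz. unfold theta, CsumZ. f_equal.
  - apply Csum_ext. intros n.
    replace (Z.of_nat n * (Z.of_nat n - 1) / 2)%Z with (Z.of_nat (tri n)).
    + rewrite !Cpowz_nat. reflexivity.
    + rewrite <- tri_double, Z.mul_comm, Z.div_mul by lia. reflexivity.
  - unfold pser. rewrite (Csum_shift0 (fun n => th_neg n * (/ z) ^ n)).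
    + apply Csum_ext. intros n.
      replace (- Z.of_nat (S n) * (- Z.of_nat (S n) - 1) / 2)%Z with (Z.of_nat (tri (S (S n)))).
      * rewrite Cpowz_nat, Cpowz_neg, Cpow_inv by exact Hz. reflexivity.
      * replace (- Z.of_nat (S n) * (- Z.of_nat (S n) - 1))%Z
          with (2 * Z.of_nat (tri (S (S n))))%Z by (rewrite tri_double; lia).
        rewrite Z.mul_comm, Z.div_mul by lia. reflexivity.
    + simpl; ring.
    + apply (psconv_Summable _ (Cmod (/ z) + 1)); [apply psconv_th_neg|lra].
Qed.

(** ** The Jacobi triple product *)

(** The coefficient of [y^n] in [(y; q)_M], by the recursion that multiplication
    by the last factor gives; it vanishes for [n > M] without case distinction. *)
Fixpoint poch_coef (M n : nat) : C :=
  match M, n with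
  | O, O => 1
  | O, S _ => 0
  | S M', O => 1
  | S M', S n' => poch_coef M' (S n') - q ^ M' * poch_coef M' n'
  end.

Lemma poch_coef_0 M n : (M < n)%nat -> poch_coef M n = 0.
Proof.
  revert n; induction M as [|M IH]; intros [|n] H; try lia; [reflexivity|].
  simpl. rewrite !IH by lia. ring.
Qed.

Lemma poch_coef_head M : poch_coef M 0 = 1.
Proof. destruct M; reflexivity. Qed.

Lemma qpoch_expand M y : qpoch y q M = bsum (fun n => poch_coef M n * y ^ n) (S M).
Proof.
  induction M as [|M IH]; [simpl; ring|].
  rewrite bsum_shift, poch_coef_head.
  rewrite (bsum_ext _ (fun n => poch_coef M (S n) * y ^ S n
                               + (- q ^ M * y) * (poch_coef M n * y ^ n)))
    by (intros; simpl; ring).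
  rewrite bsum_plus, bsum_scal, <- IH.
  assert (E : qpoch y q M = 1 + bsum (fun i => poch_coef M (S i) * y ^ S i) (S M)).
  { rewrite IH, bsum_shift, poch_coef_head.
    change (bsum (fun i => poch_coef M (S i) * y ^ S i) (S M))
      with (bsum (fun i => poch_coef M (S i) * y ^ S i) M + poch_coef M (S M) * y ^ S M).
    rewrite (poch_coef_0 M (S M)) by lia. simpl. ring. }
  simpl qpoch. rewrite E at 1. rewrite E. simpl. ring.
Qed.

(** The Gaussian binomial theorem, with the coefficients in closed form. *)
Lemma poch_coef_closed M : forall n, (n <= M)%nat ->
  poch_coef M n * (qpoch q q n * qpoch q q (M - n)) = (- (1)) ^ n * q ^ tri n * qpoch q q M.
Proof.
  induction M as [|M IH]; intros n Hn.
  - assert (n = O) as -> by lia. simpl. ring.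
  - destruct n as [|n].
    + rewrite poch_coef_head. simpl. ring.
    + pose proof (IH n ltac:(lia)) as I1.
      cbn [poch_coef tri]. rewrite Cpow_add_r.
      replace (S M - S n)%nat with (M - n)%nat by lia.
      destruct (Nat.eq_dec n M) as [->|Hne].
      * rewrite poch_coef_0 by lia. replace (M - M)%nat with O in * by lia.
        transitivity (- q ^ M * (poch_coef M M * (qpoch q q M * qpoch q q 0)) * (1 - q * q ^ M));
          [simpl; ring|].
        rewrite I1. simpl. ring.
      * pose proof (IH (S n) ltac:(lia)) as I2. cbn [tri] in I2. rewrite Cpow_add_r in I2.
        replace (M - n)%nat with (S (M - S n)) in * by lia.
        set (d := (M - S n)%nat) in *.
        transitivity (poch_coef M (S n) * (qpoch q q (S n) * qpoch q q d) * (1 - q * q ^ d)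
          - q ^ M * (1 - q * q ^ n) * (poch_coef M n * (qpoch q q n * qpoch q q (S d))));
          [simpl; ring|].
        rewrite I1, I2. replace (q ^ M) with (q * q ^ d * q ^ n).
        2:{ rewrite <- Cpow_S, <- Cpow_add_r. f_equal. unfold d; lia. }
        replace (qpoch q q (S M)) with (qpoch q q M * (1 - q * (q * q ^ d * q ^ n))).
        2:{ simpl. do 3 f_equal. rewrite <- Cpow_S, <- Cpow_add_r. f_equal. unfold d; lia. }
        simpl. ring.
Qed.

Lemma refl_factor_tri n : refl_factor q n * q ^ tri (S n) = (- (1)) ^ n.
Proof.
  induction n as [|n IH]; [simpl; ring|].
  replace (tri (S (S n))) with (tri (S n) + S n)%nat by (simpl; lia). rewrite Cpow_add_r.
  cbn [refl_factor].
  transitivity (refl_factor q n * q ^ tri (S n) * (- / q ^ S n * q ^ S n)); [ring|].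
  rewrite IH. replace (- / q ^ S n * q ^ S n) with (- (1)).
  - simpl. ring.
  - rewrite <- (Cinv_l (q ^ S n)) by apply Hqn. ring.
Qed.

Definition jac_pos (x : C) (N j : nat) : C :=
  (- (1)) ^ j * q ^ tri j * x ^ j
  * (qpoch q q (2 * N) * (/ qpoch q q (N + j) * / qpoch q q (N - j))).

Definition jac_neg (x : C) (N j : nat) : C :=
  (- (1)) ^ S j * q ^ tri (S (S j)) * (/ x) ^ S j
  * (qpoch q q (2 * N) * (/ qpoch q q (N - S j) * / qpoch q q (N + S j))).

Lemma sign_sq n : (- (1)) ^ n * (- (1)) ^ n = 1.
Proof.
  rewrite <- Cpow_mult_l. replace (- (1) * - (1)) with (RtoC 1) by ring. apply Cpow_1_l.
Qed.

Lemma inv_refl_factor n : / refl_factor q n = (- (1)) ^ n * q ^ tri (S n).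
Proof.
  pose proof (refl_factor_neq0 q Hq n) as Hrf.
  transitivity (/ refl_factor q n * ((- (1)) ^ n * (- (1)) ^ n)); [rewrite sign_sq; ring|].
  replace ((- (1)) ^ n * (- (1)) ^ n) with (refl_factor q n * q ^ tri (S n) * (- (1)) ^ n)
    by (rewrite refl_factor_tri; reflexivity).
  field. exact Hrf.
Qed.

(** Gauss's finite triple product: expand [(x q^-N; q)_(2N)] and reflect its first
    [N] factors. *)
Lemma jacobi_finite (x : C) (N : nat) : x <> 0 ->
  qpoch x q N * qpoch (q / x) q N = bsum (jac_pos x N) (S N) + bsum (jac_neg x N) N.
Proof.
  intros Hx.
  assert (Hqq : forall n, qpoch q q n <> 0) by (intros m; apply qpoch_neq0_small; [exact Hq|lra]).
  assert (Hxn : forall n, x ^ n <> 0) by (intros; apply Cpow_nz, Hx).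
  pose proof (refl_factor_neq0 q Hq N) as Hrf.
  assert (E : qpoch x q N * qpoch (q / x) q N
     = / (refl_factor q N * x ^ N) * qpoch (x / q ^ N) q (2 * N)).
  { rewrite (qpoch_reflect q Hq x N (2 * N)) by (auto; lia).
    replace (2 * N - N)%nat with N by lia. field. auto. }
  rewrite E, qpoch_expand, <- bsum_scal, bsum_center. f_equal.
  - apply bsum_ext. intros j Hj. unfold jac_pos.
    assert (Ec : poch_coef (2 * N) (N + j) = (- (1)) ^ (N + j) * q ^ tri (N + j) * qpoch q q (2 * N)
                   * (/ qpoch q q (N + j) * / qpoch q q (N - j))).
    { rewrite <- poch_coef_closed by lia. replace (2 * N - (N + j))%nat with (N - j)%nat by lia.
      field. auto. }
    rewrite Ec. unfold Cdiv. rewrite (Cpow_mult_l x), Cpow_inv, <- Cpow_mult_r by apply Hqn.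
    rewrite !(Cpow_add_r _ N j).
    assert (Et : q ^ tri (N + j) * q ^ tri (S N) = q ^ tri j * q ^ (N * (N + j))).
    { rewrite <- !Cpow_add_r. f_equal. apply tri_add. }
    transitivity ((/ refl_factor q N) * / x ^ N * ((- (1)) ^ N * (- (1)) ^ j * q ^ tri (N + j) * qpoch q q (2 * N) *
       (/ qpoch q q (N + j) * / qpoch q q (N - j)) * (x ^ N * x ^ j * / q ^ (N * (N + j))))).
    { field. repeat split; auto. }
    rewrite inv_refl_factor.
    transitivity (((- (1)) ^ N * (- (1)) ^ N) * (q ^ tri (N + j) * q ^ tri (S N)) * / q ^ (N * (N + j))
      * (- (1)) ^ j * x ^ j * (qpoch q q (2 * N) * (/ qpoch q q (N + j) * / qpoch q q (N - j)))).
    { field. repeat split; auto. }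
    rewrite sign_sq, Et. field. repeat split; auto.
  - apply bsum_ext. intros j Hj. unfold jac_neg. set (k := S j).
    replace (N - S j)%nat with (N - k)%nat by reflexivity.
    assert (Hk : exists m, N = (m + k)%nat) by (exists (N - k)%nat; unfold k; lia).
    destruct Hk as [m Hm].
    replace (N - k)%nat with m by lia.
    assert (Ec : poch_coef (2 * N) m = (- (1)) ^ m * q ^ tri m * qpoch q q (2 * N)
                   * (/ qpoch q q m * / qpoch q q (N + k))).
    { rewrite <- poch_coef_closed by lia. replace (2 * N - m)%nat with (N + k)%nat by lia.
      field. auto. }
    rewrite Ec. unfold Cdiv. rewrite (Cpow_mult_l x), !Cpow_inv, <- Cpow_mult_r by auto.
    assert (Et : q ^ tri m * q ^ tri (S N) = q ^ tri (S k) * q ^ (N * m)).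
    { rewrite <- !Cpow_add_r. f_equal. rewrite Hm, tri_sub. lia. }
    transitivity ((/ refl_factor q N) * / x ^ N * ((- (1)) ^ m * q ^ tri m * qpoch q q (2 * N) *
       (/ qpoch q q m * / qpoch q q (N + k)) * (x ^ m * / q ^ (N * m)))).
    { field. repeat split; auto. }
    rewrite inv_refl_factor.
    replace (x ^ N) with (x ^ m * x ^ k) by (rewrite Hm, Cpow_add_r; reflexivity).
    replace ((- (1)) ^ N) with ((- (1)) ^ m * (- (1)) ^ k) by (rewrite Hm, Cpow_add_r; reflexivity).
    transitivity (((- (1)) ^ m * (- (1)) ^ m) * (q ^ tri m * q ^ tri (S N)) * / q ^ (N * m)
      * (- (1)) ^ k * / x ^ k * (qpoch q q (2 * N) * (/ qpoch q q m * / qpoch q q (N + k)))).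
    { field. repeat split; auto. }
    rewrite sign_sq, Et. field. repeat split; auto.
Qed.

Lemma jacobi_triple (x : C) : x <> 0 ->
  theta q (- x) = qpoch_inf q q * (qpoch_inf x q * qpoch_inf (q / x) q).
Proof.
  intros Hx.
  assert (Hqq : forall n, qpoch q q n <> 0) by (intros m; apply qpoch_neq0_small; [exact Hq|lra]).
  assert (Hqi : qpoch_inf q q <> 0) by (apply qpoch_inf_neq0_small; [exact Hq|lra]).
  assert (Hmx : - x <> 0).
  { intros E; apply Hx. replace x with (- - x) by ring. rewrite E; ring. }
  set (B := (U q (Cmod q) * (L q (Cmod q) * L q (Cmod q)))%R).
  assert (HB : forall N a b, (Cmod (qpoch q q (2 * N) * (/ qpoch q q a * / qpoch q q b)) <= B)%R).
  { intros N a b. rewrite !Cmod_mult. unfold B. mul_compat; mul_pos; try apply Cmod_ge_0;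
      [apply (qpoch_upper q Hq)|apply (qpoch_lower q Hq); lra|apply (qpoch_lower q Hq); lra]. }
  assert (HB0 : (0 <= B)%R) by (eapply Rle_trans; [apply Cmod_ge_0|apply (HB 0 0 0)%nat]).
  assert (S1 : forall j, Cconv (fun N => qpoch q q (N + j)) (qpoch_inf q q)).
  { intros j. apply (Cconv_subseq (qpoch q q) _ (fun N => (N + j)%nat)); [lia|apply qpoch_inf_conv, Hq]. }
  assert (S2 : Cconv (fun N => qpoch q q (2 * N)) (qpoch_inf q q)).
  { apply (Cconv_subseq (qpoch q q) _ (fun N => (2 * N)%nat)); [lia|apply qpoch_inf_conv, Hq]. }
  assert (S3 : forall j, Cconv (fun N => qpoch q q (N - j)) (qpoch_inf q q)).
  { intros j. apply Cconv_shift_minus, qpoch_inf_conv, Hq. }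
  assert (Hmod1 : forall j, Cmod ((- (1)) ^ j) = 1%R).
  { intros j. rewrite Cmod_pow, Cmod_m1, pow1. reflexivity. }
  assert (T1 : Cconv (fun N => bsum (jac_pos x N) (S N))
     (Csum (fun j => / qpoch_inf q q * (th_pos j * (- x) ^ j)))).
  { apply (tannery (jac_pos x) _ (fun j => Cmod (th_pos j * x ^ j) * B)%R S).
    - auto.
    - intros N j _. unfold jac_pos. rewrite Cmod_mult.
      apply Rmult_le_compat; try apply Cmod_ge_0; [|apply HB].
      rewrite !Cmod_mult, Hmod1. unfold th_pos. lra.
    - intros j. apply Rmult_le_pos; [apply Cmod_ge_0|exact HB0].
    - apply ex_series_scal_r. apply (psconv_Summable _ (Cmod x + 1)); [apply psconv_tri|lra].
    - intros j. unfold jac_pos.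
      replace (/ qpoch_inf q q * (th_pos j * (- x) ^ j))
        with ((- (1)) ^ j * q ^ tri j * x ^ j
              * (qpoch_inf q q * (/ qpoch_inf q q * / qpoch_inf q q))).
      + apply Cconv_scal. apply Cconv_mult; [exact S2|].
        apply Cconv_mult; apply Cconv_inv; auto.
      + replace (- x) with (- (1) * x) by ring. rewrite Cpow_mult_l. unfold th_pos.
        field. exact Hqi. }
  assert (HSn : Summable (fun n => th_neg n * (/ x) ^ n))
    by (apply (psconv_Summable _ (Cmod (/ x) + 1)); [apply psconv_th_neg|lra]).
  assert (HSn' : Summable (fun n => th_neg n * (/ - x) ^ n))
    by (apply (psconv_Summable _ (Cmod (/ - x) + 1)); [apply psconv_th_neg|lra]).
  assert (T2 : Cconv (fun N => bsum (jac_neg x N) N)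
     (Csum (fun j => / qpoch_inf q q * (th_neg (S j) * (/ - x) ^ S j)))).
  { apply (tannery (jac_neg x) _ (fun j => Cmod (th_neg (S j) * (/ x) ^ S j) * B)%R (fun N => N)).
    - auto.
    - intros N j _. unfold jac_neg. rewrite Cmod_mult.
      apply Rmult_le_compat; try apply Cmod_ge_0; [|apply HB].
      rewrite !Cmod_mult, Hmod1. unfold th_neg. lra.
    - intros j. apply Rmult_le_pos; [apply Cmod_ge_0|exact HB0].
    - apply ex_series_scal_r.
      apply (ex_series_incr_1 (fun n => Cmod (th_neg n * (/ x) ^ n))). exact HSn.
    - intros j. unfold jac_neg.
      replace (/ qpoch_inf q q * (th_neg (S j) * (/ - x) ^ S j))
        with ((- (1)) ^ S j * q ^ tri (S (S j)) * (/ x) ^ S j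
              * (qpoch_inf q q * (/ qpoch_inf q q * / qpoch_inf q q))).
      + apply Cconv_scal. apply Cconv_mult; [exact S2|].
        apply Cconv_mult; apply Cconv_inv; auto.
      + replace (/ - x) with (- (1) * / x) by (field; auto). rewrite (Cpow_mult_l _ (/ x)).
        unfold th_neg. field. auto. }
  assert (T3 : Cconv (fun N => qpoch x q N * qpoch (q / x) q N)
     (qpoch_inf x q * qpoch_inf (q / x) q))
    by (apply Cconv_mult; apply qpoch_inf_conv, Hq).
  pose proof (Cconv_plus _ _ _ _ T1 T2) as T12.
  assert (E : qpoch_inf x q * qpoch_inf (q / x) q
     = Csum (fun j => / qpoch_inf q q * (th_pos j * (- x) ^ j))
       + Csum (fun j => / qpoch_inf q q * (th_neg (S j) * (/ - x) ^ S j))).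
  { eapply Cconv_unique; [exact T3|]. eapply Cconv_ext; [|exact T12].
    intros N. symmetry. apply jacobi_finite, Hx. }
  rewrite E, !Csum_scal.
  - rewrite theta_pser by exact Hmx. unfold pser.
    rewrite (Csum_shift0 (fun n => th_neg n * (/ - x) ^ n)); [|simpl; ring|exact HSn'].
    field. exact Hqi.
  - unfold Summable. 
    apply (ex_series_incr_1 (fun n => Cmod (th_neg n * (/ - x) ^ n))). exact HSn'.
  - apply (psconv_Summable _ (Cmod (- x) + 1)); [apply psconv_tri|lra].
Qed.

Lemma theta_prod (z : C) : z <> 0 ->
  theta q z = qpoch_inf q q * (qpoch_inf (- z) q * qpoch_inf (- (q / z)) q).
Proof.
  intros Hz.
  assert (Hmz : - z <> 0) by (intros E; apply Hz; replace z with (- - z) by ring; rewrite E; ring).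
  replace z with (- - z) at 1 by ring. rewrite jacobi_triple by exact Hmz.
  do 3 f_equal. field. auto.
Qed.

Lemma theta_shift (z : C) : z <> 0 -> theta q (q * z) = theta q z / z.
Proof.
  intros Hz. rewrite !theta_prod by (try apply Cmult_neq_0; assumption).
  rewrite (qpoch_inf_S_l q Hq (- z)).
  replace (- (q / (q * z))) with (- / z) by (field; auto).
  rewrite (qpoch_inf_S_l q Hq (- / z)).
  replace (- (q * z)) with (- z * q) by ring. replace (- / z * q) with (- (q / z)) by (field; auto).
  field. exact Hz.
Qed.

(** Zeros are easier to locate on the product than on the series. *)
Lemma theta_isolated (z0 : C) : z0 <> 0 -> pnear z0 (fun z => theta q z <> 0).
Proof.
  intros Hz0.
  apply (pnear_mono z0 (fun z => (z <> 0 /\ qpoch_inf (- q / z) q <> 0) /\ qpoch_inf (- (1) * z) q <> 0)).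
  - intros z [[Hz H1] H2]. rewrite theta_prod by exact Hz.
    repeat apply Cmult_neq_0.
    + apply qpoch_inf_neq0_small; [exact Hq|lra].
    + replace (- z) with (- (1) * z) by ring. exact H2.
    + replace (- (q / z)) with (- q / z) by (field; exact Hz). exact H1.
  - apply pnear_and; [apply pnear_and|].
    + apply pnear_neq0, Hz0.
    + apply (pnear_inv (fun w => qpoch_inf w q <> 0)); [|exact Hz0|apply qpoch_inf_isolated, Hq].
      intros E. apply Hq0. replace q with (- - q) by ring. rewrite E; ring.
    + apply (pnear_scal (fun w => qpoch_inf w q <> 0)); [|apply qpoch_inf_isolated, Hq].
      intros E. apply C1_nz. replace (RtoC 1) with (- (- (1))) by ring. rewrite E; ring.
Qed.

(** ** Derivatives of theta *)

Definition dtheta (z : C) : C :=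
  pser (pderiv th_pos) z + - / z ^ 2 * pser (pderiv th_neg) (/ z).

Lemma theta_Cder (z : C) : z <> 0 -> Cder (theta q) z (dtheta z).
Proof.
  intros Hz. assert (Hm : (0 < Cmod z)%R) by (apply Cmod_gt_0, Hz).
  apply (Cder_ext_loc (fun t => pser th_pos t + pser th_neg (/ t)) (theta q) z (dtheta z) (Cmod z)).
  - exact Hm.
  - intros w Hw. symmetry. apply theta_pser. intros E. rewrite E in Hw.
    replace (0 - z) with (- z) in Hw by ring. rewrite Cmod_opp in Hw. lra.
  - apply Cder_plus.
    + apply (pser_is_derive _ (Cmod z + 1)); [apply psconv_tri|lra].
    + apply (Cder_comp (pser th_neg) (fun t => / t)); [apply Cder_inv, Hz|].
      apply (pser_is_derive _ (Cmod (/ z) + 1)); [apply psconv_th_neg|lra].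
Qed.

Lemma dtheta_diffable (z : C) : z <> 0 -> Cdiffable dtheta z.
Proof.
  intros Hz. eexists. unfold dtheta. apply Cder_plus.
  - apply (pser_is_derive _ (Cmod z + 1)); [apply psconv_pderiv, psconv_tri|lra].
  - apply (Cder_mult (fun t => - / t ^ 2)).
    + apply (Cder_ext_loc (fun t => - (1) * (/ t * / t)) _ z _ (Cmod z)).
      * apply Cmod_gt_0, Hz.
      * intros w Hw. assert (w <> 0).
        { intros E. rewrite E in Hw. replace (0 - z) with (- z) in Hw by ring.
          rewrite Cmod_opp in Hw. lra. }
        field. assumption.
      * apply Cder_scal, Cder_mult; apply Cder_inv, Hz.
    + apply (Cder_comp (pser (pderiv th_neg)) (fun t => / t)); [apply Cder_inv, Hz|].
      apply (pser_is_derive _ (Cmod (/ z) + 1)); [apply psconv_pderiv, psconv_th_neg|lra].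
Qed.

Lemma C_derive_theta (z : C) : z <> 0 -> C_derive (theta q) z = dtheta z.
Proof. intros Hz. apply is_C_derive_unique, theta_Cder, Hz. Qed.

Lemma ell_shift (z : C) : z <> 0 -> theta q z <> 0 -> ell q (q * z) = ell q z + 1.
Proof.
  intros Hz Ht. assert (Hqz : q * z <> 0) by (apply Cmult_neq_0; assumption).
  unfold ell. rewrite !C_derive_theta by assumption.
  assert (Hm : (0 < Cmod z)%R) by (apply Cmod_gt_0, Hz).
  (* differentiate theta (q t) = theta t / t *)
  assert (D1 : Cder (fun t => theta q (q * t)) z (q * 1 * dtheta (q * z))).
  { apply (Cder_comp (theta q) (fun t => q * t)); [apply Cder_scal, Cder_id|apply theta_Cder, Hqz]. }
  assert (D2 : Cder (fun t => theta q t * / t) z (dtheta z * / z + theta q z * - / z ^ 2)).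
  { apply (Cder_mult (theta q)); [apply theta_Cder, Hz|apply Cder_inv, Hz]. }
  assert (D3 : Cder (fun t => theta q t * / t) z (q * 1 * dtheta (q * z))).
  { apply (Cder_ext_loc (fun t => theta q (q * t)) _ z _ (Cmod z)); [exact Hm| |exact D1].
    intros w Hw. apply theta_shift. intros E. rewrite E in Hw.
    replace (0 - z) with (- z) in Hw by ring. rewrite Cmod_opp in Hw. lra. }
  apply is_C_derive_unique in D2. apply is_C_derive_unique in D3. rewrite D2 in D3.
  assert (E : dtheta (q * z) = (dtheta z / z - theta q z / z ^ 2) / q).
  { replace (dtheta (q * z)) with (q * 1 * dtheta (q * z) / q) by (field; auto).
    rewrite <- D3. field. auto. }
  rewrite E, theta_shift by exact Hz. field. auto.
Qed.

End Theta.

(** * The q-difference equation *)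

Lemma holo_at_pser (a : nat -> C) (R0 : R) (z0 : C) :
  psconv a R0 -> (Cmod z0 < R0)%R -> holo_at z0 (pser a).
Proof.
  intros Ha Hz. exists (R0 - Cmod z0)%R; split; [lra|]. intros z H.
  eexists. apply (pser_is_derive a R0); [exact Ha|]. pose proof (Cmod_close z z0). lra.
Qed.

Section Equation.
Variables q p : C.
Hypothesis Hq : (0 < Cmod q < 1)%R.
Hypothesis Hp : p ^ 5 = q.

Let Hm : (0 < Cmod p < 1)%R := Cmod_p q p Hq Hp.
Let Hp0 : p <> 0 := p_neq0 q p Hq Hp.
Let Hpn : forall n, p ^ n <> 0 := pn_neq0 q p Hq Hp.
Let Hqn : forall n, q ^ n <> 0 := qn_neq0 q Hq.
Let Hq0 : q <> 0 := q_neq0 q Hq.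

(** The operator as a polynomial [sum_j op_coef Q j * y^j] in the shift [y]. *)
Definition op_coef (Q : C) (j : nat) : C :=
  match j with
  | 0%nat => 1 - Q
  | 1%nat => - 4 + Q * (p + p ^ 2 + p ^ 3 + p ^ 4)
  | 2%nat => 6 - Q * (p ^ 3 + p ^ 4 + 2 * p ^ 5 + p ^ 6 + p ^ 7)
  | 3%nat => - 4 + Q * (p ^ 6 + p ^ 7 + p ^ 8 + p ^ 9)
  | _ => 1 - Q * p ^ 10
  end.

Definition symbol (Q y : C) : C :=
  (1 - y) ^ 4 - Q * ((1 - p * y) * (1 - p ^ 2 * y) * (1 - p ^ 3 * y) * (1 - p ^ 4 * y)).

Lemma op_coef_symbol Q y : bsum (fun j => op_coef Q j * y ^ j) 5 = symbol Q y.
Proof. unfold symbol. cbn [bsum op_coef]. ring. Qed.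

Lemma qdiff_op_expand (f : C -> C) (Q : C) :
  qdiff_op q p f Q = bsum (fun j => op_coef Q j * f (q ^ j * Q)) 5.
Proof.
  unfold qdiff_op, one_sub_shift. cbn [Nat.iter nat_rect bsum op_coef].
  replace (q ^ 0 * Q) with Q by (simpl; ring).
  replace (q ^ 1 * Q) with (q * Q) by (simpl; ring).
  replace (q ^ 2 * Q) with (q * (q * Q)) by (simpl; ring).
  replace (q ^ 3 * Q) with (q * (q * (q * Q))) by (simpl; ring).
  replace (q ^ 4 * Q) with (q * (q * (q * (q * Q)))) by (simpl; ring).
  ring.
Qed.

(** ** The hypergeometric series at [Q = 0] *)

(** The coefficient of [Q^d] in [Xfun]. *)
Definition Rterm (d : nat) (P : C) : C :=
  Cprod [1; 2; 3; 4]%nat (fun i => qpoch (P * p ^ i) q d) / qpoch (P * q) q d ^ 4.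

Let r0 : R := ((1 - Cmod q) / 2)%R.

Let r0_pos : (0 < r0)%R.
Proof. unfold r0; lra. Qed.

Let r0_small : (Cmod q * (1 + r0) < 1)%R.
Proof. unfold r0. nra. Qed.

Lemma Pq_small (t : C) : (Cmod t < r0)%R -> (Cmod ((1 - t) * q) < 1)%R.
Proof.
  intros Ht. rewrite Cmod_mult, Rmult_comm. eapply Rle_lt_trans; [|exact r0_small].
  apply Rmult_le_compat_l; [lra|].
  unfold Cminus; eapply Rle_trans; [apply Cmod_triangle|]. rewrite Cmod_1, Cmod_opp; lra.
Qed.

(** Uniformity in [d] makes the series of jets converge for every [|Q| < 1]. *)
Lemma Rterm_jet : exists C B, (0 <= B)%R /\ forall d, jet r0 (fun t => Rterm d (1 - t)) (C d) B.
Proof.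
  assert (HN : forall i, exists C B, (0 <= B)%R /\
    forall d, jet r0 (fun t => qpoch ((1 - t) * p ^ i) q d) (C d) B).
  { intros i.
    destruct (jet_qpoch q Hq r0 r0_pos (fun t => p ^ i + - p ^ i * t) _ _ (jet_affine r0 (p ^ i) (- p ^ i)))
      as [C HC].
    exists C, (U q (Cmod (p ^ i) + Cmod (- p ^ i) * r0)). split; [left; apply exp_pos|].
    intros d. eapply (jet_ext r0); [|reflexivity|apply (HC d)].
    intros t _. simpl. f_equal. ring. }
  destruct (HN 1%nat) as [C1 [B1 [P1 J1]]]. destruct (HN 2%nat) as [C2 [B2 [P2 J2]]].
  destruct (HN 3%nat) as [C3 [B3 [P3 J3]]]. destruct (HN 4%nat) as [C4 [B4 [P4 J4]]].
  destruct (jet_inv_qpoch q Hq r0 r0_pos q r0_small) as [C5 J5].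
  set (B5 := L q (Cmod q * (1 + r0))) in *.
  assert (P5 : (0 <= B5)%R) by (left; apply exp_pos).
  do 2 eexists. split; [|intros d; eapply (jet_ext r0); [|reflexivity|
    apply (jet_mult r0 r0_pos _ _ _ _ _ _
      (jet_mult r0 r0_pos _ _ _ _ _ _ (jet_mult r0 r0_pos _ _ _ _ _ _ (J1 d) (J2 d))
         (jet_mult r0 r0_pos _ _ _ _ _ _ (J3 d) (J4 d)))
      (jet_pow r0 r0_pos _ _ _ 4 (J5 d)))]].
  - mul_pos; try assumption. apply pow_le, P5.
  - intros t Ht. simpl. unfold Rterm, Cprod. simpl.
    replace (q * (1 - t)) with ((1 - t) * q) by ring.
    pose proof (qpoch_neq0_small q Hq ((1 - t) * q) d (Pq_small t Ht)).
    field. assumption.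
Qed.

Lemma X_series : exists xc : nat -> nat -> C,
  (forall b, (b <= 3)%nat -> psconv (xc b) 1) /\
  forall Q, (Cmod Q < 1)%R -> expands (Xfun q p Q) (fun b => pser (xc b) Q).
Proof.
  destruct Rterm_jet as [C [B [HB J]]].
  exists (fun b d => C d b). split.
  - intros b Hb. apply (psconv_bounded _ (B / r0 ^ b)%R).
    intros d. apply (jet_coef r0 r0_pos _ _ _ b Hb (J d)).
  - intros Q HQ. apply (jet_expands r0 _ _ (Series (fun d => Cmod (Q ^ d) * B)%R) r0_pos).
    eapply (jet_ext r0); [| |apply (jet_sum r0 r0_pos (fun d t => Q ^ d * Rterm d (1 - t))
        (fun d b => Q ^ d * C d b) (fun d => Cmod (Q ^ d) * B)%R)].
    + intros t _. unfold Xfun, Rterm. apply Csum_ext. intros d. ring.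
    + intros b _. unfold pser. apply Csum_ext. intros d. ring.
    + intros d. apply (jet_scal r0 r0_pos), J.
    + apply ex_series_scal_r. apply Summable_geom, HQ.
Qed.

Lemma X_expands Q : (Cmod Q < 1)%R -> expands (Xfun q p Q) (fun b => X q p b Q).
Proof.
  intros HQ. destruct X_series as [xc [_ H]].
  exact (epsilon_spec (inhabits (fun _ : nat => RtoC 0)) (expands (Xfun q p Q))
           (ex_intro _ _ (H Q HQ))).
Qed.

Lemma X_holo b z0 : (b <= 3)%nat -> (Cmod z0 < 1)%R -> holo_at z0 (X q p b).
Proof.
  intros Hb Hz0. destruct X_series as [xc [Hc H]].
  destruct (holo_at_pser (xc b) 1 z0 (Hc b Hb) Hz0) as [r [Hr HH]].
  exists (Rmin r (1 - Cmod z0)). split; [apply Rmin_glb_lt; lra|]. intros z Hz.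
  pose proof (Rmin_l r (1 - Cmod z0)); pose proof (Rmin_r r (1 - Cmod z0)).
  destruct (HH z ltac:(lra)) as [l Hl]. exists l.
  pose proof (Cmod_close z z0).
  apply (Cder_ext_loc (pser (xc b)) _ z l (1 - Cmod z)); [lra| |exact Hl].
  intros w Hw. pose proof (Cmod_close w z).
  apply (expands_unique (Xfun q p w) (fun b => pser (xc b) w) (fun b => X q p b w)); [exact Hb| |].
  - apply H; lra.
  - apply X_expands; lra.
Qed.

Lemma Rterm_step d P : (Cmod (P * q) < 1)%R ->
  (1 - P * q ^ S d) ^ 4 * Rterm (S d) P
  = (1 - p * (P * q ^ d)) * (1 - p ^ 2 * (P * q ^ d)) * (1 - p ^ 3 * (P * q ^ d))
    * (1 - p ^ 4 * (P * q ^ d)) * Rterm d P.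
Proof.
  intros HP. unfold Rterm, Cprod. simpl.
  pose proof (qpoch_neq0_small q Hq (P * q) d HP) as N1.
  pose proof (factor_lower q Hq (P * q) d HP) as N2.
  assert (N3 : 1 - P * q * q ^ d <> 0) by (apply Cmod_gt_0; lra).
  field; auto.
Qed.

(** The series satisfies the equation with [P] times the shift in place of the
    shift, up to the term [(1 - P)^4]: the sum telescopes. *)
Lemma Xfun_equation Q t : (Cmod Q < 1)%R -> (Cmod t < r0)%R ->
  bsum (fun j => op_coef Q j * ((1 - t) ^ j * Xfun q p (q ^ j * Q) (1 - t))) 5 = t ^ 4.
Proof.
  intros HQ Ht. set (P := 1 - t).
  destruct Rterm_jet as [C [B [HB J]]].
  assert (HR : forall d, (Cmod (Rterm d P) <= B)%R).
  { intros d. apply (jet_bound r0 r0_pos _ _ _ t (J d) Ht). }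
  assert (Hqd : forall d, (0 <= Cmod q ^ d <= 1)%R) by (intros; apply pow_01; lra).
  assert (HSj : forall j, Summable (fun d => Rterm d P * (q ^ j * Q) ^ d)).
  { intros j. apply (Summable_bounded_geom _ B); [|exact HR].
    rewrite Cmod_mult, Cmod_pow. specialize (Hqd j). pose proof (Cmod_ge_0 Q). nra. }
  set (b := fun d => (1 - P * q ^ d) ^ 4 * Rterm d P * Q ^ d).
  assert (Hb : Cconv b 0).
  { apply Summable_conv0. unfold b. apply (Summable_bounded_geom _ ((1 + Cmod P) ^ 4 * B)%R); [exact HQ|].
    intros d. rewrite Cmod_mult, Cmod_pow.
    apply Rmult_le_compat; [apply pow_le, Cmod_ge_0|apply Cmod_ge_0| |apply HR].
    apply pow_incr; split; [apply Cmod_ge_0|].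
    unfold Cminus. eapply Rle_trans; [apply Cmod_triangle|]. rewrite Cmod_1, Cmod_opp, Cmod_mult, Cmod_pow.
    specialize (Hqd d). pose proof (Cmod_ge_0 P). nra. }
  transitivity (b O).
  2:{ unfold b, P, Rterm, Cprod. simpl. field. }
  rewrite <- (Csum_telescope (fun d => b d - b (S d)) b Hb) by reflexivity.
  assert (E : forall j, op_coef Q j * (P ^ j * Xfun q p (q ^ j * Q) P)
     = Csum (fun d => op_coef Q j * P ^ j * (Rterm d P * (q ^ j * Q) ^ d))).
  { intros j. rewrite Csum_scal by apply HSj. unfold Xfun, Rterm. ring. }
  assert (HSj' : forall j, Summable (fun d => op_coef Q j * P ^ j * (Rterm d P * (q ^ j * Q) ^ d)))
    by (intros j; apply Summable_scal, HSj).
  assert (E2 : forall n, Summable (fun d => bsum (fun j => op_coef Q j * P ^ j * (Rterm d P * (q ^ j * Q) ^ d)) n)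
     /\ bsum (fun j => op_coef Q j * (P ^ j * Xfun q p (q ^ j * Q) P)) n
        = Csum (fun d => bsum (fun j => op_coef Q j * P ^ j * (Rterm d P * (q ^ j * Q) ^ d)) n)).
  { induction n as [|n [IH1 IH2]].
    - assert (S0 : Summable (fun _ : nat => 0)).
      { apply (Summable_ext (fun d => 0 * (Rterm d P * (q ^ 0 * Q) ^ d))); [intros; ring|].
        apply Summable_scal, HSj. }
      split; [exact S0|]. simpl. symmetry. apply Csum_eq.
      apply Cconv_ext with (fun _ => 0); [|apply Cconv_const].
      induction n as [|n IH]; simpl; [reflexivity|]. rewrite <- IH; ring.
    - split; [apply Summable_plus; [exact IH1|apply HSj']|].
      cbn [bsum]. rewrite IH2, E. symmetry. apply Csum_plus; [exact IH1|apply HSj']. }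
  rewrite (proj2 (E2 5%nat)). apply Csum_ext. intros d.
  transitivity (symbol Q (P * q ^ d) * (Rterm d P * Q ^ d)).
  - rewrite <- op_coef_symbol, (Cmult_comm (bsum _ _)), <- bsum_scal. apply bsum_ext. intros j _.
    rewrite !Cpow_mult_l, <- !Cpow_mult_r, (Nat.mul_comm d j). ring.
  - unfold b. rewrite (Rterm_step d P) by (apply Pq_small, Ht).
    unfold symbol. simpl (Q ^ S d). ring.
Qed.

(** Multiplying by [P = 1 - (1 - P)] is convolution with [(1, -1)], so the
    coefficients of order at most 3 of the previous identity read as follows. *)
Lemma X_relation Q : (Cmod Q < 1)%R -> forall b, (b <= 3)%nat ->
  bsum (fun j => op_coef Q j
     * Nat.iter j (conv (unit_seq 1 (- (1)))) (fun c => X q p c (q ^ j * Q)) b) 5 = 0.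
Proof.
  intros HQ b Hb.
  assert (HjQ : forall j, (Cmod (q ^ j * Q) < 1)%R).
  { intros j. rewrite Cmod_mult, Cmod_pow. pose proof (Cmod_ge_0 Q).
    assert (0 <= Cmod q ^ j <= 1)%R; [|nra].
    apply pow_01; lra. }
  assert (H1 : forall j n, expands (fun P => P ^ j * Xfun q p (q ^ n * Q) P)
     (Nat.iter j (conv (unit_seq 1 (- (1)))) (fun c => X q p c (q ^ n * Q)))).
  { intros j n. induction j as [|j IH].
    - eapply expands_eqmod4; [|apply X_expands, HjQ].
      apply eqmod4_near with 1%R; [lra|]. intros; simpl; ring.
    - eapply expands_eqmod4; [|apply (expands_mult _ _ _ _ (expands_affine 1 (- (1))) IH)].
      apply eqmod4_near with 1%R; [lra|]. intros; simpl; ring. }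
  assert (H2 : forall n, expands (fun P => bsum (fun j => op_coef Q j * (P ^ j * Xfun q p (q ^ j * Q) P)) n)
     (fun b => bsum (fun j => op_coef Q j
     * Nat.iter j (conv (unit_seq 1 (- (1)))) (fun c => X q p c (q ^ j * Q)) b) n)).
  { induction n as [|n IH].
    - eapply expands_ext; [|eapply expands_eqmod4; [|apply (expands_affine 0 0)]].
      + intros m Hm'. destruct m as [|[|m]]; reflexivity.
      + apply eqmod4_near with 1%R; [lra|]. intros; simpl; ring.
    - apply (expands_plus _ _ _ _ IH). apply (expands_scal (op_coef Q n)), H1. }
  transitivity (unit_seq 0 0 b).
  - apply (expands_unique _ _ _ b Hb (H2 5%nat)).
    exists 1%R, r0. split; [exact r0_pos|]. intros P HP.
    rewrite cpol_sum_n. replace (cpol (unit_seq 0 0) (1 - P)) with (RtoC 0) by (unfold cpol; simpl; ring).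
    assert (Ht : (Cmod (1 - P) < r0)%R).
    { rewrite <- Cmod_opp. replace (- (1 - P)) with (P - 1) by ring. exact HP. }
    pose proof (Xfun_equation Q (1 - P) HQ Ht) as E.
    replace (1 - (1 - P)) with P in E by ring. rewrite E.
    replace ((1 - P) ^ 4 - 0) with ((1 - P) ^ 4) by ring. rewrite Cmod_pow. lra.
  - destruct b as [|[|b]]; reflexivity.
Qed.

Lemma theta_orbit (Q : C) (j : nat) : Q <> 0 -> theta q Q <> 0 ->
  q ^ j * Q <> 0 /\ theta q (q ^ j * Q) <> 0 /\ ell q (q ^ j * Q) = ell q Q + INR j.
Proof.
  intros HQ Ht. induction j as [|j [I1 [I2 I3]]].
  - simpl. replace (1 * Q) with Q by ring. repeat split; auto. ring.
  - replace (q ^ S j * Q) with (q * (q ^ j * Q)) by (simpl; ring).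
    split; [apply Cmult_neq_0; assumption|].
    split; [rewrite (theta_shift q Hq) by exact I1; apply ratio_neq0; assumption|].
    rewrite (ell_shift q Hq) by assumption. rewrite I3, S_INR, RtoC_plus. ring.
Qed.

(** The sum defining the [m]-th solution is the coefficient of [(1 - P)^m] in
    [P^ell * Xfun]; the shift of the argument multiplies [P^ell] by [P]. *)
Lemma sol0_equation (m : nat) (Q : C) : (m <= 3)%nat ->
  (Cmod Q < 1)%R -> Q <> 0 -> theta q Q <> 0 ->
  qdiff_op q p (sol0 q p m) Q = 0.
Proof.
  intros Hm3 HQ HQ0 Ht. rewrite qdiff_op_expand.
  pose proof (X_relation Q HQ 0%nat ltac:(lia)) as R0. pose proof (X_relation Q HQ 1%nat ltac:(lia)) as R1.
  pose proof (X_relation Q HQ 2%nat ltac:(lia)) as R2. pose proof (X_relation Q HQ 3%nat ltac:(lia)) as R3.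
  pose proof (proj2 (proj2 (theta_orbit Q 0 HQ0 Ht))) as L0.
  pose proof (proj2 (proj2 (theta_orbit Q 1 HQ0 Ht))) as L1.
  pose proof (proj2 (proj2 (theta_orbit Q 2 HQ0 Ht))) as L2.
  pose proof (proj2 (proj2 (theta_orbit Q 3 HQ0 Ht))) as L3.
  pose proof (proj2 (proj2 (theta_orbit Q 4 HQ0 Ht))) as L4.
  unfold sol0, binomC, Cprod. cbn [bsum].
  cbn [bsum Nat.iter nat_rect] in R0, R1, R2, R3.
  rewrite ?conv_3, ?conv_2, ?conv_1, ?conv_0 in R3.
  rewrite ?conv_3, ?conv_2, ?conv_1, ?conv_0 in R2.
  rewrite ?conv_3, ?conv_2, ?conv_1, ?conv_0 in R1.
  rewrite ?conv_3, ?conv_2, ?conv_1, ?conv_0 in R0.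
  cbn [unit_seq] in R0, R1, R2, R3.
  set (ell0 := ell q Q) in *.
  replace (INR 0) with 0%R in L0 by reflexivity. replace (INR 1) with 1%R in L1 by reflexivity.
  replace (INR 2) with 2%R in L2 by (simpl; ring). replace (INR 3) with 3%R in L3 by (simpl; ring).
  replace (INR 4) with 4%R in L4 by (simpl; ring).
  destruct m as [|[|[|[|m]]]]; [| | | |lia];
  rewrite !sum_n_bsum; cbn [bsum seq map fold_right Nat.sub fact Nat.mul Nat.add]; rewrite ?L0, ?L1, ?L2, ?L3, ?L4;
  replace (INR 0) with 0%R by reflexivity; replace (INR 1) with 1%R by reflexivity;
  try replace (INR 2) with 2%R by (simpl; ring); try replace (INR 6) with 6%R by (simpl; ring).
  - match type of R0 with ?r0 = _ => transitivity r0; [field|exact R0] end.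
  - match type of R0 with ?r0 = _ => match type of R1 with ?r1 = _ =>
      transitivity (r1 - ell0 * r0); [field; apply C1_nz|rewrite R0, R1; ring] end end.
  - match type of R0 with ?r0 = _ => match type of R1 with ?r1 = _ => match type of R2 with ?r2 = _ =>
      transitivity (r2 - ell0 * r1 + ell0 * (ell0 - 1) / 2 * r0);
        [field; auto|rewrite R0, R1, R2; ring] end end end.
  - match type of R0 with ?r0 = _ => match type of R1 with ?r1 = _ => match type of R2 with ?r2 = _ =>
    match type of R3 with ?r3 = _ =>
      transitivity (r3 - ell0 * r2 + ell0 * (ell0 - 1) / 2 * r1 - ell0 * (ell0 - 1) * (ell0 - 2) / 6 * r0);
        [field; auto|rewrite R0, R1, R2, R3; ring] end end end end.
Qed.

End Equation.

(** ** Meromorphy of the solutions *)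

(** [f] need only be differentiable on [A], which [c / z] does not leave for [z]
    near [z0]. *)
Lemma holo_at_comp_inv (f : C -> C) (c z0 : C) (A : C -> Prop) :
  z0 <> 0 -> (exists r, (0 < r)%R /\ forall z, (Cmod (z - z0) < r)%R -> A (c / z)) ->
  (forall w, A w -> Cdiffable f w) -> holo_at z0 (fun z => f (c / z)).
Proof.
  intros Hz0 [r [Hr HA]] Hf.
  assert (Hm : (0 < Cmod z0)%R) by (apply Cmod_gt_0, Hz0).
  exists (Rmin r (Cmod z0)). split; [apply Rmin_glb_lt; assumption|]. intros z Hz.
  pose proof (Rmin_l r (Cmod z0)); pose proof (Rmin_r r (Cmod z0)).
  pose proof (Cmod_close z z0).
  assert (z <> 0) by (apply Cmod_gt_0; lra).
  destruct (Hf (c / z) (HA z ltac:(lra))) as [l Hl].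
  eexists. apply (Cder_comp f (fun z => c / z)); [|exact Hl].
  apply (Cder_scal c (fun z => / z)), Cder_inv. assumption.
Qed.

Section Final.
Variables q p : C.
Hypothesis Hq : (0 < Cmod q < 1)%R.
Hypothesis Hp : p ^ 5 = q.

Let Hm : (0 < Cmod p < 1)%R := Cmod_p q p Hq Hp.
Let Hp0 : p <> 0 := p_neq0 q p Hq Hp.
Let Hpn : forall n, p ^ n <> 0 := pn_neq0 q p Hq Hp.
Let Hqn : forall n, q ^ n <> 0 := qn_neq0 q Hq.
Let Hq0 : q <> 0 := q_neq0 q Hq.

Lemma theta_holo (z0 : C) : z0 <> 0 -> holo_at z0 (theta q).
Proof.
  intros Hz. exists (Cmod z0). split; [apply Cmod_gt_0, Hz|]. intros z H.
  eexists. apply theta_Cder; [exact Hq|]. apply Cmod_gt_0. pose proof (Cmod_close z z0). lra.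
Qed.

Lemma ell_mero (z0 : C) : z0 <> 0 -> mero_at z0 (ell q).
Proof.
  intros Hz.
  assert (Hn : holo_at z0 (fun z => - (1) * z * dtheta q z)).
  { exists (Cmod z0). split; [apply Cmod_gt_0, Hz|]. intros z H.
    assert (z <> 0) by (apply Cmod_gt_0; pose proof (Cmod_close z z0); lra).
    destruct (dtheta_diffable q Hq z) as [l Hl]; [assumption|].
    eexists. apply (Cder_mult (fun z => - (1) * z)); [apply Cder_scal, Cder_id|exact Hl]. }
  apply (mero_at_quot z0 _ _ _ Hn (theta_holo z0 Hz)).
  eapply pnear_mono; [|apply pnear_and; [apply (pnear_neq0 z0 Hz)|apply (theta_isolated q Hq z0 Hz)]].
  intros z [H1 H2]. split; [exact H2|]. unfold ell.
  rewrite (C_derive_theta q Hq) by exact H1. field. exact H2.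
Qed.

Lemma binomC_mero (z0 : C) (a : nat) : z0 <> 0 -> mero_at z0 (fun z => binomC (ell q z) a).
Proof.
  intros Hz. unfold binomC.
  apply (mero_at_mult z0 (fun _ => / RtoC (INR (fact a)))); [apply holo_mero, holo_at_const|].
  unfold Cprod. induction (seq 0 a) as [|r l IH]; simpl; [apply holo_mero, holo_at_const|].
  apply (mero_at_mult z0 (fun z => ell q z - RtoC (INR r))); [|exact IH].
  apply (mero_at_plus z0 (ell q) (fun _ => - RtoC (INR r)));
    [apply ell_mero, Hz|apply holo_mero, holo_at_const].
Qed.

Lemma sol0_mero (m : nat) (z0 : C) : (m <= 3)%nat -> (0 < Cmod z0 < 1)%R ->
  mero_at z0 (sol0 q p m).
Proof.
  intros Hm3 Hz. assert (Hz0 : z0 <> 0) by (apply Cmod_gt_0; lra).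
  apply (mero_at_ext z0 (fun Q => bsum (fun a =>
     (- (1)) ^ a * binomC (ell q Q) a * X q p (m - a) Q) (S m))).
  { exists 1%R; split; [lra|]. intros z _. unfold sol0. rewrite sum_n_bsum. reflexivity. }
  assert (H : forall n, mero_at z0 (fun Q => bsum (fun a =>
     (- (1)) ^ a * binomC (ell q Q) a * X q p (m - a) Q) n)).
  { induction n as [|n IH]; [exact (holo_mero z0 _ (holo_at_const z0 0))|]. cbn [bsum].
    apply mero_at_plus; [exact IH|].
    apply (mero_at_mult z0 (fun Q => (- (1)) ^ n * binomC (ell q Q) n)).
    - apply (mero_at_mult z0 (fun _ => (- (1)) ^ n)); [apply holo_mero, holo_at_const|].
      apply binomC_mero, Hz0.
    - apply holo_mero. apply (X_holo q p Hq Hp); [lia|lra]. }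
  apply H.
Qed.

Lemma sol0_solution (m : nat) : (m <= 3)%nat ->
  qdiff_solution q p punctured_unit_disc (sol0 q p m).
Proof.
  intros Hm3. split.
  - intros z0 Hz. apply (sol0_mero m z0 Hm3 Hz).
  - apply mero_eq_0. intros z0 Hz. specialize (Hz 0%nat ltac:(lia)). replace (q ^ 0 * z0) with z0 in Hz by (simpl; ring).
      unfold punctured_unit_disc in Hz.
      assert (Hz0 : z0 <> 0) by (apply Cmod_gt_0; lra).
      eapply pnear_mono; [|apply pnear_and; [apply (pnear_lt z0 (1 - Cmod z0)); lra|
        apply pnear_and; [apply (pnear_neq0 z0 Hz0)|apply (theta_isolated q Hq z0 Hz0)]]].
      intros z [H1 [H2 H3]]. apply (sol0_equation q p Hq Hp); try assumption.
      pose proof (Cmod_close z z0); lra.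
Qed.

(** ** Solutions at infinity *)

Lemma phi_psconv k : (1 <= k <= 4)%nat -> psconv (phi_coef q p k) 1.
Proof.
  intros Hk. destruct (phi_coef_bounded q p Hq Hp k Hk) as [M [_ HM]].
  apply (psconv_bounded _ M HM).
Qed.

Lemma W_eq (k : nat) (x : C) : (1 <= k <= 4)%nat ->
  W q p k x = eq_lam q (p ^ k) x * pser (phi_coef q p k) (q ^ 2 * x).
Proof.
  intros Hk. unfold W.
  destruct k as [|[|[|[|[|k]]]]]; try lia; f_equal; unfold phi43, pser; apply Csum_ext; intros n;
    unfold phi_coef, others, Cprod; cbn [filter map fold_right Nat.eqb negb Nat.sub Nat.add];
    f_equal; unfold Cdiv; f_equal; try (simpl; ring); f_equal; ring.
Qed.

Lemma eq_lam_shift (lam z : C) : z <> 0 -> lam <> 0 -> theta q (lam / z) <> 0 ->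
  eq_lam q lam (/ (q * z)) = / lam * eq_lam q lam (/ z).
Proof.
  intros Hz Hl Ht. unfold eq_lam.
  assert (Hqz : q * z <> 0) by (apply Cmult_neq_0; assumption).
  assert (E : forall a : C, a <> 0 -> theta q (a / z) = theta q (a / (q * z)) * (q * z) / a).
  { intros a Ha. replace (a / z) with (q * (a / (q * z))) by (field; auto).
    rewrite (theta_shift q Hq) by (apply ratio_neq0; assumption). field. repeat split; auto. }
  replace (/ (q * z)) with (1 / (q * z)) by (field; auto).
  replace (lam * (1 / (q * z))) with (lam / (q * z)) by (field; auto).
  replace (/ z) with (1 / z) by (field; auto).
  replace (lam * (1 / z)) with (lam / z) by (field; auto).
  rewrite (E 1 C1_nz). rewrite (E lam Hl) in Ht |- *.
  assert (H2 : theta q (lam / (q * z)) <> 0) by (intros E2; apply Ht; rewrite E2; field; auto).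
  field. repeat split; auto.
Qed.

Lemma eq_lam_orbit (lam z : C) (j : nat) : z <> 0 -> lam <> 0 -> theta q (lam / z) <> 0 ->
  q ^ j * z <> 0 /\ theta q (lam / (q ^ j * z)) <> 0 /\
  eq_lam q lam (/ (q ^ j * z)) = (/ lam) ^ j * eq_lam q lam (/ z).
Proof.
  intros Hz Hl Ht. induction j as [|j [I1 [I2 I3]]].
  - simpl. replace (1 * z) with z by ring. repeat split; auto. ring.
  - replace (q ^ S j * z) with (q * (q ^ j * z)) by (simpl; ring).
    assert (Hn : q * (q ^ j * z) <> 0) by (apply Cmult_neq_0; assumption).
    split; [exact Hn|]. split.
    + intros E. apply I2.
      replace (lam / (q ^ j * z)) with (q * (lam / (q * (q ^ j * z)))) by (field; auto).
      rewrite (theta_shift q Hq) by (apply ratio_neq0; assumption). rewrite E.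
      unfold Cdiv; ring.
    + rewrite eq_lam_shift by assumption. rewrite I3. simpl. ring.
Qed.

(** The two-term recursion of the coefficients, in the form in which the operator
    produces it on [Q^-n]: there the shift acts as [p^-k q^-n]. *)
Lemma phi_coef_step (k n : nat) : (1 <= k <= 4)%nat ->
  phi_coef q p k (S n) * q ^ 2
    * ((1 - p * (/ p ^ k * / q ^ S n)) * (1 - p ^ 2 * (/ p ^ k * / q ^ S n))
       * (1 - p ^ 3 * (/ p ^ k * / q ^ S n)) * (1 - p ^ 4 * (/ p ^ k * / q ^ S n)))
  = (1 - / p ^ k * / q ^ n) ^ 4 * phi_coef q p k n.
Proof.
  intros Hk.
  assert (Hsm : forall a m, (1 <= a)%nat -> qpoch (p ^ a) q m <> 0).
  { intros a m Ha. apply qpoch_neq0_small; [exact Hq|]. apply (ppow_small q p Hq Hp); lia. }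
  assert (Hqq : forall m, qpoch q q m <> 0) by (intros m; apply qpoch_neq0_small; [exact Hq|lra]).
  assert (Hf : forall a, (1 <= a)%nat -> 1 - p ^ a * q ^ n <> 0).
  { intros a Ha. apply Cmod_gt_0.
    pose proof (factor_lower q Hq (p ^ a) n (ppow_small q p Hq Hp a Ha)). lra. }
  pose proof (Hf 5 ltac:(lia))%nat as F5.
  pose proof (Hf 2 ltac:(lia))%nat as F2; pose proof (Hf 3 ltac:(lia))%nat as F3;
  pose proof (Hf 4 ltac:(lia))%nat as F4; pose proof (Hf 6 ltac:(lia))%nat as F6;
  pose proof (Hf 7 ltac:(lia))%nat as F7; pose proof (Hf 8 ltac:(lia))%nat as F8.
  pose proof (Hqn n) as Hw.
  destruct k as [|[|[|[|[|k]]]]]; try lia;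
    unfold phi_coef, others, Cprod; cbn [filter map fold_right Nat.eqb negb Nat.sub Nat.add qpoch];
    change (q ^ S n) with (q * q ^ n);
    generalize (Hsm 2%nat n ltac:(lia)) (Hsm 3%nat n ltac:(lia)) (Hsm 4%nat n ltac:(lia))
      (Hsm 6%nat n ltac:(lia)) (Hsm 7%nat n ltac:(lia)) (Hsm 8%nat n ltac:(lia)) (Hqq n);
    generalize (qpoch (p ^ 1) q n) (qpoch (p ^ 2) q n) (qpoch (p ^ 3) q n) (qpoch (p ^ 4) q n)
      (qpoch (p ^ 6) q n) (qpoch (p ^ 7) q n) (qpoch (p ^ 8) q n) (qpoch q q n);
    generalize dependent (q ^ n); intros w; intros; rewrite <- Hp; field; repeat split; auto.
Qed.

(** The sum telescopes; the only boundary term has the factor [1 - p^k p^-k]. *)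
Lemma W_equation (k : nat) (z : C) : (1 <= k <= 4)%nat -> z <> 0 ->
  (Cmod q ^ 2 < Cmod (q ^ 4 * z))%R -> theta q (p ^ k / z) <> 0 ->
  qdiff_op q p (fun Q => W q p k (/ Q)) z = 0.
Proof.
  intros Hk Hz Hdom Ht. rewrite qdiff_op_expand.
  set (E := eq_lam q (p ^ k) (/ z)).
  set (a := phi_coef q p k).
  assert (Hin : forall j, (j <= 4)%nat -> (Cmod (q ^ 2 / (q ^ j * z)) < 1)%R).
  { intros j Hj. assert (Hjz : q ^ j * z <> 0) by (apply Cmult_neq_0; auto).
    rewrite Cmod_div, Cmod_pow by exact Hjz.
    apply Rlt_div_l; [apply Cmod_gt_0, Hjz|]. rewrite Rmult_1_l.
    eapply Rlt_le_trans; [exact Hdom|]. rewrite !Cmod_mult, !Cmod_pow.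
    apply Rmult_le_compat_r; [apply Cmod_ge_0|].
    replace 4%nat with (j + (4 - j))%nat by lia. rewrite pow_add.
    rewrite <- (Rmult_1_r (Cmod q ^ j)) at 2. apply Rmult_le_compat_l; [apply pow_le; lra|].
    rewrite <- (pow1 (4 - j)). apply pow_incr; lra. }
  assert (HS : forall j, (j <= 4)%nat -> Summable (fun n => a n * (q ^ 2 / (q ^ j * z)) ^ n)).
  { intros j Hj. apply (psconv_Summable _ 1 _ (phi_psconv k Hk) (Hin j Hj)). }
  set (y := fun n => / p ^ k * / q ^ n).
  set (s := fun j n => (/ p ^ k) ^ j * (a n * (q ^ 2 / (q ^ j * z)) ^ n)).
  assert (Hs : forall j n, s j n = y n ^ j * (a n * (q ^ 2 / z) ^ n)).
  { intros j n. unfold s, y. rewrite (Cpow_mult_l (/ p ^ k)), (Cpow_inv (q ^ n)) by auto.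
    rewrite <- Cpow_mult_r, (Nat.mul_comm n j), Cpow_mult_r.
    replace (q ^ 2 / (q ^ j * z)) with (/ q ^ j * (q ^ 2 / z)) by (field; auto).
    rewrite (Cpow_mult_l (/ q ^ j)), (Cpow_inv (q ^ j)) by auto. ring. }
  assert (HSs : forall j, (j <= 4)%nat -> Summable (s j)).
  { intros j Hj. apply Summable_scal, HS, Hj. }
  assert (HW : forall j, (j <= 4)%nat -> W q p k (/ (q ^ j * z)) = E * Csum (s j)).
  { intros j Hj. rewrite W_eq by exact Hk.
    rewrite (proj2 (proj2 (eq_lam_orbit (p ^ k) z j Hz (Hpn k) Ht))).
    unfold s. rewrite Csum_scal by (apply HS, Hj). fold E. unfold pser. fold a.
    replace (q ^ 2 * / (q ^ j * z)) with (q ^ 2 / (q ^ j * z)) by reflexivity. ring. }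
  set (num := fun v => (1 - p * v) * (1 - p ^ 2 * v) * (1 - p ^ 3 * v) * (1 - p ^ 4 * v)).
  set (b := fun n => - (z * (num (y n) * (a n * (q ^ 2 / z) ^ n)))).
  assert (Hb : Cconv b 0).
  { assert (H0 : forall j, (j <= 4)%nat -> Cconv (s j) 0) by (intros j Hj; apply Summable_conv0, HSs, Hj).
    apply Cconv_ext with (fun n => - z * s 0%nat n + z * (p + p ^ 2 + p ^ 3 + p ^ 4) * s 1%nat n
      + - z * (p ^ 3 + p ^ 4 + 2 * p ^ 5 + p ^ 6 + p ^ 7) * s 2%nat n
      + z * (p ^ 6 + p ^ 7 + p ^ 8 + p ^ 9) * s 3%nat n + - z * p ^ 10 * s 4%nat n).
    - intros n. unfold b, num. rewrite !Hs. ring.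
    - replace (RtoC 0) with (- z * 0 + z * (p + p ^ 2 + p ^ 3 + p ^ 4) * 0
        + - z * (p ^ 3 + p ^ 4 + 2 * p ^ 5 + p ^ 6 + p ^ 7) * 0
        + z * (p ^ 6 + p ^ 7 + p ^ 8 + p ^ 9) * 0 + - z * p ^ 10 * 0) by ring.
      repeat apply Cconv_plus; apply Cconv_scal, H0; lia. }
  assert (Hb0 : b O = 0).
  { unfold b, num, y.
    destruct k as [|[|[|[|[|k]]]]]; try lia; simpl; field; auto. }
  assert (Hstep : forall n, symbol p z (y n) * (a n * (q ^ 2 / z) ^ n) = b n - b (S n)).
  { intros n. unfold b. 
    assert (Es : z * (num (y (S n)) * (a (S n) * (q ^ 2 / z) ^ S n))
       = (1 - y n) ^ 4 * (a n * (q ^ 2 / z) ^ n)).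
    { transitivity (a (S n) * q ^ 2 * num (y (S n)) * (q ^ 2 / z) ^ n).
      - change ((q ^ 2 / z) ^ S n) with (q ^ 2 / z * (q ^ 2 / z) ^ n).
        generalize ((q ^ 2 / z) ^ n). intros w. field. exact Hz.
      - unfold num, a, y. rewrite (phi_coef_step k n Hk). ring. }
    unfold symbol. fold (num (y n)). 
    transitivity ((1 - y n) ^ 4 * (a n * (q ^ 2 / z) ^ n)
       - z * (num (y n) * (a n * (q ^ 2 / z) ^ n))); [ring|]. rewrite <- Es. ring. }
  transitivity (E * Csum (fun n => symbol p z (y n) * (a n * (q ^ 2 / z) ^ n))).
  - rewrite (Csum_ext _ (fun n => op_coef p z 0 * s 0%nat n + (op_coef p z 1 * s 1%nat n
      + (op_coef p z 2 * s 2%nat n + (op_coef p z 3 * s 3%nat n + op_coef p z 4 * s 4%nat n))))).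
    2:{ intros n. rewrite <- op_coef_symbol, !Hs. cbn [bsum]. simpl. ring. }
    pose proof (Summable_scal (op_coef p z 0) _ (HSs 0 ltac:(lia)))%nat as S0.
    pose proof (Summable_scal (op_coef p z 1) _ (HSs 1 ltac:(lia)))%nat as S1.
    pose proof (Summable_scal (op_coef p z 2) _ (HSs 2 ltac:(lia)))%nat as S2.
    pose proof (Summable_scal (op_coef p z 3) _ (HSs 3 ltac:(lia)))%nat as S3.
    pose proof (Summable_scal (op_coef p z 4) _ (HSs 4 ltac:(lia)))%nat as S4.
    pose proof (Summable_plus _ _ S3 S4) as S34. pose proof (Summable_plus _ _ S2 S34) as S234.
    pose proof (Summable_plus _ _ S1 S234) as S1234.
    rewrite (Csum_plus _ _ S0 S1234), (Csum_plus _ _ S1 S234), (Csum_plus _ _ S2 S34), (Csum_plus _ _ S3 S4).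
    rewrite !Csum_scal by (apply HSs; lia).
    cbn [bsum]. rewrite !HW by lia. ring.
  - rewrite (Csum_telescope _ b Hb Hstep), Hb0. ring.
Qed.

Lemma W_mero (k : nat) (z0 : C) : (1 <= k <= 4)%nat -> near_infinity q z0 ->
  mero_at z0 (fun Q => W q p k (/ Q)).
Proof.
  intros Hk HD. unfold near_infinity in HD.
  assert (Hq2 : (0 < Cmod q ^ 2)%R) by (apply pow_lt; lra).
  assert (Hz0 : z0 <> 0) by (apply Cmod_gt_0; lra).
  assert (Hth : forall c : C, c <> 0 -> holo_at z0 (fun z => theta q (c / z))).
  { intros c Hc. apply (holo_at_comp_inv (theta q) c z0 (fun w => w <> 0)); [exact Hz0| |].
    - exists (Cmod z0); split; [apply Cmod_gt_0, Hz0|]. intros z Hz.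
      apply ratio_neq0; [exact Hc|]. apply Cmod_gt_0. pose proof (Cmod_close z z0); lra.
    - intros w Hw. eexists. apply theta_Cder; assumption. }
  assert (Hphi : holo_at z0 (fun z => pser (phi_coef q p k) (q ^ 2 / z))).
  { apply (holo_at_comp_inv _ (q ^ 2) z0 (fun w => (Cmod w < 1)%R)); [exact Hz0| |].
    - exists (Cmod z0 - Cmod q ^ 2)%R; split; [lra|]. intros z Hz.
      pose proof (Cmod_close z z0). assert (Hz' : z <> 0) by (apply Cmod_gt_0; lra).
      rewrite Cmod_div, Cmod_pow by exact Hz'. apply Rlt_div_l; lra.
    - intros w Hw. apply (pser_ex_derive _ 1 w (phi_psconv k Hk) Hw). }
  apply (mero_at_quot z0 _ (fun z => theta q (1 / z) * pser (phi_coef q p k) (q ^ 2 / z))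
          (fun z => theta q (p ^ k / z))).
  - apply holo_at_mult; [apply Hth, C1_nz|exact Hphi].
  - apply Hth, Hpn.
  - eapply pnear_mono; [|apply pnear_and; [apply (pnear_neq0 z0 Hz0)|
      apply (pnear_inv (fun w => theta q w <> 0) (p ^ k) z0 (Hpn k) Hz0);
      apply (theta_isolated q Hq); apply ratio_neq0; [apply Hpn|exact Hz0]]].
    intros z [Hz Ht]. split; [exact Ht|]. rewrite W_eq by exact Hk. unfold eq_lam.
    replace (/ z) with (1 / z) by (field; exact Hz).
    replace (p ^ k * (1 / z)) with (p ^ k / z) by (field; exact Hz).
    replace (q ^ 2 * (1 / z)) with (q ^ 2 / z) by (field; exact Hz).
    field. exact Ht.
Qed.

Lemma W_solution (k : nat) : (1 <= k <= 4)%nat ->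
  qdiff_solution q p (near_infinity q) (fun Q => W q p k (/ Q)).
Proof.
  intros Hk. split.
  - intros z0 Hz. apply (W_mero k z0 Hk Hz).
  - apply mero_eq_0. intros z0 Hz. specialize (Hz 4%nat ltac:(lia)). unfold near_infinity in Hz.
      assert (Hq2 : (0 < Cmod q ^ 2)%R) by (apply pow_lt; lra).
      assert (Hq4 : (0 < Cmod q ^ 4)%R) by (apply pow_lt; lra).
      assert (Hz0 : z0 <> 0).
      { intros E. rewrite E, Cmult_0_r, Cmod_0 in Hz. lra. }
      rewrite Cmod_mult, Cmod_pow in Hz.
      assert (Hd : (0 < (Cmod q ^ 4 * Cmod z0 - Cmod q ^ 2) / Cmod q ^ 4)%R)
        by (apply Rdiv_lt_0_compat; lra).
      eapply pnear_mono; [|apply pnear_and; [apply (pnear_lt z0 _ Hd)|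
        apply pnear_and; [apply (pnear_neq0 z0 Hz0)|apply (pnear_inv (fun w => theta q w <> 0) (p ^ k) z0 (Hpn k) Hz0);
        apply (theta_isolated q Hq); apply ratio_neq0; [apply Hpn|exact Hz0]]]].
      intros z [H1 [H2 H3]]. apply W_equation; try assumption.
      rewrite Cmod_mult, Cmod_pow. apply Rlt_div_r in H1; [|lra].
      pose proof (Cmod_close z z0). nra.
Qed.

End Final.

(** * Normalized expansions and the connection formulas *)

Definition expandable (f : C -> C) : Prop := exists c, expands f c.

Lemma expandable_ext (f g : C -> C) (e : R) : (0 < e)%R ->
  (forall P, (Cmod (P - 1) < e)%R -> f P = g P) -> expandable g -> expandable f.
Proof.
  intros He E [c H]. exists c. eapply expands_eqmod4; [|exact H].
  apply (eqmod4_near _ _ e He E).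
Qed.

Lemma expandable_mult (f g : C -> C) :
  expandable f -> expandable g -> expandable (fun P => f P * g P).
Proof. intros [c F] [d G]. eexists. apply (expands_mult _ _ _ _ F G). Qed.

Lemma expandable_inv (f : C -> C) : f 1 <> 0 -> expandable f -> expandable (fun P => / f P).
Proof.
  intros H1 [c F]. eexists. apply (expands_inv _ c); [|exact F].
  rewrite <- (expands_at_1 _ _ F). exact H1.
Qed.

Lemma expandable_pow (f : C -> C) (n : nat) : expandable f -> expandable (fun P => f P ^ n).
Proof.
  intros H; induction n as [|n IH].
  - eexists. eapply expands_eqmod4; [|apply (expands_affine 1 0)].
    apply eqmod4_near with 1%R; [lra|]. intros; simpl; ring.
  - apply (expandable_mult f (fun P => f P ^ n)); assumption.
Qed.

Lemma expandable_bounded (f : C -> C) : expandable f ->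
  exists B e, (0 < e)%R /\ forall P, (Cmod (P - 1) < e)%R -> (Cmod (f P) <= B)%R.
Proof.
  intros [c H]. destruct (expands_jet _ _ H) as [r [Hr J]].
  destruct (J r ltac:(lra)) as [B HB]. exists B, r. split; [exact Hr|]. intros P HP.
  replace P with (1 - (1 - P)) by ring. apply (jet_bound r Hr _ _ _ (1 - P) HB).
  rewrite <- Cmod_opp. replace (- (1 - P)) with (P - 1) by ring. exact HP.
Qed.

Lemma sum_n_m_bsum (a : nat -> C) (n : nat) : sum_n_m a 1 n = bsum (fun i => a (S i)) n.
Proof.
  induction n as [|n IH]; [exact (sum_n_m_zero a 1 0 (Nat.lt_0_succ 0))|].
  rewrite sum_n_Sm by lia. rewrite IH. reflexivity.
Qed.

(** Ordinary coefficients of an expansion with leading term [A] taken out. *)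
Definition denorm (A : C) (c : nat -> C) (b : nat) : C :=
  match b with O => A | S _ => A * c b end.

Lemma expands_norm_denorm (A : C) (f : C -> C) (c : nat -> C) :
  expands_norm A f c <-> expands f (denorm A c).
Proof.
  assert (E : forall P, A * (1 + sum_n_m (fun b => c b * (1 - P) ^ b) 1 3)
     = sum_n (fun b => denorm A c b * (1 - P) ^ b) 3).
  { intros P. rewrite cpol_sum_n. unfold cpol, denorm.
    rewrite sum_n_m_bsum. cbn [bsum].
    ring. }
  split; intros H; (eapply eqmod4_trans; [exact H|]);
    apply eqmod4_near with 1%R; try lra; intros P _; rewrite E; reflexivity.
Qed.

Lemma expands_norm_some (A : C) (f : C -> C) :
  A <> 0 -> f 1 = A -> expandable f ->
  expands_norm A f (some_coef (expands_norm A f)).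
Proof.
  intros HA H1 [c H].
  apply (epsilon_spec (inhabits (fun _ : nat => RtoC 0)) (expands_norm A f)).
  exists (fun b => c b / A). apply expands_norm_denorm.
  apply (expands_ext f c); [|exact H]. intros n Hn. destruct n as [|n].
  - rewrite <- (expands_at_1 _ _ H). exact H1.
  - simpl. field. exact HA.
Qed.

Section Conclusion.
Variables q p : C.
Hypothesis Hq : (0 < Cmod q < 1)%R.
Hypothesis Hp : p ^ 5 = q.

Let Hm : (0 < Cmod p < 1)%R := Cmod_p q p Hq Hp.
Let Hp0 : p <> 0 := p_neq0 q p Hq Hp.
Let Hpn : forall n, p ^ n <> 0 := pn_neq0 q p Hq Hp.
Let Hqn : forall n, q ^ n <> 0 := qn_neq0 q Hq.
Let Hq0 : q <> 0 := q_neq0 q Hq.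

Lemma expandable_qpoch (u : C) : expandable (fun P => qpoch_inf (P * u) q).
Proof.
  destruct (jet_qpoch_inf q Hq 1 Rlt_0_1 (fun t => u + - u * t) _ _ (jet_affine 1 u (- u)))
    as [d [B H]].
  exists d. apply (jet_expands 1 _ d B Rlt_0_1).
  eapply jet_ext; [|reflexivity|exact H]. intros t _. simpl. f_equal. ring.
Qed.

(** [1/P] is the geometric series in [1 - P]. *)
Lemma expandable_qpoch_inv (u : C) : expandable (fun P => qpoch_inf (/ P * u) q).
Proof.
  assert (Hr : (0 < / 2)%R) by lra.
  assert (Hs : (Cmod (- (1)) * / 2 < Cmod 1)%R) by (rewrite Cmod_m1, Cmod_1; lra).
  destruct (jet_qpoch_inf q Hq (/ 2) Hr _ _ _
    (jet_scal (/ 2) Hr u _ _ _ (jet_inv_affine (/ 2) Hr 1 (- (1)) Hs))) as [d [B H]].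
  exists d. apply (jet_expands (/ 2) _ d B Hr).
  eapply jet_ext; [|reflexivity|exact H]. intros t _. simpl. f_equal.
  rewrite Cmult_comm. do 2 f_equal. ring.
Qed.

Lemma qpoch_inf_p_neq0 (i : nat) : (1 <= i)%nat -> qpoch_inf (p ^ i) q <> 0.
Proof. intros Hi. apply qpoch_inf_neq0_small; [exact Hq|apply (ppow_small q p Hq Hp), Hi]. Qed.

Lemma qpoch_inf_q_neq0 : qpoch_inf q q <> 0.
Proof. apply qpoch_inf_neq0_small; [exact Hq|lra]. Qed.

Lemma Ffun_expandable : expandable (Ffun q p).
Proof.
  unfold Ffun, Cprod. cbn [map fold_right].
  apply (expandable_mult (fun P => qpoch_inf (P * p ^ 1) q * (qpoch_inf (P * p ^ 2) q
     * (qpoch_inf (P * p ^ 3) q * (qpoch_inf (P * p ^ 4) q * 1))))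
     (fun P => / (qpoch_inf (P * q) q ^ 4))).
  - apply expandable_mult; [apply expandable_qpoch|].
    apply expandable_mult; [apply expandable_qpoch|].
    apply expandable_mult; [apply expandable_qpoch|].
    apply expandable_mult; [apply expandable_qpoch|].
    exists (unit_seq 1 0). eapply expands_eqmod4; [|apply (expands_affine 1 0)].
    apply eqmod4_near with 1%R; [lra|]. intros; ring.
  - apply expandable_inv; [|apply expandable_pow, expandable_qpoch].
    rewrite Cmult_1_l. apply Cpow_nz, qpoch_inf_q_neq0.
Qed.

Lemma Flead_neq0 : Flead q p <> 0.
Proof.
  unfold Flead. apply ratio_neq0; [|apply Cpow_nz, qpoch_inf_q_neq0].
  apply Cprod_neq0. intros i Hi. apply qpoch_inf_p_neq0. simpl in Hi. lia.
Qed.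

Lemma FF_expands : expands_norm (Flead q p) (Ffun q p) (FF q p).
Proof.
  apply expands_norm_some; [apply Flead_neq0| |apply Ffun_expandable].
  unfold Ffun, Flead, Cprod. cbn [map fold_right]. rewrite !Cmult_1_l. reflexivity.
Qed.

Lemma q_div_p (k : nat) : (k <= 5)%nat -> q / p ^ k = p ^ (5 - k).
Proof.
  intros Hk. rewrite <- Hp. replace 5%nat with (5 - k + k)%nat at 1 by lia.
  rewrite Cpow_add_r. field. apply Hpn.
Qed.

Lemma theta_neg_p (k : nat) : (1 <= k <= 4)%nat ->
  theta q (- p ^ k) = qpoch_inf q q * (qpoch_inf (p ^ k) q * qpoch_inf (p ^ (5 - k)) q).
Proof.
  intros Hk. rewrite (jacobi_triple q Hq (p ^ k) (Hpn k)), q_div_p by lia. reflexivity.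
Qed.

Lemma theta_neg_pQ (k : nat) (Q : C) : (1 <= k <= 4)%nat -> Q <> 0 ->
  theta q (- p ^ k * Q)
  = qpoch_inf q q * (qpoch_inf (p ^ k * Q) q * qpoch_inf (p ^ (5 - k) / Q) q).
Proof.
  intros Hk HQ. replace (- p ^ k * Q) with (- (p ^ k * Q)) by ring.
  rewrite (jacobi_triple q Hq) by (apply Cmult_neq_0; auto).
  replace (q / (p ^ k * Q)) with (p ^ (5 - k) / Q) by (rewrite <- q_div_p by lia; field; auto).
  reflexivity.
Qed.

Lemma Glead_prod (k : nat) (Q : C) : (1 <= k <= 4)%nat -> Q <> 0 ->
  Glead q p k Q = (qpoch_inf (p ^ k * Q) q * qpoch_inf (p ^ (5 - k) / Q) q)
                  / (qpoch_inf (p ^ k) q * qpoch_inf (p ^ (5 - k)) q).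
Proof.
  intros Hk HQ. unfold Glead. rewrite theta_neg_pQ, theta_neg_p by assumption.
  pose proof (qpoch_inf_p_neq0 k ltac:(lia)). pose proof (qpoch_inf_p_neq0 (5 - k) ltac:(lia)).
  pose proof qpoch_inf_q_neq0. field. auto.
Qed.

Lemma GG_expands (k : nat) (Q : C) : (1 <= k <= 4)%nat -> Q <> 0 -> theta q (- p ^ k * Q) <> 0 ->
  expands_norm (Glead q p k Q) (Gfun q p k Q) (fun b => GG q p k b Q).
Proof.
  intros Hk HQ Ht.
  pose proof (qpoch_inf_p_neq0 k ltac:(lia)) as N1.
  pose proof (qpoch_inf_p_neq0 (5 - k) ltac:(lia)) as N2.
  apply (expands_norm_some (Glead q p k Q) (Gfun q p k Q)).
  - unfold Glead. apply ratio_neq0; [exact Ht|]. rewrite theta_neg_p by exact Hk.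
    repeat apply Cmult_neq_0; auto. apply qpoch_inf_q_neq0.
  - rewrite Glead_prod by assumption. unfold Gfun.
    assert (E1 : / RtoC 1 = 1) by (field; apply C1_nz).
    rewrite E1, !Cmult_1_l. rewrite (Cmult_comm (/ Q)). reflexivity.
  - unfold Gfun.
    apply (expandable_mult (fun P => qpoch_inf (P * p ^ k * Q) q * qpoch_inf (/ P * / Q * p ^ (5 - k)) q)
      (fun P => / (qpoch_inf (P * p ^ k) q * qpoch_inf (/ P * p ^ (5 - k)) q))).
    + apply expandable_mult.
      * apply (expandable_ext _ (fun P => qpoch_inf (P * (p ^ k * Q)) q) 1 Rlt_0_1);
          [intros; f_equal; ring|apply expandable_qpoch].
      * apply (expandable_ext _ (fun P => qpoch_inf (/ P * (/ Q * p ^ (5 - k))) q) 1 Rlt_0_1);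
          [intros; f_equal; ring|apply expandable_qpoch_inv].
    + apply expandable_inv; [|apply expandable_mult; [apply expandable_qpoch|apply expandable_qpoch_inv]].
      assert (E1 : / RtoC 1 = 1) by (field; apply C1_nz).
      rewrite E1, !Cmult_1_l. apply Cmult_neq_0; assumption.
Qed.

(** ** The connection formula for fixed [Q] *)

Lemma Cpowz_diff (i k : nat) : (1 <= i <= 4)%nat -> (1 <= k <= 4)%nat ->
  Cpowz p (Z.of_nat i - Z.of_nat k) = p ^ i / p ^ k.
Proof.
  intros Hi Hk. destruct (Nat.le_gt_cases k i) as [H|H].
  - replace (Z.of_nat i - Z.of_nat k)%Z with (Z.of_nat (i - k)) by lia.
    rewrite Cpowz_nat. replace (p ^ i) with (p ^ (i - k) * p ^ k)
      by (rewrite <- Cpow_add_r; f_equal; lia). field. apply Hpn.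
  - replace (Z.of_nat i - Z.of_nat k)%Z with (- Z.of_nat (S (k - i - 1)))%Z by lia.
    rewrite Cpowz_neg. replace (p ^ k) with (p ^ S (k - i - 1) * p ^ i)
      by (rewrite <- Cpow_add_r; f_equal; lia). field. split; apply Hpn.
Qed.

Lemma Cprod_ext (l : list nat) (f g : nat -> C) :
  (forall i, In i l -> f i = g i) -> Cprod l f = Cprod l g.
Proof.
  unfold Cprod. induction l as [|i l IH]; intros H; simpl; [reflexivity|].
  rewrite (H i) by (left; reflexivity). rewrite IH; [reflexivity|].
  intros; apply H; right; assumption.
Qed.

Section FixedQ.
Variable Q : C.
Hypothesis HQ : annulus q Q.
Hypothesis HQ1 : qpoch_inf Q q <> 0.
Hypothesis HQ2 : qpoch_inf (q / Q) q <> 0.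

Let HQ0 : Q <> 0.
Proof. apply Cmod_gt_0. unfold annulus in HQ. pose proof (pow2_ge_0 (Cmod q)). lra. Qed.

Let phi (k : nat) : C := pser (phi_coef q p k) (q ^ 2 / Q).

Lemma theta_unit_neq0 : theta_unit q Q <> 0.
Proof.
  unfold theta_unit. pose proof qpoch_inf_q_neq0.
  apply ratio_neq0; apply Cmult_neq_0; assumption.
Qed.

(** The factors of [Ccon] regroup into the limit of the residues and the values at
    [P = 1] of [Ffun] and [Gfun]. *)
Lemma Ccon_factor (k : nat) : (1 <= k <= 4)%nat ->
  Ccon q p k Q = kap q p k / theta_unit q Q * (Flead q p * Glead q p k Q).
Proof.
  intros Hk. rewrite Glead_prod by assumption.
  unfold Ccon, kap, theta_unit, Flead.
  rewrite (Cprod_ext (others k) (fun i => qpoch_inf (Cpowz p (Z.of_nat i - Z.of_nat k)) q)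
            (fun i => qpoch_inf (p ^ i / p ^ k) q)).
  2:{ intros i Hi. apply others_range in Hi. rewrite Cpowz_diff by lia. reflexivity. }
  assert (HD : Cprod (others k) (fun i => qpoch_inf (p ^ i / p ^ k) q) <> 0).
  { apply Cprod_neq0. intros i Hi. apply others_range in Hi.
    apply qpoch_inf_neq0; [exact Hq|]. intros j. apply (p_ratio_neq1 q p Hq Hp); lia. }
  assert (HF : Cprod [1; 2; 3; 4]%nat (fun i => qpoch_inf (p ^ i) q)
     = qpoch_inf (p ^ k) q * Cprod (others k) (fun i => qpoch_inf (p ^ i) q)).
  { destruct k as [|[|[|[|[|k]]]]]; try lia; unfold others, Cprod;
      cbn [filter map fold_right Nat.eqb negb]; ring. }
  rewrite HF.
  pose proof (qpoch_inf_p_neq0 k ltac:(lia)) as N1.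
  pose proof (qpoch_inf_p_neq0 (5 - k) ltac:(lia)) as N2.
  pose proof qpoch_inf_q_neq0 as N3.
  generalize dependent (Cprod (others k) (fun i => qpoch_inf (p ^ i / p ^ k) q)).
  generalize (Cprod (others k) (fun i => qpoch_inf (p ^ i) q)).
  generalize (qpoch_inf (p ^ k * Q) q) (qpoch_inf (p ^ (5 - k) / Q) q).
  generalize dependent (qpoch_inf (p ^ k) q). generalize dependent (qpoch_inf (p ^ (5 - k)) q).
  generalize dependent (qpoch_inf q q). generalize dependent (qpoch_inf (q / Q) q).
  generalize dependent (qpoch_inf Q q). intros. field. repeat split; assumption.
Qed.

(** The product over all factors after the [j]-th is the whole product divided by
    the first [j] factors. *)
Lemma quot_inf_Rterm (P : C) (j : nat) : near1 p P ->
  quot_inf q p (P * q ^ j) = / Ffun q p P * Rterm q p j P.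
Proof.
  intros HP. pose proof (near1_bounds q p Hq Hp P HP) as [B1 [B2 [B3 [B4 B5]]]].
  assert (Hsm : forall i, (1 <= i)%nat -> (Cmod (P * p ^ i) < 1)%R).
  { intros i Hi. rewrite Cmult_comm. pose proof (near1_num q p Hq Hp P i HP Hi). lra. }
  unfold quot_inf, Ffun, Rterm, Cprod. cbn [map fold_right].
  assert (E : forall i, (1 <= i)%nat -> qpoch (P * p ^ i) q j <> 0 /\
    qpoch_inf (p ^ i * (P * q ^ j)) q <> 0 /\
    qpoch_inf (P * p ^ i) q = qpoch (P * p ^ i) q j * qpoch_inf (p ^ i * (P * q ^ j)) q).
  { intros i Hi. pose proof (Hsm i Hi) as Hs.
    assert (E1 : qpoch_inf (P * p ^ i) q = qpoch (P * p ^ i) q j * qpoch_inf (p ^ i * (P * q ^ j)) q).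
    { rewrite (qpoch_inf_split q Hq (P * p ^ i) j). do 2 f_equal. ring. }
    split; [apply qpoch_neq0_small; assumption|]. split; [|exact E1].
    intros Z. apply (qpoch_inf_neq0_small q Hq _ Hs). rewrite E1, Z; ring. }
  destruct (E 1%nat ltac:(lia)) as [X1 [Y1 ->]]. destruct (E 2%nat ltac:(lia)) as [X2 [Y2 ->]].
  destruct (E 3%nat ltac:(lia)) as [X3 [Y3 ->]]. destruct (E 4%nat ltac:(lia)) as [X4 [Y4 ->]].
  pose proof (E 5%nat ltac:(lia)) as E5. rewrite Hp in E5. destruct E5 as [X5 [Y5 ->]].
  field. repeat split; assumption.
Qed.

Lemma theta_ratio_Gfun (k : nat) (P : C) : (1 <= k <= 4)%nat -> P <> 0 ->
  theta_ratio q p Q k P = Gfun q p k Q P.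
Proof.
  intros Hk HP. unfold theta_ratio, Gfun. rewrite <- q_div_p by lia.
  replace (q / (P * p ^ k * Q)) with (/ P * / Q * (q / p ^ k)) by (field; auto).
  replace (q / (P * p ^ k)) with (/ P * (q / p ^ k)) by (field; auto).
  reflexivity.
Qed.

Lemma Xfun_connection :
  eqmod4 (Xfun q p Q) (fun P => sum4 (fun k =>
     (kap q p k * phi k / theta_unit q Q) * (Ffun q p P * Gfun q p k Q P))).
Proof.
  destruct (connection_series_mod4 q p Hq Hp Q HQ) as [M HM].
  destruct (expandable_bounded _ Ffun_expandable) as [B [e [He HB]]].
  destruct (Rterm_jet q p Hq Hp) as [C [BR [_ J]]].
  pose proof theta_unit_neq0 as HT.
  assert (Hqp : (Cmod q <= Cmod p)%R).
  { rewrite <- Hp, Cmod_pow. simpl.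
    assert (Cmod p ^ 4 <= 1)%R by (rewrite <- (pow1 4); apply pow_incr; lra). simpl in *. nra. }
  exists (Rabs M * (Rabs B * Cmod (/ theta_unit q Q)))%R, (Rmin e ((1 - Cmod p) / 2)).
  split; [apply Rmin_glb_lt; lra|]. intros P HPe.
  pose proof (Rmin_l e ((1 - Cmod p) / 2)); pose proof (Rmin_r e ((1 - Cmod p) / 2)).
  assert (HP : near1 p P) by (unfold near1; lra).
  pose proof (near1_neq0 q p Hq Hp P HP) as HP0.
  specialize (HM P HP). specialize (HB P ltac:(lra)).
  assert (HS : Summable (fun j => Rterm q p j P * Q ^ j)).
  { apply (Summable_bounded_geom _ BR); [apply HQ|]. intros d.
    replace P with (1 - (1 - P)) by ring.
    apply (jet_bound ((1 - Cmod q) / 2) ltac:(lra) _ _ _ (1 - P) (J d)).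
    rewrite <- Cmod_opp. replace (- (1 - P)) with (P - 1) by ring. lra. }
  assert (E1 : Csum (fun j => theta_unit q Q * (quot_inf q p (P * q ^ j) * Q ^ j))
     = theta_unit q Q * / Ffun q p P * Xfun q p Q P).
  { rewrite (Csum_ext _ (fun j => theta_unit q Q * / Ffun q p P * (Rterm q p j P * Q ^ j))).
    - rewrite Csum_scal by exact HS. reflexivity.
    - intros j. rewrite quot_inf_Rterm by exact HP. ring. }
  assert (HSp : forall k, (1 <= k <= 4)%nat -> Summable (fun n => phi_coef q p k n * (q ^ 2 / Q) ^ n)).
  { intros k Hk. apply (psconv_Summable _ 1 _ (phi_psconv q p Hq Hp k Hk)).
    rewrite Cmod_div, Cmod_pow by exact HQ0. destruct HQ. apply Rlt_div_l; [apply Cmod_gt_0, HQ0|lra]. }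
  assert (E2 : Csum (fun n => sum4 (fun k =>
            (kap q p k * theta_ratio q p Q k P) * (phi_coef q p k n * (q ^ 2 / Q) ^ n)))
     = sum4 (fun k => kap q p k * Gfun q p k Q P * phi k)).
  { set (tr := fun k => kap q p k * theta_ratio q p Q k P).
    pose proof (Summable_scal (tr 1%nat) _ (HSp 1%nat ltac:(lia))) as S1.
    pose proof (Summable_scal (tr 2%nat) _ (HSp 2%nat ltac:(lia))) as S2.
    pose proof (Summable_scal (tr 3%nat) _ (HSp 3%nat ltac:(lia))) as S3.
    pose proof (Summable_scal (tr 4%nat) _ (HSp 4%nat ltac:(lia))) as S4.
    pose proof (Summable_plus _ _ S1 S2) as S12. pose proof (Summable_plus _ _ S12 S3) as S123.
    transitivity (tr 1%nat * phi 1 + tr 2%nat * phi 2 + tr 3%nat * phi 3 + tr 4%nat * phi 4).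
    - unfold phi, pser. rewrite <- !Csum_scal by (apply HSp; lia).
      rewrite <- (Csum_plus _ _ S1 S2), <- (Csum_plus _ _ S12 S3), <- (Csum_plus _ _ S123 S4).
      reflexivity.
    - unfold tr. rewrite !theta_ratio_Gfun by (lia || exact HP0). reflexivity. }
  rewrite E1, E2 in HM.
  assert (HF : Ffun q p P <> 0).
  { intros Z. pose proof (quot_inf_Rterm P 0 HP) as EZ. 
    unfold Ffun in Z. revert Z.
    assert (Hsm : forall i, (1 <= i)%nat -> qpoch_inf (P * p ^ i) q <> 0).
    { intros i Hi. apply qpoch_inf_neq0_small; [exact Hq|]. rewrite Cmult_comm.
      pose proof (near1_num q p Hq Hp P i HP Hi).
      pose proof (near1_bounds q p Hq Hp P HP) as [_ [_ [_ [_ B5]]]]. lra. }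
    apply ratio_neq0.
    - apply Cprod_neq0. intros i Hi. apply Hsm. simpl in Hi. lia.
    - apply Cpow_nz. pose proof (Hsm 5%nat ltac:(lia)) as H5. rewrite Hp in H5. exact H5. }
  match goal with |- (Cmod (?x - ?y) <= _)%R =>
    replace (x - y) with ((theta_unit q Q * / Ffun q p P * Xfun q p Q P
       - sum4 (fun k => kap q p k * Gfun q p k Q P * phi k)) * (Ffun q p P * / theta_unit q Q)) end.
  2:{ unfold sum4. field. split; assumption. }
  rewrite Cmod_mult.
  replace (Rabs M * (Rabs B * Cmod (/ theta_unit q Q)) * Cmod (1 - P) ^ 4)%R
    with (Rabs M * Cmod (1 - P) ^ 4 * (Rabs B * Cmod (/ theta_unit q Q)))%R by ring.
  apply Rmult_le_compat; try apply Cmod_ge_0.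
  - eapply Rle_trans; [exact HM|]. apply Rmult_le_compat_r; [apply pow_le, Cmod_ge_0|apply Rle_abs].
  - rewrite Cmod_mult. apply Rmult_le_compat_r; [apply Cmod_ge_0|].
    eapply Rle_trans; [exact HB|apply Rle_abs].
Qed.

Hypothesis HQ3 : forall k, (1 <= k <= 4)%nat -> theta q (- p ^ k * Q) <> 0.
Hypothesis HQ4 : theta q (1 / Q) <> 0.
Hypothesis HQ5 : forall k, (1 <= k <= 4)%nat -> theta q (p ^ k / Q) <> 0.

(** Uniqueness of expansions: the coefficient of order [b] in [Ffun * Gfun] is the
    convolution of the two expansions, whose leading terms are inside [Ccon]. *)
Lemma X_connection (b : nat) (coef : nat -> C -> C) : (b <= 3)%nat ->
  (forall k, (1 <= k <= 4)%nat ->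
     conv (denorm (Flead q p) (FF q p))
          (denorm (Glead q p k Q) (fun b => GG q p k b Q)) b
     = Flead q p * Glead q p k Q * coef k Q) ->
  X q p b Q = connection q p coef Q.
Proof.
  intros Hb Hcoef.
  pose proof (proj1 (expands_norm_denorm _ _ _) FF_expands) as HF.
  set (Kk := fun k => kap q p k * phi k / theta_unit q Q).
  assert (HG : forall k, (1 <= k <= 4)%nat -> expands (fun P => Kk k * (Ffun q p P * Gfun q p k Q P))
     (fun n => Kk k * conv (denorm (Flead q p) (FF q p))
          (denorm (Glead q p k Q) (fun b => GG q p k b Q)) n)).
  { intros k Hk. apply expands_scal, expands_mult; [exact HF|].
    apply expands_norm_denorm, GG_expands; auto. }
  assert (HX : X q p b Q = sum4 (fun k => Kk k * (Flead q p * Glead q p k Q * coef k Q))).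
  { unfold sum4. rewrite <- !Hcoef by lia.
    apply (expands_unique (Xfun q p Q) (fun b => X q p b Q)
      (fun n => Kk 1%nat * conv (denorm (Flead q p) (FF q p))
          (denorm (Glead q p 1 Q) (fun b => GG q p 1 b Q)) n
        + Kk 2%nat * conv (denorm (Flead q p) (FF q p))
          (denorm (Glead q p 2 Q) (fun b => GG q p 2 b Q)) n
        + Kk 3%nat * conv (denorm (Flead q p) (FF q p))
          (denorm (Glead q p 3 Q) (fun b => GG q p 3 b Q)) n
        + Kk 4%nat * conv (denorm (Flead q p) (FF q p))
          (denorm (Glead q p 4 Q) (fun b => GG q p 4 b Q)) n) b Hb).
    - apply (X_expands q p Hq Hp). apply HQ.
    - eapply expands_eqmod4; [apply Xfun_connection|].
      unfold sum4. repeat apply expands_plus; apply HG; lia. }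
  rewrite HX. unfold connection.
  rewrite sum_n_m_bsum. cbn [bsum]. rewrite Cplus_0_l.
  assert (E : forall k, (1 <= k <= 4)%nat ->
    Ccon q p k Q * coef k Q * / eq_lam q (p ^ k) (/ Q) * W q p k (/ Q)
    = Kk k * (Flead q p * Glead q p k Q * coef k Q)).
  { intros k Hk. rewrite Ccon_factor by exact Hk.
    rewrite (W_eq q p) by exact Hk.
    assert (HE : eq_lam q (p ^ k) (/ Q) <> 0).
    { unfold eq_lam. apply ratio_neq0.
      - replace (/ Q) with (1 / Q) by (field; exact HQ0). exact HQ4.
      - apply (HQ5 k Hk). }
    unfold Kk, phi. change (q ^ 2 * / Q) with (q ^ 2 / Q).
    pose proof theta_unit_neq0. field. split; assumption. }
  unfold sum4. rewrite <- !E by lia. reflexivity.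
Qed.

End FixedQ.

(** The points excluded in the formula for fixed [Q] are isolated. *)
Lemma connection_mero_eq (b : nat) (coef : nat -> C -> C) : (b <= 3)%nat ->
  (forall k Q,
     conv (denorm (Flead q p) (FF q p))
          (denorm (Glead q p k Q) (fun b => GG q p k b Q)) b
     = Flead q p * Glead q p k Q * coef k Q) ->
  mero_eq (annulus q) (X q p b) (connection q p coef).
Proof.
  intros Hb Hcoef. apply mero_eq_of_holo.
  - intros z0 Hz. apply holo_mero, (X_holo q p Hq Hp); [exact Hb|apply Hz].
  - intros z0 Hz. unfold annulus in Hz.
    assert (Hq2 : (0 < Cmod q ^ 2)%R) by (apply pow_lt; lra).
    assert (Hz0 : z0 <> 0) by (apply Cmod_gt_0; lra).
    assert (A1 : pnear z0 (annulus q)).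
    { apply (pnear_mono z0 (fun z => (Cmod (z - z0) < Cmod z0 - Cmod q ^ 2)%R
                                     /\ (Cmod (z - z0) < 1 - Cmod z0)%R)).
      - intros z [H1 H2]. unfold annulus. pose proof (Cmod_close z z0). lra.
      - apply pnear_and; apply pnear_lt; lra. }
    assert (A2 : pnear z0 (fun z => qpoch_inf z q <> 0)) by apply (qpoch_inf_isolated q Hq).
    assert (A3 : pnear z0 (fun z => qpoch_inf (q / z) q <> 0)).
    { apply (pnear_inv (fun w => qpoch_inf w q <> 0) q z0 Hq0 Hz0), (qpoch_inf_isolated q Hq). }
    assert (A4 : forall c, c <> RtoC 0 -> pnear z0 (fun z => theta q (c * z) <> 0)).
    { intros c Hc. apply (pnear_scal (fun w => theta q w <> 0) c z0 Hc), (theta_isolated q Hq).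
      apply Cmult_neq_0; assumption. }
    assert (A5 : forall c, c <> RtoC 0 -> pnear z0 (fun z => theta q (c / z) <> 0)).
    { intros c Hc. apply (pnear_inv (fun w => theta q w <> 0) c z0 Hc Hz0), (theta_isolated q Hq).
      apply ratio_neq0; assumption. }
    assert (Hneg : forall k, - p ^ k <> 0).
    { intros k E. apply (Hpn k). replace (p ^ k) with (- - p ^ k) by ring. rewrite E; ring. }
    pose proof (pnear_and _ _ _ A1 (pnear_and _ _ _ A2 (pnear_and _ _ _ A3 (pnear_and _ _ _ (A5 1 C1_nz)
      (pnear_and _ _ _ (pnear_and _ _ _ (A4 _ (Hneg 1%nat)) (pnear_and _ _ _ (A4 _ (Hneg 2%nat))
         (pnear_and _ _ _ (A4 _ (Hneg 3%nat)) (A4 _ (Hneg 4%nat)))))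
       (pnear_and _ _ _ (A5 _ (Hpn 1%nat)) (pnear_and _ _ _ (A5 _ (Hpn 2%nat))
         (pnear_and _ _ _ (A5 _ (Hpn 3%nat)) (A5 _ (Hpn 4%nat)))))))))) as A.
    eapply pnear_mono; [|exact A].
    intros z [B1 [B2 [B3 [B4 [[C1 [C2 [C3 C4]]] [D1 [D2 [D3 D4]]]]]]]].
    apply X_connection; auto.
    + intros k Hk. destruct k as [|[|[|[|[|k]]]]]; try lia; assumption.
    + intros k Hk. destruct k as [|[|[|[|[|k]]]]]; try lia; assumption.
Qed.

End Conclusion.

Theorem corollary5p5 :
  forall (q p : C) (hq : (0 < Cmod q < 1)%R) (hp : p ^ 5 = q),
  (* the expansions defining X_b, F_b and G^(k)_b exist *)
  (forall Q : C, (Cmod Q < 1)%R ->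
     expands (Xfun q p Q) (fun b => X q p b Q)) /\
  expands_norm (Flead q p) (Ffun q p) (FF q p) /\
  (forall (k : nat) (Q : C), (1 <= k <= 4)%nat -> Q <> 0 ->
     theta q (- p ^ k * Q) <> 0 ->
     expands_norm (Glead q p k Q) (Gfun q p k Q) (fun b => GG q p k b Q)) /\
  (* solutions at Q = 0 and at Q = infinity *)
  (forall m : nat, (m <= 3)%nat ->
     qdiff_solution q p punctured_unit_disc (sol0 q p m)) /\
  (forall k : nat, (1 <= k <= 4)%nat ->
     qdiff_solution q p (near_infinity q) (fun Q => W q p k (/ Q))) /\
  (* connection formulas *)
  mero_eq (annulus q) (X q p 0) (connection q p (fun k Q => 1)) /\
  mero_eq (annulus q) (X q p 1)
    (connection q p (fun k Q => GG q p k 1 Q + FF q p 1)) /\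
  mero_eq (annulus q) (X q p 2)
    (connection q p (fun k Q =>
       GG q p k 2 Q + FF q p 2 + GG q p k 1 Q * FF q p 1)) /\
  mero_eq (annulus q) (X q p 3)
    (connection q p (fun k Q =>
       GG q p k 3 Q + FF q p 3 + GG q p k 2 Q * FF q p 1
       + GG q p k 1 Q * FF q p 2)).
Proof.
  intros q p hq hp.
  split; [intros Q HQ; apply (X_expands q p hq hp Q HQ)|].
  split; [apply (FF_expands q p hq hp)|].
  split; [intros k Q Hk HQ Ht; apply (GG_expands q p hq hp k Q Hk HQ Ht)|].
  split; [intros m Hm; apply (sol0_solution q p hq hp m Hm)|].
  split; [intros k Hk; apply (W_solution q p hq hp k Hk)|].
  split; [|split; [|split]]; apply (connection_mero_eq q p hq hp); try lia; intros k Q.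
  - rewrite conv_0. unfold denorm. ring.
  - rewrite conv_1. unfold denorm. ring.
  - rewrite conv_2. unfold denorm. ring.
  - rewrite conv_3. unfold denorm. ring.
Qed.
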